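(* Let $d\ge 1$ and let $H:\Omega_f\to\mathbb{R}\cup\{+\infty\}$ be a measurable energy function which is stationary, hereditary, non-degenerate, stable and finite range. Assume moreover that: (1) for every $P\in\mathcal{P}$ the mean energy $$H(P):=\lim_{n\to\infty}\frac{1}{|\Lambda_n|}\int H(\omega_{\Lambda_n})\,P(d\omega)$$ exists; (2) for every Gibbs measure $P\in\mathcal{G}_H$, $$\lim_{n\to\infty}\frac{1}{|\Lambda_n|}\int \partial H_{\Lambda_n}(\omega)\,P(d\omega)=0,\qquad\text{where } \partial H_{\Lambda_n}(\omega)=H_{\Lambda_n}(\omega)-H(\omega_{\Lambda_n}).$$ Then for every $P\in\mathcal{P}$, $$\mathcal{I}(P)+H(P)\ \ge\ -p_H,$$ with equality if and only if $P$ is a Gibbs measure for $H$, i.e. $P\in\mathcal{G}_H$.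
   Context: **Configurations.** A configuration is a locally finite subset $\omega\subset\mathbb{R}^d$; $\Omega$ is the set of configurations, equipped with the $\sigma$-algebra $\mathcal{F}$ generated by the counting variables $N_\Lambda(\omega)=\#(\omega\cap\Lambda)$, $\Lambda\subset\mathbb{R}^d$ bounded Borel. $\Omega_f$ is the set of finite configurations and $N(\omega)$ is the cardinality of $\omega\in\Omega_f$. $\Lambda$ always denotes a bounded Borel set, $|\Lambda|$ its Lebesgue measure, $\Lambda^c$ its complement, and $\omega_\Lambda=\omega\cap\Lambda$. $\tau_u$ is translation by $u\in\mathbb{R}^d$, acting on $\mathbb{R}^d$ and on $\Omega$. $\Lambda_n=[-n,n]^d$, $n\ge1$. **Reference measure.** $\pi$ is the law on $\Omega$ of the Poisson point process with intensity the Lebesgue measure on $\mathbb{R}^d$; $\pi_\Lambda$ is its restriction to $\Lambda$, i.e. the law of $\omega_\Lambda$ under $\pi$. Likewise $P_\Lambda$ is the law of $\omega_\Lambda$ under $P$. **Stationary measures.** $\mathcal{P}$ is the set of probability measures $P$ on $(\Omega,\mathcal{F})$ that are stationary ($P=P\circ\tau_u^{-1}$ for all $u\in\mathbb{R}^d$) and have finite intensity ($E_P(N_{[0,1]^d})<+\infty$). **Assumptions on $H$.** For a measurable $H:\Omega_f\to\mathbb{R}\cup\{+\infty\}$: - stationary: $H(\tau_u\omega)=H(\omega)$ for all $\omega\in\Omega_f$, $u\in\mathbb{R}^d$; - hereditary: $H(\omega)=+\infty$ implies $H(\omega\cup\{x\})=+\infty$ for all $\omega\in\Omega_f$, $x\in\mathbb{R}^d$;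 - non-degenerate: $H(\{0\})\ne+\infty$ and $H(\emptyset)=0$; - stable: there is $A>0$ with $H(\omega)\ge -A\,N(\omega)$ for all $\omega\in\Omega_f$; - finite range: there is $R\ge0$ such that for every configuration $\omega\in\Omega$ and every bounded $\Lambda$, the quantity $H_\Lambda(\omega):=H(\omega_{\Lambda'})-H(\omega_{\Lambda'\setminus\Lambda})$ (with the convention $\infty-\infty=0$) does not depend on the choice of the bounded set $\Lambda'$ as soon as $\Lambda\oplus B(0,R)\subset\Lambda'$. Here $\oplus$ is the Minkowski sum and $B(0,R)$ the ball of radius $R$ centred at $0$. **Gibbs measures.** $\Omega_\infty$ is the set of $\omega\in\Omega$ such that $H(\omega_\Lambda)<+\infty$ for every bounded $\Lambda$. For bounded $\Lambda$ put $$f_\Lambda(\omega)=\frac{1}{Z_\Lambda(\omega_{\Lambda^c})}e^{-H_\Lambda(\omega)},\qquad Z_\Lambda(\omega_{\Lambda^c})=\int e^{-H_\Lambda(\omega'_\Lambda\cup\omega_{\Lambda^c})}\,\pi_\Lambda(d\omega'_\Lambda).$$ A probability measure $P$ on $\Omega$ is a Gibbs measure for $H$ if $P(\Omega_\infty)=1$ and, for every bounded Borel set $\Lambda$ and every bounded measurable $g:\Omega\to\mathbb{R}$, $$\int g(\omega)\,P(d\omega)=\int\!\!\int g(\omega'_\Lambda\cup\omega_{\Lambda^c})\,f_\Lambda(\omega'_\Lambda\cup\omega_{\Lambda^c})\,\pi_\Lambda(d\omega'_\Lambda)\,P(d\omega).$$ $\mathcal{G}_H$ is the set of all Gibbs measures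 for $H$. **Macroscopic quantities.** For probability measures $\mu,\nu$, $\mathcal{I}(\mu,\nu)=\int\ln f\,d\mu$ if $\mu\ll\nu$ with density $f$, and $\mathcal{I}(\mu,\nu)=+\infty$ otherwise. The specific entropy of $P\in\mathcal{P}$ is $\mathcal{I}(P)=\lim_{n\to\infty}\frac{1}{|\Lambda_n|}\mathcal{I}(P_{\Lambda_n},\pi_{\Lambda_n})\in[0,+\infty]$ (this limit always exists). The pressure is $p_H=\lim_{n\to\infty}\frac{1}{|\Lambda_n|}\ln Z_n$, where $Z_n=Z_{\Lambda_n}(\emptyset)=\int e^{-H(\omega)}\,\pi_{\Lambda_n}(d\omega)$ (when $H$ is stationary, hereditary, non-degenerate, stable and finite range, this limit exists and is finite). The mean energy $H(P)$ takes values in $\mathbb{R}\cup\{+\infty\}$. *)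

(* Defs.v *)
From HB Require Import structures.
From mathcomp Require Import all_boot all_order all_algebra finmap.
From mathcomp Require Import all_classical all_reals all_analysis.
From mathcomp Require Import measurable_realfun.

Set Implicit Arguments.
Unset Strict Implicit.
Unset Printing Implicit Defensive.

Import Order.TTheory GRing.Theory Num.Theory.
Import numFieldTopology.Exports numFieldNormedType.Exports.

Local Open Scope classical_set_scope.
Local Open Scope ring_scope.

Section Space.
Context {R : realType} {d : nat}.

(* [bounded_set] refers to the sup norm on 'rV[R]_d, which is equivalent to
   the Euclidean one. *)
Record window := Window {
  window_set :> set 'rV[R]_d ;
  window_bounded : bounded_set window_set ;
  window_borel : <<s @open 'rV[R]_d >> window_set }.

Definition box (a b : R) : set 'rV[R]_d :=
  [set x | forall i, a <= x ord0 i <= b].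

(* Closed, so that for r = 0 the ball is {0} and not the empty set. *)
Definition euclidean_ball (r : R) : set 'rV[R]_d :=
  [set x | Num.sqrt (\sum_i x ord0 i ^+ 2) <= r].

Definition minkowski_sum (A B : set 'rV[R]_d) : set 'rV[R]_d :=
  [set x + y | x in A & y in B].

Lemma bounded_setS (A B : set 'rV[R]_d) :
  A `<=` B -> bounded_set B -> bounded_set A.
Proof.
move=> AB [M [Mr MB]]; exists M; split=> // x Mx y Ay.
by apply: MB => //; exact: AB.
Qed.

Lemma bounded_set_shift (u : 'rV[R]_d) (A : set 'rV[R]_d) :
  bounded_set A -> bounded_set [set x | A (u + x)].
Proof.
move=> [M [Mr MA]]; exists (M + 1 + `|u|); split; first exact: num_real.
move=> y My x /= Ax.
have := MA (M + 1) (ltr_pwDr ltr01 (lexx M)) _ Ax => Mux.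
apply: (le_trans _ (ltW My)).
have -> : x = (u + x) - u by rewrite addrC addKr.
by rewrite (le_trans (ler_normB _ _))// lerD2r.
Qed.

Lemma closed_box a b : closed (box a b).
Proof.
have -> : box a b =
    \bigcap_(i in [set: 'I_d]) ((fun x : 'rV[R]_d => x ord0 i) @^-1` `[a, b]).
  apply/seteqP; split=> [x xab i _ /=|x xab i].
    by rewrite in_itv /=; exact: xab.
  by have := xab i I; rewrite /= in_itv.
apply: closed_bigI => i _.
apply: preimage_closed; last exact: interval_closed.
by move=> x _; exact: coord_continuous.
Qed.

Lemma borel_box a b : <<s @open 'rV[R]_d >> (box a b).
Proof.
rewrite -[box a b]setCK -setTD; apply: sigma_algebraCD.
by apply: sub_sigma_algebra; apply: closed_openC; exact: closed_box.
Qed.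

Lemma bounded_box a b : bounded_set (box a b).
Proof.
exists (`|a| + `|b|); split; first exact: num_real.
move=> M abM x xab; apply: (le_trans _ (ltW abM)).
rewrite [leLHS]/Num.norm /= mx_normrE; apply/bigmax_leP.
split; first exact: addr_ge0.
move=> [i j] _ /=; rewrite (ord1 i); have /andP[ax xb] := xab j.
rewrite ler_norml; apply/andP; split.
  apply: le_trans ax; rewrite opprD lerBlDr.
  by rewrite (le_trans (lerNnormlW (lexx _)))// lerDl.
by rewrite (le_trans xb)// (le_trans (ler_norm b))// lerDr.
Qed.

Definition box_window (a b : R) : window :=
  Window (bounded_box a b) (borel_box a b).

End Space.
Arguments window : clear implicits.

(* The product of d copies of the one-dimensional Lebesgue measure, computed
   by iterated integrals of sections: for Borel A, this is its volume |A|. *)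
Fixpoint lebesgue_rV {R : realType} (d : nat) : set 'rV[R]_d -> \bar R :=
  match d with
  | 0 => fun A : set 'rV[R]_0 => (\1_A 0)%:E
  | d'.+1 => fun A : set 'rV[R]_d'.+1 =>
      (\int[lebesgue_measure]_(t in [set: R])
         lebesgue_rV
           [set v : 'rV[R]_d' | A (row_mx t%:M v : 'rV[R]_(1 + d'))])%E
  end.

Section Configurations.
Context {R : realType} {d : nat}.

Record config := Config {
  points :> set 'rV[R]_d ;
  locally_finite : forall A, bounded_set A -> finite_set (points `&` A) }.

HB.instance Definition _ := gen_eqMixin config.
HB.instance Definition _ := gen_choiceMixin config.

Lemma locally_finite0 (A : set 'rV[R]_d) :
  bounded_set A -> finite_set (set0 `&` A).
Proof. by rewrite set0I. Qed.

Definition empty_config : config := Config locally_finite0.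

HB.instance Definition _ := isPointed.Build config empty_config.

Lemma locally_finite1 (x : 'rV[R]_d) A :
  bounded_set A -> finite_set ([set x] `&` A).
Proof. by move=> _; exact: finite_setIl. Qed.

Definition singleton_config (x : 'rV[R]_d) : config :=
  Config (locally_finite1 x).

Lemma locally_finiteU (w w' : config) A :
  bounded_set A -> finite_set ((w `|` w') `&` A).
Proof.
by move=> bA; rewrite setIUl finite_setU; split; exact: locally_finite.
Qed.

Definition union_config (w w' : config) : config :=
  Config (locally_finiteU w w').

Lemma locally_finiteI (B : set 'rV[R]_d) (w : config) A :
  bounded_set A -> finite_set ((w `&` B) `&` A).
Proof.
by move=> bA; rewrite setIAC; apply: finite_setIl; exact: locally_finite.
Qed.

Definition restrict_config (B : set 'rV[R]_d) (w : config) : config :=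
  Config (locally_finiteI B w).

Lemma locally_finite_shift (u : 'rV[R]_d) (w : config) A :
  bounded_set A -> finite_set ([set u + x | x in w] `&` A).
Proof.
move=> bA.
have fA := locally_finite w (bounded_set_shift u bA).
apply: sub_finite_set (finite_image (fun x => u + x) fA).
by move=> _ [[x wx <-] Aux]; exists x.
Qed.

Definition translate (u : 'rV[R]_d) (w : config) : config :=
  Config (locally_finite_shift u w).

Definition finite_config : set config := [set w | finite_set w].

(* Meaningful when w `&` A is finite; [fset_set] of an infinite set is empty. *)
Definition npoints (A : set 'rV[R]_d) (w : config) : nat :=
  #|` fset_set (w `&` A)|.

Definition counting_events : set (set config) :=
  [set C | exists (L : window R d) (k : nat), C = npoints L @^-1` [set k]].

End Configurations.
Arguments config : clear implicits.
Arguments counting_events : clear implicits.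

Notation Omega R d := (g_sigma_algebraType (counting_events R d)).

Section Restriction.
Context {R : realType} {d : nat}.
Implicit Type L : window R d.

Definition window_restrict L : Omega R d -> Omega R d := restrict_config L.

Lemma measurable_window_restrict L :
  measurable_fun [set: Omega R d] (window_restrict L).
Proof.
apply: (@measurability _ _ (Omega R d) (Omega R d) _ _
  (counting_events R d)) => //.
move=> _ [_ [L' [k ->]] <-]; rewrite setTI.
have bor : <<s @open 'rV[R]_d >> (L `&` L').
  exact: (@measurableI _ (g_sigma_algebraType (@open 'rV[R]_d)) _ _
    (window_borel L) (window_borel L')).
have bd : bounded_set (L `&` L').
  by apply: bounded_setS (window_bounded L); exact: subIsetl.
apply: sub_sigma_algebra; exists (Window bd bor), k.
by apply/seteqP; split=> w; rewrite /preimage /= /npoints /= setIA.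
Qed.

HB.instance Definition _ L := isMeasurableFun.Build _ _ _ _ (window_restrict L)
  (measurable_window_restrict L).

End Restriction.

Local Open Scope ereal_scope.

Section Processes.
Context {R : realType} {d : nat}.
Implicit Types (P pi : probability (Omega R d) R) (L : window R d).

Definition restricted_law P L : probability (Omega R d) R :=
  distribution P (window_restrict L).

Definition stationary P := forall (u : 'rV[R]_d) (A : set (Omega R d)),
  measurable A -> P (translate u @^-1` A) = P A.

Definition finite_intensity P :=
  \int[P]_w ((npoints (box 0 1 : set 'rV[R]_d) w)%:R)%:E < +oo.

Definition stationary_process P := stationary P /\ finite_intensity P.

(* The second argument of [poisson_prob] is unused in its definition. *)
Definition poisson_process pi :=
  (forall L (k : nat), pi (npoints L @^-1` [set k]) =
     poisson_prob (fine (lebesgue_rV L)) 0 [set k]) /\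
  (forall (m : nat) (L : 'I_m -> window R d) (k : 'I_m -> nat),
     (forall i j, i != j -> L i `&` L j = set0) ->
     pi (\bigcap_(i in [set: 'I_m]) (npoints (L i) @^-1` [set k i])) =
     \prod_(i < m) pi (npoints (L i) @^-1` [set k i])).

End Processes.

Section Entropy.
Context disp (T : measurableType disp) (R : realType).

Definition relative_entropy (mu nu : probability T R) : \bar R :=
  if pselect (mu `<< nu) then
    \int[mu]_x lne (Radon_Nikodym_SigmaFinite.f mu nu x)
  else +oo.

End Entropy.

Section Gibbs.
Context {R : realType} {d : nat}.
Implicit Types (H : config R d -> \bar R) (P pi : probability (Omega R d) R).
Implicit Types (L : window R d) (w : config R d).

Definition stationary_energy H := forall w u,
  finite_config w -> H (translate u w) = H w.

Definition hereditary H := forall w x,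
  finite_config w -> H w = +oo -> H (union_config w (singleton_config x)) = +oo.

Definition non_degenerate H :=
  H (singleton_config 0) != +oo /\ H empty_config = 0.

Definition stable H := exists2 A : R, (0 < A)%R &
  forall w, finite_config w -> - (A * (npoints setT w)%:R)%:E <= H w.

(* x - y with the convention +oo - +oo = 0; the library's own subtraction
   gives -oo there. *)
Definition energy_diff (x y : \bar R) : \bar R :=
  if (x == +oo) && (y == +oo) then 0 else x - y.

Definition energy_in H (L L' : window R d) w : \bar R :=
  energy_diff (H (restrict_config L' w)) (H (restrict_config (L' `\` L) w)).

Definition has_range H (r : R) := forall w L (L1 L2 : window R d),
  minkowski_sum L (euclidean_ball r) `<=` L1 ->
  minkowski_sum L (euclidean_ball r) `<=` L2 ->
  energy_in H L L1 w = energy_in H L L2 w.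

Definition finite_range H := exists2 r : R, (0 <= r)%R & has_range H r.

(* For H of finite range, the common value of [energy_in H L L' w] over all
   sufficiently large L'; it does not depend on the range r used. *)
Definition local_energy H L w : \bar R :=
  xget 0 [set e | exists2 r : R, (0 <= r)%R &
    forall L', minkowski_sum L (euclidean_ball r) `<=` L' ->
      energy_in H L L' w = e].

Definition partition_function pi H L (eta : config R d) : \bar R :=
  \int[restricted_law pi L]_w'
    expeR (- local_energy H L (union_config (restrict_config L w') eta)).

Definition gibbs_density pi H L w : \bar R :=
  (partition_function pi H L (restrict_config (~` L) w))^-1 *
  expeR (- local_energy H L w).

Definition locally_finite_energy H : set (config R d) :=
  [set w | forall L, H (restrict_config L w) < +oo].

Definition gibbs pi H P :=
  P (locally_finite_energy H) = 1 /\
  forall L (g : Omega R d -> R),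
    measurable_fun setT g -> (exists M, forall w, `|g w| <= M)%R ->
    \int[P]_w (g w)%:E =
    \int[P]_w \int[restricted_law pi L]_w'
      ((g (union_config (restrict_config L w') (restrict_config (~` L) w)))%:E *
       gibbs_density pi H L
         (union_config (restrict_config L w') (restrict_config (~` L) w))).

Definition cube (n : nat) : window R d := box_window (- n%:R) n%:R.

Definition specific_entropy pi P : \bar R :=
  limn (fun n => relative_entropy (restricted_law P (cube n))
                   (restricted_law pi (cube n)) / lebesgue_rV (cube n)).

Definition pressure pi H : \bar R :=
  limn (fun n =>
    lne (\int[restricted_law pi (cube n)]_(w in finite_config) expeR (- H w)) /
    lebesgue_rV (cube n)).

Definition energy_density H P (n : nat) : \bar R :=
  (\int[P]_w H (restrict_config (cube n) w)) / lebesgue_rV (cube n).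

Definition mean_energy H P : \bar R := limn (energy_density H P).

Definition boundary_energy H L w : \bar R :=
  energy_diff (local_energy H L w) (H (restrict_config L w)).

End Gibbs.

(* Main.v *)
Require Import Defs.
From HB Require Import structures.
From mathcomp Require Import all_boot all_order all_algebra finmap.
From mathcomp Require Import all_classical all_reals all_analysis.
From mathcomp Require Import measurable_realfun.
From mathcomp Require Import zify ring lra.

Set Implicit Arguments.
Unset Strict Implicit.
Unset Printing Implicit Defensive.

Import Order.TTheory GRing.Theory Num.Theory.
Import numFieldTopology.Exports numFieldNormedType.Exports.

Local Open Scope classical_set_scope.
Local Open Scope ring_scope.
Local Open Scope ereal_scope.

(* Write I_n for the entropy of P relative to pi in the cube Lambda_n, E_n for the
   expected energy there and Z_n for the free partition function.

   The Donsker-Varadhan inequality for -H gives I_n + E_n >= - ln Z_n, and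
   dividing by |Lambda_n| yields the inequality. Superadditivity, up to a
   corridor of the width of the range, makes all the limits exist.

   If P is a Gibbs measure with conditional density f in Lambda_n, then 1/f has
   mean at most 1, and the exponential form of Jensen's inequality bounds I_n + E_n
   plus the mean boundary energy by minus the logarithm of the conditional
   partition function. The latter is at least the free partition function of a
   slightly smaller cube times the probability that the annulus between the two
   cubes is empty.

   Conversely, let equality hold, let G be a local function with values in [0,1]
   and K the difference between G and its average under the Gibbs kernel of a
   window L. As K has mean zero under this kernel, tilting exp(-H) by exp(tK)
   multiplies the partition function by at most 1 + 2t^2; this can be iterated
   over disjoint translates of L filling a positive fraction of Lambda_n, and the
   Donsker-Varadhan inequality then gives t E_P(K) <= ln(1 + 2t^2). Letting t
   tend to 0, for G and for 1 - G, yields E_P(K) = 0, which is the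
   Dobrushin-Lanford-Ruelle equation. *)

(** Entropy is handled only through its dual description by bounded test functions:
    [donsker_varadhan] and its converse [relative_entropy_le]. The converse supplies every upper
    bound on an entropy (superadditivity, the Gibbs case), so densities of restricted laws never
    have to be multiplied or conditioned. The value +oo shapes many statements: heredity makes
    exp(-H) factor through local energies even when some energies are infinite, and limits are added
    only once none of them is known to be -oo. Tilting succeeds because its gain is linear in t and
    its cost quadratic, while the number of blocks per unit volume tends to the positive constant
    (2N+1)^-d, where the cube of half-side N contains L and its range. The tilting factors of
    different blocks are not independent under exp(-H); they are integrated out one at a time, since
    each is controlled by the kernel of its own translate of L and the other factors do not see the
    points in that translate. Corridors are paid for by void probabilities exp(-volume), which is
    why ln Z_n + |Lambda_n|, and not ln Z_n, is the superadditive quantity. *)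

Section ereal_functions.
Context {R : realType}.

Lemma measurable_ereal_cases (f : R -> \bar R) (a b : \bar R) :
  measurable_fun setT f ->
  measurable_fun [set: \bar R]
    (fun x => match x with r%:E => f r | +oo => a | -oo => b end).
Proof.
move=> mf.
have -> : (fun x => match x with r%:E => f r | +oo => a | -oo => b end) =
    (fun x => if x == +oo then a else if x == -oo then b else f (fine x)).
  by apply/funext => -[r| |].
have meq (y : \bar R) : measurable_fun [set: \bar R] (fun x => x == y).
  apply: (@measurable_fun_bool _ _ _ _ true).
  rewrite setTI (_ : _ @^-1` _ = [set y]); first exact: emeasurable_set1.
  by apply/seteqP; split=> x /eqP.
apply: measurable_fun_ifT => //; apply: measurable_fun_ifT => //.
exact: measurableT_comp.
Qed.

Lemma measurable_expeR : measurable_fun [set: \bar R] (@expeR R).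
Proof.
apply: (measurable_ereal_cases (f := fun r => (expR r)%:E)).
exact/measurable_EFinP.
Qed.

Lemma measurable_lne : measurable_fun [set: \bar R] (@lne R).
Proof.
apply: (measurable_ereal_cases
  (f := fun r => if (r <= 0)%R then -oo else (ln r)%:E)).
apply: measurable_fun_ifT => //.
- exact: measurable_fun_ler.
- exact/measurable_EFinP.
Qed.

Lemma measurable_invr_ge0 d (T : measurableType d) (f : T -> R) :
  measurable_fun setT f -> (forall x, 0 <= f x)%R ->
  measurable_fun setT (fun x => (f x)^-1%R).
Proof.
move=> mf f0.
under eq_fun do rewrite -powR_inv1//.
have h := measurableT_comp (measurable_powR (-1)%R) mf.
exact: h.
Qed.

End ereal_functions.

(** * Relative entropy *)

Section entropy_bounds.
Context d (T : measurableType d) (R : realType).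

Lemma integral_prob_cst (P : probability T R) (c : \bar R) :
  \int[P]_x c = c.
Proof. by rewrite integral_cst// [X in _ * X]probability_setT mule1. Qed.

(** Positive and negative parts are compared separately, so the integral of [g] may be infinite.
    This is how it is used, with [g] the logarithm of a density or minus an energy. *)
Lemma ae_le_integral (mu : {measure set T -> \bar R}) (f g : T -> \bar R) :
  mu.-integrable setT f -> measurable_fun setT g ->
  {ae mu, forall x, f x <= g x} -> \int[mu]_x f x <= \int[mu]_x g x.
Proof.
move=> fi mg fg; have mf := measurable_int _ fi.
rewrite integralE [leRHS]integralE; apply: leeB.
- apply: ae_ge0_le_integral => //.
  + exact: measurable_funepos.
  + exact: measurable_funepos.
  + by apply: filterS fg => x fgx _; rewrite !funeposE ge_max !le_max fgx lexx orbT.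
- apply: ae_ge0_le_integral => //.
  + exact: measurable_funeneg.
  + exact: measurable_funeneg.
  + by apply: filterS fg => x fgx _; rewrite !funenegE ge_max !le_max leeN2 fgx lexx orbT.
Qed.

Lemma ge0_le1_integrable (mu : {measure set T -> \bar R}) (f : T -> \bar R) :
  measurable_fun setT f -> (forall x, 0 <= f x) -> \int[mu]_x f x <= 1 ->
  mu.-integrable setT f.
Proof.
move=> mf f0 f1; apply/integrableP; split=> //.
under eq_integral do rewrite gee0_abs//.
exact: le_lt_trans f1 (ltry _).
Qed.

(* The exponential form of Jensen's inequality, with [q] the ratio of the two
   densities: the pointwise bound is [ln q <= q - 1]. *)
Lemma le_integral_exponential (mu : probability T R) (f g q : T -> \bar R)
    (c : R) :
  mu.-integrable setT f -> measurable_fun setT g -> measurable_fun setT q ->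
  (forall x, 0 <= q x) -> \int[mu]_x q x <= 1 ->
  {ae mu, forall x, f x - q x + (1 - c)%:E <= g x} ->
  \int[mu]_x f x <= \int[mu]_x g x + c%:E.
Proof.
move=> fi mg mq q0 q1 fqg.
have qi : mu.-integrable setT q by exact: ge0_le1_integrable.
have ci : mu.-integrable setT (EFin \o cst (1 - c)%R).
  by apply: finite_measure_integrable_cst.
have fqi : mu.-integrable setT (f \- q) by exact: integrableB.
have := ae_le_integral (integrableD measurableT fqi ci) mg fqg.
rewrite integralD// integralB//= integral_prob_cst.
have ff := integrable_fin_num measurableT fi.
have qf := integrable_fin_num measurableT qi.
move=> h; rewrite -leeBlDr//; apply: le_trans h.
rewrite -(fineK ff) -(fineK qf) -!EFinB -EFinD lee_fin.
have : (fine (\int[mu]_x q x) <= 1)%R by rewrite -lee_fin fineK.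
lra.
Qed.

(** Monotone convergence along bounded truncations. The Gibbs property and the converse entropy
    bound only test bounded functions; this carries their estimates to unbounded ones. *)
Lemma le_integral_truncation (mu : {measure set T -> \bar R})
    (f : T -> \bar R) (C : \bar R) :
  measurable_fun setT f -> (forall x, 0 <= f x) ->
  (forall k : nat, \int[mu]_x mine (f x) k%:R%:E <= C) -> \int[mu]_x f x <= C.
Proof.
move=> mf f0 fC.
have fmono x : nondecreasing_seq (fun k : nat => mine (f x) k%:R%:E).
  by move=> m n mn; rewrite le_min2// lee_fin ler_nat.
have -> : \int[mu]_x f x = \int[mu]_x limn (fun k : nat => mine (f x) k%:R%:E).
  apply: eq_integral => x _; apply/esym/cvg_lim => //.
  have := f0 x; case: (f x) => [r _| _|//].
    apply: cvg_near_cst; near=> k; apply/min_idPl; rewrite lee_fin.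
    by near: k; exact: nbhs_infty_ger.
  under eq_fun do rewrite minye.
  by apply/cvgenyP; exact: cvg_id.
have mfk (k : nat) : measurable_fun setT (fun x => mine (f x) k%:R%:E).
  exact: measurable_mine.
rewrite monotone_convergence//.
- apply: lime_le; last exact: nearW.
  apply: ereal_nondecreasing_is_cvgn => m n mn; apply: ge0_le_integral => //.
  + by move=> x _; rewrite le_min f0 lee_fin ler0n.
  + by move=> x _; exact: fmono.
- by move=> k x _; rewrite le_min f0 lee_fin ler0n.
Unshelve.
all: by end_near.
Qed.

Context (mu nu : probability T R).
Local Notation rn := (Radon_Nikodym_SigmaFinite.f mu nu).

Lemma relative_entropyE : mu `<< nu ->
  relative_entropy mu nu = \int[mu]_x lne (rn x).
Proof. by rewrite /relative_entropy; case: pselect. Qed.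

Lemma relative_entropyNE : ~ (mu `<< nu) -> relative_entropy mu nu = +oo.
Proof. by rewrite /relative_entropy; case: pselect. Qed.

Lemma measurable_rn : mu `<< nu -> measurable_fun setT rn.
Proof.
by move=> munu; have /measurable_int := Radon_Nikodym_SigmaFinite.f_integrable munu.
Qed.

Lemma rn_gt0 : mu `<< nu -> {ae mu, forall x, 0 < rn x}.
Proof.
move=> munu; exists (rn @^-1` [set 0]); split.
- by rewrite -[X in measurable X]setTI; apply: measurable_rn.
- rewrite (Radon_Nikodym_SigmaFinite.f_integral munu); last first.
    by rewrite -[X in measurable X]setTI; apply: measurable_rn.
  by apply: integral0_eq => x ->.
- move=> x /= /negP; rewrite -leNgt => rx.
  by apply/eqP; rewrite eq_le rx Radon_Nikodym_SigmaFinite.f_ge0.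
Qed.

Lemma donsker_varadhan (F : T -> \bar R) (e : R) :
  mu.-integrable setT F -> (0 < e)%R -> \int[nu]_x expeR (F x) <= e%:E ->
  \int[mu]_x F x <= relative_entropy mu nu + (ln e)%:E.
Proof.
move=> Fi e0 Fe.
have [munu|/relative_entropyNE ->] := pselect (mu `<< nu); last first.
  by rewrite addye// leey.
rewrite relative_entropyE//.
have mF := measurable_int _ Fi.
have meF : measurable_fun setT (fun x => expeR (F x)).
  by apply: measurableT_comp => //; exact: measurable_expeR.
(* Ratio of the density exp(F)/e to that of [mu], both relative to [nu]. Division by zero gives 0
   where [rn] vanishes, so its mean is only bounded by 1. *)
pose q x := expeR (F x) * (e * fine (rn x))^-1%:E.
have mrn := measurable_rn munu.
have rn0 x : 0 <= rn x by exact: Radon_Nikodym_SigmaFinite.f_ge0.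
have rnf x : rn x \is a fin_num by exact: Radon_Nikodym_SigmaFinite.f_fin_num.
have q0 x : 0 <= q x.
  by rewrite mule_ge0 ?expeR_ge0// lee_fin invr_ge0 mulr_ge0 ?fine_ge0// ltW.
have mq : measurable_fun setT q.
  apply: emeasurable_funM => //; apply/measurable_EFinP.
  apply: measurable_invr_ge0; last first.
    by move=> x; rewrite mulr_ge0 ?fine_ge0// ltW.
  apply: measurable_funM => //.
  exact: measurableT_comp.
apply: (@le_integral_exponential _ _ _ q) => //.
- apply: measurableT_comp => //.
  exact: measurable_lne.
- rewrite -(Radon_Nikodym_SigmaFinite.change_of_variables munu)//.
  apply: (@le_trans _ _ (\int[nu]_x (expeR (F x) * e^-1%:E))).
    apply: ge0_le_integral => //.
    + by move=> x _; rewrite mule_ge0.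
    + exact: emeasurable_funM.
    + exact: emeasurable_funM.
    + move=> x _; rewrite /q -muleA lee_wpmul2l ?expeR_ge0//.
      rewrite -[X in _ * X](fineK (rnf x)) -EFinM lee_fin.
      rewrite invfM -mulrA; have [->|rx] := eqVneq (fine (rn x)) 0%R.
        by rewrite !mulr0 invr_ge0 ltW.
      by rewrite mulVf// mulr1.
  rewrite ge0_integralZr//; last 2 first.
    by move=> x _; exact: expeR_ge0.
    by rewrite lee_fin invr_ge0 ltW.
  apply: (@le_trans _ _ (e%:E * e^-1%:E)).
    by rewrite lee_wpmul2r// lee_fin invr_ge0 ltW.
  by rewrite -EFinM mulfV// gt_eqF.
- have := rn_gt0 munu; apply: filterS2 (integrable_ae measurableT Fi).
  move=> x Fx rx; rewrite /q.
  have : F x \is a fin_num by exact: Fx.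
  case: (F x) => // r _; move: (rnf x) rx; case: (rn x) => // s _.
  rewrite lte_fin => s0; rewrite lne_EFin//= -!EFinB -EFinD lee_fin.
  have a0 : (0 < expR r / (e * s))%R by rewrite divr_gt0 ?expR_gt0 ?mulr_gt0.
  have a1 : (-1 < expR r / (e * s) - 1)%R by lra.
  have := le_ln1Dx a1.
  rewrite subrKC ln_div ?posrE ?expR_gt0 ?mulr_gt0// expRK lnM//.
  lra.
Qed.


(** Converse of [donsker_varadhan]: bounded test functions detect the whole entropy. The
    near-optimal test function is the logarithm of the density, truncated on both sides; a [nu]-null
    set charged by [mu] is detected by a large multiple of its indicator. *)
Lemma relative_entropy_le (c : R) :
  (forall (h : T -> R) (e M : R), measurable_fun setT h ->
     (forall x, `|h x| <= M)%R -> (0 < e)%R ->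
     \int[nu]_x (expR (h x))%:E <= e%:E ->
     \int[mu]_x (h x)%:E <= (c + ln e)%:E) ->
  relative_entropy mu nu <= c%:E.
Proof.
move=> hc; have [munu|munu] := pselect (mu `<< nu); last first.
  have [A [mA [nuA muA]]] : exists A, measurable A /\ nu A = 0 /\ mu A != 0.
    apply: contrapT => nA; apply: munu.
    apply/null_content_dominatesP => A mA nuA.
    by apply/eqP/negPn/negP => muA; apply: nA; exists A.
  have muAf : mu A \is a fin_num by exact: fin_num_measure.
  have muA0 : (0 < fine (mu A))%R.
    by rewrite fine_gt0// lt0e muA measure_ge0 -ge0_fin_numE.
  (* With this height the test function has [mu]-mean |c| + 1, above [c], while its exponential
     still has [nu]-mean 1. *)
  pose t := ((`|c| + 1) / fine (mu A))%R.
  have t0 : (0 <= t)%R by rewrite divr_ge0 ?addr_ge0// ltW.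
  have := hc (fun x => t * \1_A x)%R 1%R t.
  have -> : \int[mu]_x (t * \1_A x)%:E = (`|c| + 1)%:E.
    rewrite (_ : (fun _ => _) = (fun x => t%:E * (\1_A x)%:E))//.
    rewrite ge0_integralZl_EFin//; last by apply/measurable_EFinP.
    rewrite integral_indic// setIT -[X in _ * X](fineK muAf) -EFinM /t.
    by rewrite mulfVK ?gt_eqF.
  have mh : measurable_fun setT (fun x => t * \1_A x)%R by exact: measurable_funM.
  have -> : \int[nu]_x (expR (t * \1_A x))%:E = 1.
    transitivity (\int[nu]_x cst 1 x); last first.
      exact: integral_prob_cst.
    apply: ge0_ae_eq_integral => //.
    - by apply/measurable_EFinP; exact: measurableT_comp.
    - exists A; split=> // x /= /not_implyP[_]; apply: contra_notP => xA.
      by rewrite indicE memNset// mulr0 expR0.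
  rewrite ln1 addr0 => /(_ mh) h; exfalso.
  have {}h : (`|c| + 1)%:E <= c%:E :> \bar R.
    apply: h => // x; rewrite normrM (ger0_norm t0) indicE.
    by case: (x \in A); rewrite ?normr1 ?normr0 ?mulr1 ?mulr0.
  by move: h; rewrite lee_fin; have := ler_norm c; lra.
rewrite relative_entropyE//.
have mrn := measurable_rn munu.
have rn0 x : 0 <= rn x by exact: Radon_Nikodym_SigmaFinite.f_ge0.
have rnf x : rn x \is a fin_num by exact: Radon_Nikodym_SigmaFinite.f_fin_num.
pose l x := lne (rn x).
have ml : measurable_fun setT l by exact: (measurableT_comp measurable_lne).
pose g (k : nat) x := maxe (- k%:R%:E) (mine (l x) k%:R%:E).
have mg k : measurable_fun setT (g k).
  by apply: measurable_maxe => //; apply: measurable_mine.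
have gk k x : (- k%:R%:E <= g k x <= k%:R%:E).
  rewrite /g le_max lexx/= ge_max lee_fin ge_min lexx orbT andbT.
  by rewrite (le_trans _ (ler0n _ k))// oppr_le0.
have gf k x : g k x \is a fin_num.
  have /andP[g1 g2] := gk k x.
  by rewrite fin_real// (lt_le_trans _ g1) ?ltNyr// (le_lt_trans g2) ?ltry.
have gE k : (fun x => (fine (g k x))%:E) = g k by apply/funext => x; rewrite fineK.
(* Subtracting +oo always yields -oo here, so an infinite negative part makes the integral -oo and
   the bound trivial. *)
have [by_|b_fin] := eqVneq (\int[mu]_x l^\- x) +oo.
  by rewrite integralE by_ addeNy leNye.
have l0 : 0 <= \int[mu]_x l^\- x by apply: integral_ge0 => x _; exact: funeneg_ge0.
have {b_fin}bf : \int[mu]_x l^\- x \is a fin_num.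
  by rewrite ge0_fin_numE// ltey.
set b := \int[mu]_x l^\- x in l0 bf *.
have gle k : \int[mu]_x g k x <= (c + k.+1%:R^-1)%:E.
  (* Cutting the logarithm from below at -k adds at most exp(-k) to the density; hence the
     normalisation 1 + exp(-k), whose logarithm is at most 1/(k+1). *)
  have e0 : (0 < 1 + expR (- k%:R) :> R)%R by rewrite addr_gt0 ?expR_gt0.
  have := hc (fun x => fine (g k x)) (1 + expR (- k%:R))%R k%:R.
  rewrite gE => /(_ _ _ e0 _)/le_trans; apply.
  - exact: measurableT_comp.
  - move=> x; rewrite ler_norml -!lee_fin EFinN fineK//; exact: gk.
  - apply: (@le_trans _ _ (\int[nu]_x (rn x + (expR (- k%:R))%:E))).
      apply: ge0_le_integral => //.
      + apply/measurable_EFinP; apply: measurableT_comp => //.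
        exact: measurableT_comp.
      + exact: emeasurable_funD.
      + move=> x _.
        have -> : (expR (fine (g k x)))%:E = expeR (g k x).
          by rewrite -[in RHS](fineK (gf k x)).
        rewrite /g maxEle; case: ifPn => _.
          rewrite (@le_trans _ _ (expeR (l x)))//.
            by rewrite lee_expeR ge_min lexx.
          rewrite /l; have := lneK_eq (rn x); rewrite rn0 => /eqP ->.
          by rewrite leeDl// lee_fin expR_ge0.
        by rewrite /= leeDr.
    rewrite ge0_integralD//.
    rewrite -(Radon_Nikodym_SigmaFinite.f_integral munu)//.
    rewrite integral_prob_cst.
    by rewrite [X in X + _ <= _]probability_setT.
  - rewrite lee_fin lerD2l.
    have := @le_ln1Dx R (expR (- k%:R)); move=> /(_ _)/le_trans; apply.
      by rewrite (lt_trans _ (expR_gt0 _))// oppr_lt0.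
    rewrite expRN lef_pV2 ?posrE ?expR_gt0// -natr1 addrC.
    exact: expR_ge1Dx.
have posle k : \int[mu]_x mine (l^\+ x) k%:R%:E <= (c + k.+1%:R^-1)%:E + b.
  apply: (@le_trans _ _ (\int[mu]_x g k x + b)); last by rewrite leeD2r.
  rewrite [X in _ <= X + b]integralE.
  apply: (@le_trans _ _ (\int[mu]_x (g k)^\+ x)).
    apply: ge0_le_integral => //.
    - by move=> x _; rewrite le_min funepos_ge0 lee_fin ler0n.
    - by apply: measurable_mine => //; exact: measurable_funepos.
    - exact: measurable_funepos.
    - move=> x _; rewrite !funeposE /g.
      have [x0|x0] := leP (l x) 0.
        by apply: (@le_trans _ _ 0); rewrite ?ge_min ?le_max lexx ?orbT.
      by rewrite !le_max lexx !orbT.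
  have gb : \int[mu]_x (g k)^\- x <= b.
    apply: ge0_le_integral => //.
    - exact: measurable_funeneg.
    - exact: measurable_funeneg.
    - move=> x _; rewrite !funenegE ge_max [X in _ && X]le_max lexx orbT andbT /g.
      have [xk|xk] := leP (l x) k%:R%:E.
        by rewrite le_max leeN2 le_max lexx orbT.
      by rewrite le_max; apply/orP; right; rewrite oppe_le0 le_max !lee_fin ler0n orbT.
  have gbf : \int[mu]_x (g k)^\- x \is a fin_num.
    rewrite ge0_fin_numE ?(le_lt_trans gb) -?ge0_fin_numE//.
    by apply: integral_ge0 => x _; exact: funeneg_ge0.
  rewrite -addeA leeDl// addeC sube_ge0 ?bf ?orbT//.
rewrite integralE leeBlDr// -/b.
apply: le_integral_truncation => [||n].
- exact: measurable_funepos.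
- by move=> x; exact: funepos_ge0.
(* The truncation level [n] of the positive part stays fixed while the level [k] of the test
   function grows, which removes the error 1/(k+1). *)
apply/lee_addgt0Pr => e e0; near \oo => k.
apply: (@le_trans _ _ (\int[mu]_x mine (l^\+ x) k%:R%:E)).
  apply: ge0_le_integral => //.
  - by move=> x _; rewrite le_min funepos_ge0 lee_fin ler0n.
  - by apply: measurable_mine => //; exact: measurable_funepos.
  - by apply: measurable_mine => //; exact: measurable_funepos.
  - move=> x _; rewrite le_min2// lee_fin ler_nat.
    by near: k; exact: nbhs_infty_ge.
rewrite (le_trans (posle k))// addeAC leeD2r// -EFinD lee_fin lerD2l.
near: k.
have := near_infty_natSinv_lt (PosNum e0); apply: filterS => k /=; exact: ltW.
Unshelve.
all: by end_near.
Qed.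

End entropy_bounds.

(** * Windows and configurations *)

Section integral_translation.
Context d (T : measurableType d) (R : realType).
Variable mu : {measure set T -> \bar R}.
Import HBNNSimple.

(* No measurability is required of [f]: the integral is a supremum over simple
   functions, which [phi] transports. *)
Lemma ge0_integral_le_preserving (phi : T -> T) (f : T -> \bar R) :
  measurable_fun setT phi ->
  (forall A, measurable A -> mu (phi @^-1` A) = mu A) ->
  (forall x, 0 <= f x) -> \int[mu]_x f x <= \int[mu]_x f (phi x).
Proof.
move=> mphi muphi f0; rewrite !ge0_integralTE//.
apply: ge_ereal_sup => _ /= [h hf <-].
have mh : measurable_fun setT (h \o phi) by exact: measurableT_comp.
have fh : finite_set (range (h \o phi)).
  by apply: (sub_finite_set _ (fimfunP h)) => _ [x _ <-]; exists (phi x).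
have h0 x : (0 <= (h \o phi) x)%R by [].
pose mixm := isMeasurableFun.Build _ _ _ _ _ mh.
pose mixf := FiniteImage.Build _ _ _ fh.
pose mixn := isNonNegFun.Build _ _ _ h0.
pose g : {nnsfun T >-> R} := HB.pack (h \o phi) mixm mixf mixn.
apply: ereal_sup_ubound; exists g => [x|]; first exact: hf.
rewrite !sintegralET; apply: eq_fsbigr => r _.
by rewrite comp_preimage muphi.
Qed.

(** The previous inequality for [phi] and for its inverse. It is applied to the iterated sections in
    [lebesgue_rV], whose measurability is not established. *)
Lemma ge0_integral_preserving (phi psi : T -> T) (f : T -> \bar R) :
  measurable_fun setT phi -> measurable_fun setT psi ->
  cancel phi psi -> cancel psi phi ->
  (forall A, measurable A -> mu (phi @^-1` A) = mu A) ->
  (forall x, 0 <= f x) -> \int[mu]_x f (phi x) = \int[mu]_x f x.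
Proof.
move=> mphi mpsi phiK psiK muphi f0; apply/eqP; rewrite eq_le.
rewrite ge0_integral_le_preserving// andbT.
have -> : f = (fun x => f (phi (psi x))) by apply/funext => x; rewrite psiK.
under eq_integral do rewrite phiK.
apply: (@ge0_integral_le_preserving psi (f \o phi)) => [//|A mA|x]; last exact: f0.
rewrite -muphi -1?comp_preimage; last by rewrite -[X in measurable X]setTI; exact: mpsi.
by rewrite -comp_preimage; congr (mu _); apply/funext => x /=; rewrite phiK.
Qed.

End integral_translation.

Section volume.
Context {R : realType}.

Lemma lebesgue_measure_shift (a : R) (A : set (measurableTypeR R)) :
  measurable A -> lebesgue_measure ((fun x => a + x)%R @^-1` A) = lebesgue_measure A.
Proof.
move=> mA.
have ms : measurable_fun setT ((fun x => a + x)%R : _ -> measurableTypeR R).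
  exact: measurable_funD.
pose phi : measurableTypeR R -> measurableTypeR R := (fun x => a + x)%R.
rewrite -[LHS]/(pushforward lebesgue_measure phi A).
apply/esym/lebesgue_measure_unique => //= _ [[b c]] _ <-.
rewrite /pushforward.
rewrite (_ : phi @^-1` _ = `](b - a)%R, (c - a)%R]%classic); last first.
  by apply/seteqP; split=> x; rewrite /= !in_itv/= /phi ltrBlDl lerBrDl.
rewrite !lebesgue_measure_itv/= !lte_fin ltrD2r.
by rewrite -!EFinD opprB addrA subrK.
Qed.

Lemma lebesgue_rV_ge0 d (A : set 'rV[R]_d) : 0 <= lebesgue_rV A.
Proof.
elim: d A => [|d IH] A /=; first by rewrite lee_fin.
by apply: integral_ge0 => t _; exact: IH.
Qed.

Lemma lebesgue_rV0 d : lebesgue_rV (set0 : set 'rV[R]_d) = 0.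
Proof.
elim: d => [|d IH] /=; first by rewrite indicE in_set0.
by apply: integral0_eq => t _; rewrite -[RHS]IH.
Qed.

(** By induction on the dimension: the first coordinate of [u] translates the outer integral, the
    others translate inside each section. *)
Lemma lebesgue_rV_shift d (u : 'rV[R]_d) (A : set 'rV[R]_d) :
  lebesgue_rV [set x | A (u + x)%R] = lebesgue_rV A.
Proof.
elim: d u A => [|d IH] u A /=.
  rewrite !indicE /=; congr ((_ : bool)%:R%:E); congr (0%R \in _).
  by apply/seteqP; split=> x /=; rewrite (thinmx0 (u + x)%R) (thinmx0 x).
pose F t := lebesgue_rV [set v : 'rV[R]_d | A (row_mx t%:M v : 'rV[R]_(1 + d))].
rewrite -[RHS]/(\int[lebesgue_measure]_t F t).
rewrite -(@ge0_integral_preserving _ _ _ lebesgue_measure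
  (fun t => u ord0 ord0 + t)%R (fun t => t - u ord0 ord0)%R F).
- apply: eq_integral => t _; rewrite /F.
  rewrite -[RHS](IH (rsubmx (u : 'rV_(1 + d)))); congr lebesgue_rV.
  have E v : (u + row_mx t%:M v =
      row_mx (u ord0 ord0 + t)%:M (rsubmx (u : 'rV_(1 + d)) + v) :> 'rV_(1 + d))%R.
    apply/rowP => i; rewrite mxE; case: (split_ordP (i : 'I_(1 + d))) => j ->.
      rewrite !(@row_mxEl _ 1 1 d) !mxE (ord1 j) eqxx !mulr1n.
      by congr (u _ _ + _)%R; exact: val_inj.
    by rewrite !(@row_mxEr _ 1 1 d) !mxE.
  by apply/funext => v /=; rewrite E.
- exact: measurable_funD.
- exact: measurable_funB.
- by move=> t; rewrite addrC addKr.
- by move=> t; rewrite subrKC.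
- exact: lebesgue_measure_shift.
- by move=> t; exact: lebesgue_rV_ge0.
Qed.

Lemma lebesgue_rV_cube d n : lebesgue_rV (@cube R d n) = ((2 * n) ^ d)%:R%:E.
Proof.
elim: d => [|d IH] /=.
  by rewrite indicE mem_set// => -[].
transitivity (\int[lebesgue_measure]_(t in `[(- n%:R)%R, n%:R]) cst ((2 * n) ^ d)%:R%:E (t : R)).
  rewrite [RHS]integral_mkcond; apply: eq_integral => t _.
  rewrite patchE; case: ifPn => [/set_mem/=|]; rewrite ?notin_setE /= in_itv/=.
    move=> tn; rewrite -[RHS]IH; congr lebesgue_rV.
    apply/seteqP; split => v /= vn i.
      by have := vn (rshift 1 i); rewrite (@row_mxEr _ 1 1 d).
    case: (split_ordP (i : 'I_(1 + d))) => j ->.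
      by rewrite (@row_mxEl _ 1 1 d) mxE (ord1 j) eqxx.
    by rewrite (@row_mxEr _ 1 1 d).
  move=> tn; rewrite -[RHS]/(0 : \bar R) -[RHS](lebesgue_rV0 d); congr lebesgue_rV.
  apply/seteqP; split => v //= /(_ (@lshift 1 d ord0)).
  by rewrite (@row_mxEl _ 1 1 d) mxE eqxx.
rewrite integral_cst//= lebesgue_measure_itv/= lte_fin.
case: ltP => [_|].
  rewrite -EFinD opprK -EFinM -!natrD -natrM expnSr; congr (_ * _)%:R%:E; lia.
move=> n0; have -> : n = 0%N.
  by clear IH; case: n n0 => // n n0; exfalso; have := ltr0Sn R n; lra.
by rewrite muln0 expnS mul0n mule0.
Qed.

End volume.

Section windows.
Context {R : realType} {d : nat}.
Implicit Types (L : window R d) (A B : set 'rV[R]_d) (u : 'rV[R]_d).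
Local Notation borel := (<<s @open 'rV[R]_d >>).

Lemma borelI A B : borel A -> borel B -> borel (A `&` B).
Proof. exact: (@measurableI _ (g_sigma_algebraType (@open 'rV[R]_d))). Qed.

Lemma borelU A B : borel A -> borel B -> borel (A `|` B).
Proof. exact: (@measurableU _ (g_sigma_algebraType (@open 'rV[R]_d))). Qed.

Lemma borelC A : borel A -> borel (~` A).
Proof. exact: (@measurableC _ (g_sigma_algebraType (@open 'rV[R]_d))). Qed.

Lemma borel_shift u A : borel A -> borel [set x | A (u + x)%R].
Proof.
pose f : g_sigma_algebraType (@open 'rV[R]_d) ->
  g_sigma_algebraType (@open 'rV[R]_d) := fun x => (u + x)%R.
have mf : measurable_fun setT f.
  apply: (@measurability _ _ (g_sigma_algebraType (@open 'rV[R]_d))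
    (g_sigma_algebraType (@open 'rV[R]_d)) _ _ (@open 'rV[R]_d)) => //.
  move=> _ [B oB <-]; rewrite setTI; apply: sub_sigma_algebra.
  apply: open_comp => // x _; apply: continuousD; first exact: cst_continuous.
  exact: cvg_id.
by move=> bA; have := mf measurableT _ bA; rewrite setTI.
Qed.

Definition windowI L B (mB : borel B) : window R d :=
  Window (bounded_setS (@subIsetl _ L B) (window_bounded L))
    (borelI (window_borel L) mB).

Definition shift_window u L : window R d :=
  Window (bounded_set_shift u (window_bounded L)) (borel_shift u (window_borel L)).

Lemma bounded_setU A B : bounded_set A -> bounded_set B -> bounded_set (A `|` B).
Proof.
move=> [M [Mr MA]] [N [Nr NB]]; exists (Num.max M N); split.
  exact: num_real.
by move=> x; rewrite gt_max => /andP[Mx Nx] y [/(MA _ Mx)|/(NB _ Nx)].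
Qed.

Definition windowU L L' : window R d :=
  Window (bounded_setU (window_bounded L) (window_bounded L'))
    (borelU (window_borel L) (window_borel L')).

Lemma borel0 : borel set0. Proof. exact: sigma_algebra0. Qed.

Lemma bounded_set0 : bounded_set (set0 : set 'rV[R]_d).
Proof. by exists 0%R; split=> // x _ y. Qed.

Definition window0 : window R d := Window bounded_set0 borel0.

End windows.

Section cubes.
Context {R : realType} {d : nat}.
Implicit Types (x : 'rV[R]_d) (A : set 'rV[R]_d).

Lemma coord_le_norm x i : (`|x ord0 i| <= `|x|)%R.
Proof.
by rewrite [leRHS]/Num.norm /= mx_normrE; exact: (le_bigmax _ _ (ord0, i)).
Qed.

Lemma norm_le_cube n x : (`|x| <= n%:R)%R -> window_set (cube n) x.
Proof. by move=> xn i; rewrite -ler_norml (le_trans (coord_le_norm x i)). Qed.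

Lemma subset_cube m n : (m <= n)%N -> @cube R d m `<=` cube n.
Proof.
move=> mn x xm i; have /andP[x1 x2] := xm i.
have mnR : (m%:R <= n%:R :> R)%R by rewrite ler_nat.
by rewrite (le_trans x2)// andbT (le_trans _ x1)// lerN2.
Qed.

Lemma bounded_set_cube A : bounded_set A -> exists n, A `<=` cube n.
Proof.
move=> [M [_ MA]]; exists (Num.truncn M).+1 => x Ax; apply: norm_le_cube.
by apply: MA Ax; exact: truncnS_gt.
Qed.

Lemma seq_cube (s : seq 'rV[R]_d) : exists n, forall x, x \in s -> window_set (cube n) x.
Proof.
elim: s => [|x s [n sn]]; first by exists 0%N.
pose m := maxn n (Num.truncn `|x|%R).+1; exists m => y.
rewrite inE => /predU1P[->|/sn]; last first.
  by apply: subset_cube; rewrite leq_maxl.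
apply: (@subset_cube (Num.truncn `|x|%R).+1); first by rewrite leq_maxr.
by apply: norm_le_cube; apply/ltW; exact: truncnS_gt.
Qed.

End cubes.

Section configuration_algebra.
Context {R : realType} {d : nat}.
Implicit Types (w : config R d) (A B : set 'rV[R]_d) (u : 'rV[R]_d).

Lemma config_ext w w' : (w : set _) = w' -> w = w'.
Proof.
case: w w' => p fp [q fq] /= pq; rewrite pq in fp *.
by congr Config; exact: Prop_irrelevance.
Qed.

Lemma restrict_config_restrict A B w :
  restrict_config A (restrict_config B w) = restrict_config (B `&` A) w.
Proof. by apply: config_ext; rewrite /= setIA. Qed.

Lemma restrict_config_sub A B w :
  A `<=` B -> restrict_config A (restrict_config B w) = restrict_config A w.
Proof. by move=> AB; rewrite restrict_config_restrict setIidr. Qed.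

Lemma restrict_config_union A w w' :
  restrict_config A (union_config w w') =
  union_config (restrict_config A w) (restrict_config A w').
Proof. by apply: config_ext; rewrite /= setIUl. Qed.

Lemma restrict_config_set0 w : restrict_config set0 w = empty_config.
Proof. by apply: config_ext; rewrite /= setI0. Qed.

Lemma union_config0 w : union_config w empty_config = w.
Proof. by apply: config_ext; rewrite /= setU0. Qed.

Lemma union_configC w w' : union_config w w' = union_config w' w.
Proof. by apply: config_ext; rewrite /= setUC. Qed.

Lemma translateE u w x : points (translate u w) x = points w (x - u)%R.
Proof.
rewrite /=; apply/propext; split=> [[y wy <-]|wx].
  by rewrite addrC addKr.
by exists (x - u)%R => //; rewrite subrKC.
Qed.

Lemma restrict_translate A u w :
  restrict_config A (translate u w) =
  translate u (restrict_config [set x | A (u + x)%R] w).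
Proof.
apply: config_ext; apply/funext => x; rewrite translateE.
rewrite -[LHS]/(points (translate u w) x /\ A x) translateE /=.
by rewrite subrKC.
Qed.

Lemma translateD u v w : translate u (translate v w) = translate (u + v)%R w.
Proof.
by apply: config_ext; apply/funext => x; rewrite !translateE opprD addrA.
Qed.

Lemma translate0 w : translate 0%R w = w.
Proof. by apply: config_ext; apply/funext => x; rewrite translateE subr0. Qed.

Lemma finite_restrict A w : bounded_set A -> finite_config (restrict_config A w).
Proof. exact: locally_finite. Qed.

Lemma npoints_restrict A B w :
  npoints A (restrict_config B w) = npoints (B `&` A) w.
Proof. by rewrite /npoints /= setIA. Qed.

Lemma card_fset_setU (T : choiceType) (X Y : set T) :
  finite_set X -> finite_set Y -> X `&` Y = set0 ->
  #|` fset_set (X `|` Y)| = (#|` fset_set X| + #|` fset_set Y|)%N.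
Proof.
move=> fX fY XY0; rewrite fset_setU// cardfsU -fset_setI// XY0 fset_set0.
by rewrite cardfs0 subn0.
Qed.

Lemma npointsU A B w : bounded_set A -> bounded_set B -> A `&` B = set0 ->
  npoints (A `|` B) w = (npoints A w + npoints B w)%N.
Proof.
move=> bA bB AB0; rewrite /npoints setIUr card_fset_setU//.
- exact: locally_finite.
- exact: locally_finite.
- by rewrite setIACA setIid AB0 setI0.
Qed.

Lemma npoints0 w : npoints set0 w = 0%N.
Proof. by rewrite /npoints setI0 fset_set0. Qed.

Lemma npoints_union_config A w w' : bounded_set A ->
  w `&` w' `&` A = set0 ->
  npoints A (union_config w w') = (npoints A w + npoints A w')%N.
Proof.
move=> bA ww0; rewrite /npoints /= setIUl card_fset_setU//.
- exact: locally_finite.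
- exact: locally_finite.
- by rewrite setIACA setIid.
Qed.

Lemma le_npoints A B w : bounded_set B -> A `<=` B ->
  (npoints A w <= npoints B w)%N.
Proof.
move=> bB AB; apply: fsubset_leq_card; rewrite -fset_set_sub.
- by apply: setIS.
- by apply: (sub_finite_set _ (locally_finite w bB)); apply: setIS.
- exact: locally_finite.
Qed.

Lemma npoints_eq0 A w : bounded_set A ->
  npoints A w = 0%N -> w `&` A = set0.
Proof.
move=> bA /eqP; rewrite cardfs_eq0 => /eqP w0.
by rewrite -(fset_setK (locally_finite w bA)) w0 set_fset0.
Qed.

Lemma npoints_translate A u w : bounded_set A ->
  npoints A (translate u w) = npoints [set x | A (u + x)%R] w.
Proof.
move=> bA; rewrite /npoints.
have -> : translate u w `&` A = [set u + x | x in w `&` [set x | A (u + x)]]%R.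
  by apply/seteqP; split=> [_ [[x wx <-] Ax]|_ [x [wx Ax] <-]]; [exists x|split=> //; exists x].
rewrite fset_set_image; last exact: (locally_finite w (bounded_set_shift u bA)).
by rewrite card_imfset//=; exact: addrI.
Qed.

Lemma npoints_bigU (I : choiceType) (s : seq I) (F : I -> set 'rV[R]_d) w :
  uniq s -> (forall i, bounded_set (F i)) ->
  (forall i j, i != j -> F i `&` F j = set0) ->
  npoints (\big[setU/set0]_(i <- s) F i) w = (\sum_(i <- s) npoints (F i) w)%N.
Proof.
move=> us bF F0; elim: s us => [_|i s IH /= /andP[is_ us]].
  by rewrite !big_nil npoints0.
rewrite !big_cons npointsU ?IH//.
  elim/big_ind: _ => //; first exact: bounded_set0.
  exact: bounded_setU.
rewrite big_distrr/= big_seq big1// => j js; apply: F0.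
by apply: contraNneq is_ => ->.
Qed.

End configuration_algebra.

Section configuration_measurability.
Context {R : realType} {d : nat}.
Implicit Types (L : window R d) (B : set 'rV[R]_d).
Local Notation borel := (<<s @open 'rV[R]_d >>).

Lemma measurable_npoints L : measurable_fun setT (npoints L : Omega R d -> nat).
Proof.
move=> _ /= A _; rewrite setTI.
rewrite (_ : _ @^-1` A = \bigcup_(k in A) (npoints L @^-1` [set k])).
  by apply: bigcup_measurable => k _; apply: sub_sigma_algebra; exists L, k.
by apply/seteqP; split=> [w Aw|w [k Ak /= wk]]; [exists (npoints L w)|rewrite /= wk].
Qed.

Lemma measurable_npointsR L :
  measurable_fun setT (fun w : Omega R d => (npoints L w)%:R : R).
Proof.
have mN : measurable_fun [set: nat] (fun k => k%:R : R) by [].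
exact: (measurableT_comp mN (measurable_npoints L)).
Qed.

Lemma measurable_config dT (T : measurableType dT) (f : T -> Omega R d) :
  (forall L, measurable_fun setT (fun x => npoints L (f x))) ->
  measurable_fun setT f.
Proof.
move=> mf; apply: (@measurability _ _ T (Omega R d) _ _ (counting_events R d)) => //.
move=> _ [_ [L [k ->]] <-]; rewrite setTI.
by have := mf L measurableT [set k]; rewrite setTI; apply.
Qed.

Lemma measurable_restrict_config B : borel B ->
  measurable_fun setT (restrict_config B : Omega R d -> Omega R d).
Proof.
move=> bB; apply: measurable_config => L.
under eq_fun do rewrite npoints_restrict setIC.
exact: (measurable_npoints (windowI L bB)).
Qed.

Lemma measurable_translate u :
  measurable_fun setT (translate u : Omega R d -> Omega R d).
Proof.
apply: measurable_config => L.
rewrite [X in measurable_fun _ X](_ : _ = npoints (shift_window u L)).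
  exact: measurable_npoints.
by apply/funext => w; rewrite npoints_translate//; exact: window_bounded.
Qed.

Lemma measurable_glue A B : borel A -> borel B -> A `&` B = set0 ->
  measurable_fun setT (fun z : Omega R d * Omega R d =>
    union_config (restrict_config A z.1) (restrict_config B z.2) : Omega R d).
Proof.
move=> bA bB AB0; apply: measurable_config => L.
have E z : npoints L (union_config (restrict_config A z.1) (restrict_config B z.2)) =
    (npoints (windowI L bA) z.1 + npoints (windowI L bB) z.2)%N.
  rewrite npoints_union_config ?npoints_restrict.
  - by rewrite !(setIC _ (L : set _)).
  - exact: window_bounded.
  - by rewrite /= setIACA AB0 setI0 set0I.
under eq_fun do rewrite E.
apply: measurable_fun_addn.
- exact: (measurableT_comp (measurable_npoints _) measurable_fst).
- exact: (measurableT_comp (measurable_npoints _) measurable_snd).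
Qed.

Lemma finite_configP (w : config R d) :
  finite_config w <-> exists k, forall n, (npoints (cube n) w <= k)%N.
Proof.
split=> [fw|[k wk]].
  exists #|` fset_set w| => n; apply: fsubset_leq_card; rewrite -fset_set_sub//.
  exact: finite_setIl.
apply: contrapT => iw; have [C Cw kC] := infinite_set_fset k.+1 iw.
have [n Cn] := seq_cube C.
suff : (k < k)%N by rewrite ltnn.
apply: leq_trans kC (leq_trans _ (wk n)); apply: fsubset_leq_card.
apply/fsubsetP => x xC; rewrite in_fset_set ?inE; last first.
  by apply: locally_finite; exact: bounded_box.
by split; [exact: Cw|exact: Cn].
Qed.

Lemma measurable_finite_config : measurable (finite_config : set (Omega R d)).
Proof.
rewrite (_ : finite_config = \bigcup_k \bigcap_n (npoints (cube n) @^-1` [set m | (m <= k)%N])).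
  apply: bigcupT_measurable => k; apply: bigcapT_measurable => n.
  by rewrite -[X in measurable X]setTI; apply: measurable_npoints.
apply/seteqP; split=> w.
  by move=> /finite_configP[k wk]; exists k => // n _; exact: wk.
move=> [k _ wk]; apply/finite_configP; exists k => n.
exact: (wk n I).
Qed.

End configuration_measurability.

(** * The Poisson process *)

Section count_events.
Context {R : realType} {d : nat}.
Local Notation borel := (<<s @open 'rV[R]_d >>).

(** With arbitrary finite index types, an intersection is indexed by a sum of types and a family of
    atoms by sets of indices, without renumbering. *)
Definition count_event (I : finType) (L : I -> window R d) (k : I -> nat) :
  set (Omega R d) := [set w | forall i, npoints (L i) w = k i].

Lemma measurable_npoints_eq (L : window R d) k :
  measurable [set w : Omega R d | npoints L w = k].
Proof. by apply: sub_sigma_algebra; exists L, k. Qed.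

Lemma measurable_count_event (I : finType) (L : I -> window R d) k :
  measurable (count_event L k).
Proof.
rewrite (_ : count_event L k = \bigcap_(i in [set: I]) [set w | npoints (L i) w = k i]).
  by apply: fin_bigcap_measurable => // i _; exact: measurable_npoints_eq.
by apply/seteqP; split=> w /= wk i => [_|]; exact: wk.
Qed.

Definition count_system : set (set (Omega R d)) :=
  [set C | exists (I : finType) (L : I -> window R d) k, C = count_event L k].

Lemma generated_by_count_events :
  @measurable _ (Omega R d) = <<s count_system >>.
Proof.
apply/seteqP; split.
- apply: smallest_sub; first exact: smallest_sigma_algebra.
  move=> _ [L [k ->]]; apply: sub_sigma_algebra; exists unit, (fun=> L), (fun=> k).
  by apply/seteqP; split=> w /= => [wk _|/(_ tt)].
- apply: smallest_sub; first exact: sigma_algebra_measurable.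
  by move=> _ [I [L [k ->]]]; exact: measurable_count_event.
Qed.

Lemma measure_eq_count_events (P Q : {measure set (Omega R d) -> \bar R}) :
  P setT < +oo ->
  (forall (I : finType) (L : I -> window R d) k,
     P (count_event L k) = Q (count_event L k)) ->
  forall A, measurable A -> P A = Q A.
Proof.
move=> Poo PQ; apply: (measure_unique count_system (fun=> setT)) => //.
- exact: generated_by_count_events.
- move=> _ _ [I [L [k ->]]] [J [M [l ->]]].
  exists (I + J)%type, (fun x => match x with inl i => L i | inr j => M j end),
    (fun x => match x with inl i => k i | inr j => l j end).
  apply/seteqP; split=> w /= => [[wI wJ] [i|j]//|wIJ].
  by split=> [i|j]; [exact: (wIJ (inl i))|exact: (wIJ (inr j))].
- move=> _; exists void, (fun=> window0), (fun=> 0%N).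
  by apply/seteqP; split=> w //= _ [].
- by rewrite bigcup_const//; exists 0%N.
- by move=> _ [I [L [k ->]]].
Qed.

(* The overlaps of finitely many windows are resolved by their atoms, each of
   them further cut along [A]. *)
Lemma measure_eq_disjoint_counts (A : set 'rV[R]_d)
    (P Q : {measure set (Omega R d) -> \bar R}) :
  borel A -> P setT < +oo ->
  (forall (I : finType) (L : I -> window R d) (k : I -> nat),
     (forall i j, i != j -> L i `&` L j = set0) ->
     (forall i, L i `<=` A \/ L i `&` A = set0) ->
     P (count_event L k) = Q (count_event L k)) ->
  forall B, measurable B -> P B = Q B.
Proof.
move=> bA Poo PQ; apply: measure_eq_count_events => // I L k.
pose W := \big[@windowU R d/@window0 R d]_(i : I) L i.
have WE x : (W : set _) x <-> exists i, (L i : set _) x.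
  rewrite /W; split.
    elim/big_ind: _ => //= [U V IU IV [/IU|/IV]//|i _]; by exists i.
  move=> [i Lix].
  have : i \in index_enum I by rewrite mem_index_enum.
  elim: (index_enum I) => // j r IH; rewrite big_cons inE => /predU1P[<-|/IH]; first by left.
  by right.
(* A point is classified by the set of windows containing it and by the side of [A] on which it
   lies. *)
pose T := ({set I} * bool)%type.
pose atom_set (x : T) : set 'rV[R]_d :=
  \bigcap_(i in [set: I]) (if i \in x.1 then (L i : set _) else ~` L i) `&`
  (if x.2 then A else ~` A).
have batom x : borel (atom_set x).
  apply: borelI; last by case: x.2 => //; exact: borelC.
  apply: (@fin_bigcap_measurable _ (g_sigma_algebraType (@open 'rV[R]_d))) => // i _.
  case: (i \in x.1); first exact: (window_borel (L i)).
  exact: (borelC (window_borel (L i))).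
pose atom x := windowI W (batom x).
have atomE x y : (atom x : set _) y <->
    [/\ (W : set _) y, (forall i, (i \in x.1) <-> (L i : set _) y) & (x.2 <-> A y)].
  rewrite /= /atom_set /=; split=> [[Wy [xy xA]]|[Wy xy xA]].
    split=> // [i|].
      by have := xy i Logic.I; case: (i \in x.1) => //; split.
    by move: xA; case: x.2 => //; split.
  split=> //; split.
    by move=> i _; have := xy i; case: (i \in x.1) => //= -[h1 h2]; [exact: h1|move/h2].
  by move: xA; case: x.2 => //= -[h1 h2]; [exact: h1|move/h2].
have atom_disj x y : x != y -> atom x `&` atom y = set0.
  move=> xy; apply/seteqP; split=> // z [/atomE[_ xz xA] /atomE[_ yz yA]].
  move/eqP: xy; apply; case: x y xz xA yz yA => [S b] [S' b'] /= xz xA yz yA.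
  congr (_, _); first by apply/setP => i; apply/idP/idP => [/(xz i)/(yz i)|/(yz i)/(xz i)].
  by apply/idP/idP => [/xA/yA|/yA/xA].
have bW x : bounded_set (atom x) by exact: window_bounded.
have LE i w : npoints (L i) w = (\sum_(x : T | i \in x.1) npoints (atom x) w)%N.
  rewrite -big_enum/= -npoints_bigU ?enum_uniq//; congr npoints.
  apply/seteqP; split=> y.
    move=> Liy; pose S := [set j | `[< (L j : set _) y >]]%SET.
    pose x0 : T := (S, `[< A y >]).
    have x0y : (atom x0 : set _) y.
      apply/atomE; split; first by apply/WE; exists i.
      - by move=> j; rewrite inE; split => /asboolP.
      - by split => /asboolP.
    rewrite -bigcup_seq; exists x0 => //=.
    rewrite mem_enum; suff : i \in x0.1 by [].
    by rewrite /x0 /S inE; exact/asboolP.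
  rewrite -bigcup_seq => -[x /=]; rewrite mem_enum => ix /atomE[_ xy _].
  by apply/(xy i).
(* On the event every atom holds at most [K] points, so the event is a finite disjoint union over
   the vectors of atom counts that sum to [k]. *)
pose K := \max_(i : I) k i.
pose F := [set n : {ffun T -> 'I_K.+1} |
  forall i, (\sum_(x : T | i \in x.1) (n x : nat))%N = k i].
pose E (n : {ffun T -> 'I_K.+1}) := count_event atom (fun x => n x : nat).
have mE n : measurable (E n) by exact: measurable_count_event.
have tE : trivIset F E.
  move=> m n _ _ [w [wm wn]]; apply/ffunP => x; apply: val_inj => /=.
  by rewrite -wm -wn.
have fF : finite_set F by exact: finite_finset.
have -> : count_event L k = \bigcup_(n in F) E n.
  apply/seteqP; split=> w /= => [wk|[n Fn wn] i]; last first.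
    by rewrite LE -Fn; apply: eq_bigr => x _; exact: wn.
  have wK x : (npoints (atom x) w < K.+1)%N.
    have [x0|[i ix]] := set_0Vmem x.1.
      rewrite (_ : window_set (atom x) = set0) ?npoints0//.
      apply/seteqP; split=> // y /atomE[/WE[i Liy] /(_ i)[_ /(_ Liy)]].
      by rewrite x0 inE.
    rewrite ltnS (leq_trans _ (leq_bigmax i))// -wk; apply: le_npoints.
      exact: window_bounded.
    by move=> y /atomE[_ /(_ i)[/(_ ix)]].
  exists [ffun x => Ordinal (wK x)] => [i|x /=]; last by rewrite ffunE.
  by rewrite -wk LE; apply: eq_bigr => x _; rewrite ffunE.
rewrite !measure_fin_bigcup//; apply: eq_fsbigr => n _.
apply: PQ => //= x; rewrite /atom_set; case: x.2.
- by left => y [_ [_]].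
- by right; apply/seteqP; split=> // y [[_ [_ nA]]].
Qed.

End count_events.

Section poisson.
Context {R : realType} {d : nat}.
Local Notation borel := (<<s @open 'rV[R]_d >>).
Variable pi : probability (Omega R d) R.
Hypothesis pi_poisson : poisson_process pi.

Lemma poisson_count_event (I : finType) (L : I -> window R d) (k : I -> nat) :
  (forall i j, i != j -> L i `&` L j = set0) ->
  pi (count_event L k) = \prod_(i : I) pi [set w | npoints (L i) w = k i].
Proof.
move=> L0.
rewrite [LHS](_ : _ = pi (\bigcap_(i in [set: 'I_#|I|])
    (npoints (L (enum_val i)) @^-1` [set k (enum_val i)]))); last first.
  congr (pi _); apply/seteqP; split=> w /= wk i; first by move=> _; exact: wk.
  by have := wk (enum_rank i) Logic.I; rewrite /= enum_rankK.
rewrite (pi_poisson.2 _ (fun i => L (enum_val i)) (fun i => k (enum_val i))).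
  by rewrite (reindex (@enum_val I I))//; exact: onW_bij (enum_val_bij _).
by move=> i j ij; apply: L0; apply: contra_neq ij => /enum_val_inj.
Qed.

(** Counts in disjoint windows have a law fixed by the volumes, and volume is translation
    invariant. *)
Lemma poisson_stationary : stationary pi.
Proof.
move=> u; move=> A mA; have mt := @measurable_translate R d u.
pose tr : Omega R d -> Omega R d := translate u.
pose Q : {measure set (Omega R d) -> \bar R} := pushforward pi tr.
rewrite -[LHS]/(Q mt A).
apply: (@measure_eq_disjoint_counts _ _ set0 (Q mt) pi) => //.
- exact: borel0.
- by rewrite /Q /= /pushforward preimage_setT probability_setT ltry.
- move=> I L k L0 _; rewrite [RHS](poisson_count_event _ L0).
  rewrite [LHS](_ : _ = pi (count_event (fun i => shift_window u (L i)) k)); last first.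
    congr (pi _); apply/seteqP; split=> w /= wk i.
      by rewrite -wk npoints_translate//; exact: window_bounded.
    by rewrite npoints_translate ?wk//; exact: window_bounded.
  rewrite [LHS]poisson_count_event; last first.
    move=> i j /L0 ij0; apply/seteqP; split=> // x [xi xj].
    have : (L i `&` L j) (u + x)%R by split.
    by rewrite ij0.
  apply: eq_bigr => i _; rewrite -!/(_ @^-1` [set k i]).
  rewrite -[LHS]/(pi (npoints (shift_window u (L i)) @^-1` [set k i])).
  by rewrite [LHS]pi_poisson.1 [RHS]pi_poisson.1 lebesgue_rV_shift.
Qed.

(** The restriction to the union and the gluing of two independent copies have the same law: on
    counts in disjoint windows, each lying inside [A] or off [A], both factor into the same product.
    Tonelli then gives the iterated integral. *)
Lemma poisson_split A B (F : Omega R d -> \bar R) :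
  borel A -> borel B -> bounded_set (A `|` B) -> A `&` B = set0 ->
  measurable_fun setT F -> (forall w, 0 <= F w) ->
  \int[pi]_w F (restrict_config (A `|` B) w) =
  \int[pi]_w \int[pi]_w' F (union_config (restrict_config A w') (restrict_config B w)).
Proof.
move=> bA bB bdAB AB0 mF F0.
have bAB := borelU bA bB.
have mr := measurable_restrict_config bAB.
have mg := measurable_glue bA bB AB0.
pose rst : Omega R d -> Omega R d := restrict_config (A `|` B).
pose glue (z : Omega R d * Omega R d) : Omega R d :=
  union_config (restrict_config A z.1) (restrict_config B z.2).
pose P : {measure set (Omega R d) -> \bar R} := pushforward pi rst.
pose Q : {measure set (Omega R d) -> \bar R} := pushforward (pi \x pi) glue.
have PQ : forall C, measurable C -> P mr C = Q mg C.
  apply: (@measure_eq_disjoint_counts _ _ A (P mr) (Q mg)) => //.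
    by rewrite /P /= /pushforward preimage_setT probability_setT ltry.
  move=> I L k L0 LA.
  (* Each window goes to the factor that sees it; the other factor receives the empty window with
     count 0, an event of probability 1. *)
  pose inA i := `[< L i `<=` A >].
  pose LA' i := if inA i then L i else window0.
  pose LB' i := if inA i then window0 else windowI (L i) bB.
  pose kA i := if inA i then k i else 0%N.
  pose kB i := if inA i then 0%N else k i.
  have notinA i : ~~ inA i -> L i `&` A = set0.
    by move=> /asboolPn nA; case: (LA i).
  rewrite [LHS](_ : _ = pi (count_event (fun i => windowI (L i) bAB) k)); last first.
    congr (pi _); apply/seteqP; split=> w /= wk i.
      by rewrite -wk /rst npoints_restrict setIC.
    by rewrite /rst npoints_restrict setIC; exact: wk.
  rewrite [RHS](_ : _ = (pi \x pi) (count_event LA' kA `*` count_event LB' kB)); last first.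
    congr ((pi \x pi) _).
    have E z i : npoints (L i) (glue z) = if inA i then npoints (L i) z.1 else
        npoints (windowI (L i) bB) z.2.
      rewrite /glue npoints_union_config; last 2 first.
      - exact: window_bounded.
      - by rewrite /= setIACA AB0 setI0 set0I.
      rewrite !npoints_restrict; have [/asboolP iA|/notinA iA0] := boolP (inA i).
        rewrite (setIidr iA) [X in (_ + npoints X _)%N](_ : _ = set0) ?npoints0 ?addn0//.
        apply/seteqP; split=> // x [Bx Lx].
        by rewrite -AB0; split=> //; exact: iA.
      by rewrite (setIC A) iA0 npoints0 add0n setIC.
    apply/seteqP; split=> z /=.
      move=> zk; split=> i; rewrite /LA' /LB' /kA /kB -(zk i) E; case: ifP => _ //.
        by rewrite npoints0.
      by rewrite npoints0.
    move=> [z1 z2] i; rewrite E; have := z1 i; have := z2 i.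
    by rewrite /LA' /LB' /kA /kB; case: ifP.
  rewrite product_measure1E; [|exact: measurable_count_event..].
  have dLA i j : i != j -> LA' i `&` LA' j = set0.
    by move=> /L0 ij; rewrite /LA'; case: ifP => _; case: ifP => _; rewrite ?set0I ?setI0.
  have dLB i j : i != j -> LB' i `&` LB' j = set0.
    move=> /L0 ij; rewrite /LB'; case: ifP => _; case: ifP => _; rewrite ?set0I ?setI0//=.
    by rewrite setIACA ij set0I.
  have dL i j : i != j -> windowI (L i) bAB `&` windowI (L j) bAB = set0.
    by move=> /L0 ij /=; rewrite setIACA ij set0I.
  rewrite [X in _ = X * _](poisson_count_event _ dLA).
  rewrite [X in _ = _ * X](poisson_count_event _ dLB).
  rewrite [LHS](poisson_count_event _ dL) -big_split/=; apply: eq_bigr => i _.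
  have h0 : pi [set w | npoints (window0 : window R d) w = 0%N] = 1.
    rewrite (_ : [set w | _] = setT) ?probability_setT//.
    by apply/seteqP; split=> w //= _; rewrite npoints0.
  rewrite /LA' /LB' /kA /kB; have [/asboolP iA|/notinA iA0] := boolP (inA i).
    rewrite h0 mule1; congr (pi _); apply/funext => w /=; congr (npoints _ w = _).
    by rewrite setIidl// => x /iA; left.
  rewrite h0 mul1e; congr (pi _); apply/funext => w /=; congr (npoints _ w = _).
  by rewrite setIUr iA0 set0U.
transitivity (\int[P mr]_w F w).
  by rewrite /P ge0_integral_pushforward.
transitivity (\int[Q mg]_w F w).
  by apply: eq_measure_integral => C mC _; exact: PQ.
rewrite /Q ge0_integral_pushforward//= fubini_tonelli2//.
exact: (measurableT_comp mF mg).
Qed.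

End poisson.

Section poisson_integrals.
Context {R : realType} {d : nat}.
Local Notation borel := (<<s @open 'rV[R]_d >>).

Lemma stationary_integral (P : probability (Omega R d) R) u (f : Omega R d -> \bar R) :
  stationary P -> measurable_fun setT f -> (forall w, 0 <= f w) ->
  \int[P]_w f (translate u w) = \int[P]_w f w.
Proof.
move=> sP mf f0; have mt := @measurable_translate R d u.
pose tr : Omega R d -> Omega R d := translate u.
pose Q : {measure set (Omega R d) -> \bar R} := pushforward P tr.
transitivity (\int[Q mt]_w f w); first by rewrite /Q ge0_integral_pushforward.
by apply: eq_measure_integral => A mA _; exact: sP.
Qed.

Variable pi : probability (Omega R d) R.
Hypothesis pi_poisson : poisson_process pi.

Lemma poisson_indep2 (A B : window R d) (f g : Omega R d -> \bar R) :
  A `&` B = set0 -> measurable_fun setT f -> measurable_fun setT g ->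
  (forall w, 0 <= f w) -> (forall w, 0 <= g w) ->
  \int[pi]_w (f (restrict_config A w) * g (restrict_config B w)) =
  \int[pi]_w f (restrict_config A w) * \int[pi]_w g (restrict_config B w).
Proof.
move=> AB0 mf mg f0 g0.
have mfA : measurable_fun setT (fun w : Omega R d => f (restrict_config A w)).
  exact: (measurableT_comp mf (measurable_restrict_config (window_borel A))).
have mgB : measurable_fun setT (fun w : Omega R d => g (restrict_config B w)).
  exact: (measurableT_comp mg (measurable_restrict_config (window_borel B))).
pose F (w : Omega R d) := f (restrict_config A w) * g (restrict_config B w).
transitivity (\int[pi]_w F (restrict_config (A `|` B) w)).
  apply: eq_integral => w _; rewrite /F !restrict_config_sub//.
have mF : measurable_fun setT (F : Omega R d -> _) by exact: emeasurable_funM.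
have F0 w : 0 <= F w by rewrite mule_ge0.
rewrite (poisson_split pi_poisson (window_borel A) (window_borel B)
  (window_bounded (windowU A B)) AB0 mF F0).
transitivity (\int[pi]_w \int[pi]_w' (f (restrict_config A w') * g (restrict_config B w))).
  apply: eq_integral => w _; apply: eq_integral => w' _; rewrite /F.
  rewrite !restrict_config_union !restrict_config_restrict !setIid.
  rewrite (setIC B) AB0 !restrict_config_set0.
  by rewrite union_config0 union_configC union_config0.
under eq_integral do rewrite ge0_integralZr//.
rewrite ge0_integralZl// ?integral_ge0//.
Qed.

Lemma poisson_indep_prod (I : eqType) (s : seq I) (D : I -> window R d)
    (C : window R d) (psi : I -> Omega R d -> \bar R) (phi : Omega R d -> \bar R) :
  uniq s -> (forall i j, i != j -> D i `&` D j = set0) ->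
  (forall i, D i `&` C = set0) ->
  (forall i, measurable_fun setT (psi i)) -> (forall i w, 0 <= psi i w) ->
  measurable_fun setT phi -> (forall w, 0 <= phi w) ->
  \int[pi]_w ((\prod_(i <- s) psi i (restrict_config (D i) w)) *
              phi (restrict_config C w)) =
  (\prod_(i <- s) \int[pi]_w psi i (restrict_config (D i) w)) *
  \int[pi]_w phi (restrict_config C w).
Proof.
move=> us D0 DC mpsi psi0 mphi phi0.
have : forall i, i \in s -> D i `&` C = set0 by move=> i _; exact: DC.
move=> {}DC; elim: s C phi us mphi phi0 DC => [|i s IH] C phi.
  move=> _ mphi phi0 _; rewrite big_nil mul1e.
  by apply: eq_integral => w _; rewrite big_nil mul1e.
move=> /= /andP[is_ us] mphi phi0 DC.
(* The block [D i] is absorbed into the function of the remaining window, which is why the induction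
   runs over all [C] and [phi]. *)
pose phi' w := psi i (restrict_config (D i) w) * phi (restrict_config C w).
have mphi' : measurable_fun setT (phi' : Omega R d -> \bar R).
  apply: emeasurable_funM.
    exact: (measurableT_comp (mpsi i) (measurable_restrict_config (window_borel _))).
  exact: (measurableT_comp mphi (measurable_restrict_config (window_borel _))).
have phi'E w : phi' (restrict_config (windowU (D i) C) w) = phi' w.
  by rewrite /phi' !restrict_config_sub//=.
transitivity (\int[pi]_w ((\prod_(j <- s) psi j (restrict_config (D j) w)) *
              phi' (restrict_config (windowU (D i) C) w))).
  by apply: eq_integral => w _; rewrite phi'E /phi' big_cons muleA (muleC (psi i _)).
rewrite (IH (windowU (D i) C) phi')//; last 2 first.
- by move=> w; rewrite mule_ge0.
- move=> j js /=; rewrite setIUr D0 ?DC ?setU0// ?inE ?js ?orbT//.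
  by apply: contraNneq is_ => <-.
under eq_integral do rewrite phi'E.
rewrite poisson_indep2 ?DC ?inE ?eqxx// big_cons muleA.
by rewrite (muleC (\prod_(j <- s) _)).
Qed.

Lemma poisson_void (L : window R d) :
  pi [set w | npoints L w = 0%N] = (expR (- fine (lebesgue_rV L)))%:E.
Proof.
rewrite [LHS]pi_poisson.1 /poisson_prob; case: ifPn => [r0|].
  rewrite esum_set1 ?lee_fin ?poisson_pmf_ge0// /poisson_pmf r0.
  by rewrite expr0 fact0 invr1 !mul1r.
(* For a rate that is not positive [poisson_prob] is the Dirac mass at 0, in agreement with exp(0) =
   1. *)
rewrite -leNgt => r0.
have -> : fine (lebesgue_rV L) = 0%R.
  by apply/eqP; rewrite eq_le r0 fine_ge0// lebesgue_rV_ge0.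
by rewrite oppr0 expR0 diracE mem_set.
Qed.

Lemma poisson_exp_moment (a : R) n : (0 < n)%N -> (0 < d)%N ->
  \int[pi]_w (expR (a * (npoints (cube n) w)%:R))%:E < +oo.
Proof.
move=> n0 d0.
pose l : R := ((2 * n) ^ d)%:R.
have l0 : (0 < l)%R by rewrite ltr0n expn_gt0 muln_gt0 n0.
(* Weighting the Poisson law of mean l by exp(a k) gives exp(l' - l) times the Poisson law of mean
   l' = l exp(a), whose total mass is 1. *)
pose l' := (l * expR a)%R.
have l'0 : (0 < l')%R by rewrite mulr_gt0 ?expR_gt0.
pose E k := [set w : Omega R d | npoints (cube n) w = k].
have mE k : measurable (E k) by exact: measurable_npoints_eq.
have EU : \bigcup_k E k = setT by apply/seteqP; split=> // w _; exists (npoints (cube n) w).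
rewrite -EU ge0_integral_bigcup//; last 2 first.
- apply/measurable_funTS/measurable_EFinP; apply: measurableT_comp => //.
  by apply: measurable_funM => //; exact: measurable_npointsR.
- by move=> i j _ _ [w [/= <- <-]].
rewrite (@eq_eseriesr _ _ (fun k => (expR (l' - l))%:E * (poisson_pmf l' k)%:E)); last first.
  move=> k _.
  rewrite (eq_integral (fun=> (expR (a * k%:R))%:E)); last first.
    by move=> w; rewrite inE => ->.
  rewrite integral_cst// [X in _ * X](pi_poisson.1 (cube n) k).
  rewrite lebesgue_rV_cube /= /poisson_prob l0 esum_set1 ?lee_fin ?poisson_pmf_ge0//.
  rewrite /poisson_pmf l0 l'0 -!EFinM; congr EFin.
  rewrite expRD exprMn -expRM_natl mulrC (mulrC a) -/l.
  rewrite [RHS](_ : _ = (expR l' * expR (- l')) *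
    (l ^+ k / k`!%:R * expR (- l) * expR (k%:R * a)))%R; last by ring.
  by rewrite expRxMexpNx_1 mul1r mulrC.
rewrite nneseriesZl//; last by move=> k _; rewrite lee_fin poisson_pmf_ge0.
rewrite nneseries_esumT; last by move=> k; rewrite lee_fin poisson_pmf_ge0.
have := @probability_setT _ _ _ (poisson_prob l' 0).
rewrite /= /poisson_prob l'0 => ->.
by rewrite mule1 ltry.
Qed.

End poisson_integrals.

(** * Local energies *)

Section energy.
Context {R : realType} {d : nat}.
Local Notation borel := (<<s @open 'rV[R]_d >>).
Implicit Types (w : config R d) (L : window R d).

Definition windowD (L L' : window R d) : window R d :=
  windowI L (borelC (window_borel L')).

Lemma minkowski_sum_cube (r : R) (r0 n : nat) (A : set 'rV[R]_d) :
  (r <= r0%:R)%R -> A `<=` cube n ->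
  minkowski_sum A (euclidean_ball r) `<=` cube (n + r0).
Proof.
move=> rr0 An _ [x Ax [y yr <-]] i; have := An _ Ax i => /andP[x1 x2].
have : (`|y ord0 i| <= r0%:R)%R.
  apply: le_trans rr0; apply: le_trans yr.
  rewrite -sqrtr_sqr ler_wsqrtr// (bigD1 i)//= lerDl.
  by apply: sumr_ge0 => j _; exact: sqr_ge0.
rewrite ler_norml mxE => /andP[y1 y2]; rewrite natrD opprD.
by rewrite !lerD.
Qed.

Lemma subset_minkowski (r : R) (A : set 'rV[R]_d) : (0 <= r)%R ->
  A `<=` minkowski_sum A (euclidean_ball r).
Proof.
move=> r0 x Ax; exists x => //; exists 0%R; last by rewrite addr0.
rewrite /euclidean_ball /= big1 ?sqrtr0// => i _.
by rewrite mxE expr0n.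
Qed.

Lemma minkowski_shift (r : R) u (A : set 'rV[R]_d) :
  minkowski_sum [set x | A (u + x)%R] (euclidean_ball r) =
  [set x | minkowski_sum A (euclidean_ball r) (u + x)%R].
Proof.
apply/seteqP; split=> [_ [x Ax [y yr <-]]|z [x Ax [y yr xyz]]].
  by exists (u + x)%R => //; exists y => //; rewrite addrA.
exists (x - u)%R; first by rewrite /= subrKC.
by exists y => //; rewrite addrAC xyz addrC addKr.
Qed.

Variable H : Omega R d -> \bar R.
Hypothesis H_meas : measurable_fun (finite_config : set (Omega R d)) H.
Hypothesis H_gtNy : forall w, finite_config w -> H w != -oo.
Hypothesis H_hereditary : hereditary H.
Hypothesis H_non_degenerate : non_degenerate H.

Lemma measurable_energy L :
  measurable_fun setT (fun w : Omega R d => H (restrict_config L w)).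
Proof.
apply: (@measurable_comp _ _ _ _ _ _ (finite_config : set (Omega R d))) => //.
- exact: measurable_finite_config.
- by move=> _ [w _ <-]; exact/finite_restrict/window_bounded.
- exact: measurable_restrict_config (window_borel L).
Qed.

Lemma energy_gtNy L w : -oo < H (restrict_config L w).
Proof. by rewrite ltNye H_gtNy//; exact/finite_restrict/window_bounded. Qed.

(** Heredity adds one point at a time; adding the points of [w'] successively leads from [w] to
    [w']. *)
Lemma energy_eqy_sub w w' : finite_config w' -> (w : set _) `<=` w' ->
  H w = +oo -> H w' = +oo.
Proof.
move=> fw' ww' Hw; have fw : finite_config w by exact: sub_finite_set fw'.
pose add s := foldr (fun x v => union_config v (singleton_config x)) w s.
have addE s : (add s : set _) = w `|` [set` s].
  elim: s => [|x s IH] /=; first by apply/seteqP; split=> x; [left|case].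
  rewrite IH -setUA; congr (_ `|` _); apply/seteqP; split=> y /=.
    by rewrite inE => -[->|->]; rewrite ?eqxx ?orbT.
  by rewrite inE => /predU1P[->|]; [right|left].
have Hadd s : H (add s) = +oo.
  elim: s => //= x s IH; apply: H_hereditary => //.
  by rewrite /finite_config /= addE finite_setU; split=> //; exact: finite_seq.
have <- : add (fset_set (w' : set _)) = w'.
  apply: config_ext; rewrite addE; apply/seteqP; split=> x.
    by move=> [/ww'//|/=]; rewrite in_fset_set// inE.
  by move=> w'x; right => /=; rewrite in_fset_set// inE.
exact: Hadd.
Qed.

Lemma energy_restrict_eqy (A : set 'rV[R]_d) L w : A `<=` L ->
  H (restrict_config A w) = +oo -> H (restrict_config L w) = +oo.
Proof.
move=> AL; apply: energy_eqy_sub; first exact/finite_restrict/window_bounded.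
exact: setIS.
Qed.

(** The factorisation survives infinite energies. If the energy off [L] is infinite, so is the total
    energy by heredity, and both sides vanish whatever value the convention gives to +oo - +oo. *)
Lemma expe_energy_in L L' w :
  expeR (- H (restrict_config L' w)) =
  expeR (- energy_in H L L' w) * expeR (- H (restrict_config (L' `\` L) w)).
Proof.
rewrite /energy_in /energy_diff.
have HN := energy_gtNy L' w.
have HDN : -oo < H (restrict_config (L' `\` L) w).
  by have := energy_gtNy (windowD L' L) w.
have h := @energy_restrict_eqy (L' `\` L) L' w (@subDsetl _ _ _).
move: h HN HDN; case: (H (restrict_config L' w)) => [x| |];
  case: (H (restrict_config (L' `\` L) w)) => [y| |]//= h _ _.
- by rewrite -EFinM -expRD; congr (expR _)%:E; ring.
- by have := h erefl.
- by rewrite mul0e.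
- by rewrite mule0.
Qed.

Lemma energy_in_notin L L' w : w `&` L = set0 -> energy_in H L L' w = 0.
Proof.
move=> wL; rewrite /energy_in.
have -> : restrict_config (L' `\` L) w = restrict_config L' w.
  apply: config_ext; apply/seteqP; split=> x /= [wx]; first by case.
  move=> L'x; split=> //; split=> // Lx.
  by have : (w `&` L) x by []; rewrite wL.
have := energy_gtNy L' w; rewrite /energy_diff.
case: (H _) => [x| |]//= _.
by rewrite -EFinB subrr.
Qed.

Lemma energy_in_gtNy L L' w : -oo < energy_in H L L' w.
Proof.
rewrite /energy_in /energy_diff.
have HN := energy_gtNy L' w.
have h := @energy_restrict_eqy (L' `\` L) L' w (@subDsetl _ _ _).
move: h HN; case: (H (restrict_config L' w)) => [x| |];
  case: (H (restrict_config (L' `\` L) w)) => [y| |]//= h _; rewrite ?ltNyr ?ltNy0//.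
by have := h erefl.
Qed.

Variables (r : R) (r0 : nat).
Hypothesis r_ge0 : (0 <= r)%R.
Hypothesis H_range : has_range H r.
Hypothesis rr0 : (r <= r0%:R)%R.

Lemma local_energyE L L' w : minkowski_sum L (euclidean_ball r) `<=` L' ->
  local_energy H L w = energy_in H L L' w.
Proof.
move=> LL'; apply: xget_unique.
  by exists r => // L'' LL''; exact: H_range.
move=> e [r' r'0 h].
have [n Ln] := bounded_set_cube (window_bounded L).
(* Another admissible range [r'] must lead to the same value; a cube enlarged by [m] is big enough
   for both ranges and compares them. *)
pose m := (Num.truncn (Num.max r r')).+1.
have rm : (r <= m%:R)%R.
  by rewrite (le_trans _ (ltW (truncnS_gt (Num.max r r'))))// le_max lexx.
have r'm : (r' <= m%:R)%R.
  by rewrite (le_trans _ (ltW (truncnS_gt (Num.max r r'))))// le_max lexx orbT.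
rewrite -(h (cube (n + m))); last exact: minkowski_sum_cube.
by apply: H_range => //; exact: minkowski_sum_cube.
Qed.

Lemma exists_range_window L : exists2 n, L `<=` cube n &
  minkowski_sum L (euclidean_ball r) `<=` @cube R d (n + r0).
Proof.
have [n Ln] := bounded_set_cube (window_bounded L); exists n => //.
exact: minkowski_sum_cube.
Qed.

Lemma measurable_energy_diff (f g : Omega R d -> \bar R) :
  measurable_fun setT f -> measurable_fun setT g ->
  measurable_fun setT (fun w : Omega R d => energy_diff (f w) (g w)).
Proof.
move=> mf mg; have meq (h : Omega R d -> \bar R) : measurable_fun setT h ->
    measurable_fun setT (fun x => h x == +oo).
  move=> mh; apply: (@measurable_fun_bool _ _ _ _ true).
  rewrite setTI (_ : _ @^-1` _ = h @^-1` [set +oo]); last first.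
    by apply/seteqP; split=> x /eqP.
  by rewrite -[X in measurable X]setTI; apply: mh => //; exact: emeasurable_set1.
rewrite /energy_diff; apply: measurable_fun_ifT => //.
- by apply: measurable_and; exact: meq.
- exact: emeasurable_funB.
Qed.

Lemma measurable_local_energy L : measurable_fun setT (local_energy H L : Omega R d -> _).
Proof.
have [n Ln LrR] := exists_range_window L.
have mE1 := measurable_energy (cube (n + r0)).
have mE2 := measurable_energy (windowD (cube (n + r0)) L).
have -> : local_energy H L = fun w => energy_in H L (cube (n + r0)) w.
  by apply/funext => w; exact: local_energyE.
exact: measurable_energy_diff.
Qed.

Lemma local_energy_gtNy L w : -oo < local_energy H L w.
Proof.
by have [n _ LrR] := exists_range_window L; rewrite (local_energyE _ LrR) energy_in_gtNy.
Qed.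

Lemma local_energy_notin L w : w `&` L = set0 -> local_energy H L w = 0.
Proof.
have [n _ LrR] := exists_range_window L.
by rewrite (local_energyE _ LrR); exact: energy_in_notin.
Qed.

(** Finite range is applied to the configuration in the union of [A] and [B], with two surroundings
    of [A]. In [A'] nothing but [A] is seen and the local energy is H of [A]; in the union of [A']
    and [B] it is the energy of both minus that of [B]. *)
Lemma energy_separated (A A' B : window R d) w :
  minkowski_sum A (euclidean_ball r) `<=` A' -> A' `&` B = set0 ->
  H (restrict_config (A `|` B) w) =
  H (restrict_config A w) + H (restrict_config B w).
Proof.
move=> AA' A'B.
have sAA' : A `<=` A' by apply: subset_trans AA'; exact: subset_minkowski.
have := @H_range (restrict_config (A `|` B) w) A A' (windowU A' B) AA' _.
have A'BN x : (A' : set _) x -> ~ (B : set _) x by move=> A'x Bx; have : (A' `&` B) x by []; rewrite A'B.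
move=> /(_ _); rewrite /energy_in !restrict_config_restrict.
have -> : (A `|` B) `&` A' = A.
  by apply/seteqP; split=> x /= => [[[//|Bx] /A'BN]|Ax]; [|split; [left|exact: sAA']].
have -> : (A `|` B) `&` (A' `\` A) = set0.
  by apply/seteqP; split=> // x [[Ax|Bx] [A'x nA]]; [exact: nA|exact: (A'BN x)].
have -> : (A `|` B) `&` windowU A' B = A `|` B.
  by apply/setIidPl => x /= [/sAA'|]; [left|right].
have -> : (A `|` B) `&` (windowU A' B `\` A) = B.
  apply/seteqP; split=> x /= => [[[Ax|//] [_ //]]|Bx].
  by split; [right|split; [right|move=> /sAA'/A'BN]].
rewrite restrict_config_set0 H_non_degenerate.2 => /(_ _) h.
have {}h : energy_diff (H (restrict_config A w)) 0 =
    energy_diff (H (restrict_config (A `|` B) w)) (H (restrict_config B w)).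
  by apply: h; apply: subset_trans AA' _ => x; left.
have HA := energy_gtNy A w; have HB := energy_gtNy B w.
have HAB : -oo < H (restrict_config (A `|` B) w) by exact: (energy_gtNy (windowU A B)).
have hB : H (restrict_config B w) = +oo -> H (restrict_config (A `|` B) w) = +oo.
  by apply: (energy_restrict_eqy (L := windowU A B)) => x; right.
move: h hB HA HB HAB; rewrite /energy_diff andbF sube0.
case: (H (restrict_config A w)) => [a| |];
 case: (H (restrict_config B w)) => [b| |]; 
 case: (H (restrict_config (A `|` B) w)) => [c| |]//= [].
by move=> -> *; rewrite -EFinD subrK.
Qed.

End energy.

(** * Superadditive sequences indexed by cubes *)

Section superadditive.
Context {R : realType} (d : nat).

Lemma cvg_floor_ratio (S : nat) : (0 < S)%N ->
  ((2 * n %/ S)%:R / (2 * n)%:R : R)%R @[n --> \oo] --> (S%:R^-1 : R)%R.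
Proof.
move=> S0; have SR : (0 < S%:R :> R)%R by rewrite ltr0n.
apply/cvgrPdist_le => e e0; near=> n.
have n0 : (0 < n)%N by near: n; exact: nbhs_infty_gt.
have nR : (0 < (2 * n)%:R :> R)%R by rewrite ltr0n muln_gt0.
have h1 : ((2 * n %/ S)%:R * S%:R <= (2 * n)%:R :> R)%R.
  by rewrite -natrM ler_nat leq_trunc_div.
have h2 : ((2 * n)%:R <= ((2 * n %/ S)%:R + 1) * S%:R :> R)%R.
  by rewrite natr1 -natrM ler_nat ltnW// ltn_ceil.
have le1 : ((2 * n %/ S)%:R / (2 * n)%:R <= S%:R^-1 :> R)%R.
  by rewrite ler_pdivrMr// mulrC ler_pdivlMr.
rewrite ger0_norm ?subr_ge0//.
apply: (@le_trans _ _ ((2 * n)%:R^-1)%R).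
  rewrite lerBlDr -[X in (_ <= X + _)%R]mul1r -mulrDl ler_pdivlMr//.
  by rewrite mulrC ler_pdivrMr// addrC.
rewrite invf_ple ?posrE//; apply: (@le_trans _ _ n%:R); last by rewrite ler_nat leq_pmull.
by near: n; exact: nbhs_infty_ger.
Unshelve. all: by end_near. Qed.

Lemma cvg_exprn (u : nat -> R) (l : R) e :
  u n @[n --> \oo] --> l -> (u n ^+ e)%R @[n --> \oo] --> (l ^+ e)%R.
Proof.
move=> ul; elim: e => [|e IH].
  by under eq_fun do rewrite expr0; rewrite expr0; exact: cvg_cst.
by under eq_fun do rewrite exprS; rewrite exprS; exact: cvgM.
Qed.

Lemma cvg_packing_ratio (S : nat) : (0 < S)%N ->
  (((2 * n %/ S) ^ d)%:R / ((2 * n) ^ d)%:R : R)%R @[n --> \oo] -->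
  ((S ^ d)%:R^-1 : R)%R.
Proof.
move=> S0.
under eq_fun do rewrite !natrX -expr_div_n.
by rewrite natrX -exprVn; apply: cvg_exprn; exact: cvg_floor_ratio.
Qed.

Variables (b : nat -> \bar R) (s0 : nat).
Hypothesis b_ge0 : forall n, 0 <= b n.
Hypothesis b_super : forall k m n, (0 < k)%N -> (m * (2 * k + s0) <= 2 * n)%N ->
  (m ^ d)%:R%:E * b k <= b n.

Let a n := b n / ((2 * n) ^ d)%:R%:E.

(** The hypothesis packs [m ^ d] cubes of side 2k, with gaps [s0], into the cube of side 2n. The
    limit is the supremum [l] of c_k a_k: packing with k fixed bounds the sequence from below, and
    a_n <= l / c_n with c_n tending to 1 bounds it from above. The value +oo is allowed. *)
Lemma cvg_superadditive : cvgn a.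
Proof.
have powE n : (0 < n)%N -> (0 < ((2 * n) ^ d)%:R :> R)%R.
  by move=> n0; rewrite ltr0n expn_gt0 muln_gt0 n0.
have aE n : (0 < n)%N -> a n = b n * (((2 * n) ^ d)%:R^-1)%:E.
  by move=> n0; rewrite /a inver gt_eqF// powE.
have bE n : (0 < n)%N -> b n = a n * ((2 * n) ^ d)%:R%:E.
  by move=> n0; rewrite aE// -muleA -EFinM mulVf ?mule1// gt_eqF// powE.
have a0 n : (0 < n)%N -> 0 <= a n.
  by move=> n0; rewrite aE// mule_ge0// lee_fin invr_ge0 ltW// powE.
(* The fraction of a cell of side 2k + s0 that is filled by its cube of side 2k. *)
pose c k : R := (((2 * k) ^ d)%:R / ((2 * k + s0) ^ d)%:R)%R.
have c0 k : (0 < k)%N -> (0 < c k)%R.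
  by move=> k0; rewrite divr_gt0 ?powE// ltr0n expn_gt0 addn_gt0 muln_gt0 k0.
have low k (x : R) : (0 < k)%N -> x%:E < (c k)%:E * a k ->
    \forall n \near \oo, x%:E <= a n.
  move=> k0 xk; pose S := (2 * k + s0)%N.
  have S0 : (0 < S)%N by rewrite addn_gt0 muln_gt0 k0.
  have le_an n : (0 < n)%N ->
      (((2 * n %/ S) ^ d)%:R / ((2 * n) ^ d)%:R)%:E * b k <= a n.
    move=> n0; rewrite aE// mulrC EFinM -muleA muleC lee_wpmul2r//.
    by apply: b_super => //; exact: leq_trunc_div.
  have ckE : (c k)%:E * a k = ((S ^ d)%:R^-1)%:E * b k.
    rewrite aE// (muleC (b k)) muleA -EFinM; congr (_%:E * _).
    by rewrite /c mulrAC mulfV ?mul1r// gt_eqF// powE.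
  rewrite ckE in xk.
  have q := cvg_packing_ratio S0.
  have := b_ge0 k; move: xk le_an; case: (b k) => [y| |//] xk le_an _.
    rewrite -EFinM lte_fin in xk.
    have qy : (((2 * n %/ S) ^ d)%:R / ((2 * n) ^ d)%:R * y)%R @[n --> \oo] -->
        ((S ^ d)%:R^-1 * y)%R by apply: cvgMl.
    near=> n; have n0 : (0 < n)%N by near: n; exact: nbhs_infty_gt.
    rewrite (le_trans _ (le_an n n0))// -EFinM lee_fin ltW//.
    by near: n; exact: (cvgr_gt _ qy).
  have S1 : (0 < (S ^ d)%:R^-1 :> R)%R by rewrite invr_gt0 ltr0n expn_gt0 S0.
  near=> n; have n0 : (0 < n)%N by near: n; exact: nbhs_infty_gt.
  rewrite (le_trans _ (le_an n n0))// gt0_muley ?leey// lte_fin.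
  by near: n; exact: (cvgr_gt _ q).
pose l := ereal_sup [set (c k)%:E * a k | k in [set k | (0 < k)%N]].
have lub k : (0 < k)%N -> (c k)%:E * a k <= l.
  by move=> k0; apply: ereal_sup_ubound; exists k.
have l0 : 0 <= l.
  by apply: le_trans (lub 1%N isT); rewrite mule_ge0 ?a0// lee_fin ltW// c0.
have llow (x : R) : x%:E < l -> \forall n \near \oo, x%:E <= a n.
  by move=> /ereal_sup_gt[_ [k k0 <-]]; exact: low.
apply/cvg_ex; exists l.
have := l0; case El : l => [L| |//] L0.
- have cinv : ((c n)^-1 * L)%R @[n --> \oo] --> L.
    have cvg0 : (s0%:R / (2 * n)%:R : R)%R @[n --> \oo] --> (0 : R)%R.
      apply/cvgrPdist_le => e e0; near=> n.
      have n0 : (0 < n)%N by near: n; exact: nbhs_infty_gt.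
      rewrite sub0r normrN ger0_norm ?divr_ge0// ler_pdivrMr ?ltr0n ?muln_gt0//.
      rewrite mulrC -ler_pdivrMr// (@le_trans _ _ n%:R)// ?ler_nat ?leq_pmull//.
      by near: n; exact: nbhs_infty_ger.
    rewrite -[X in _ --> X]mul1r; apply: cvgMl.
    have cvg1 : ((1 + s0%:R / (2 * n)%:R) ^+ d : R)%R @[n --> \oo] --> (1 : R)%R.
      rewrite -[X in _ --> X](expr1n R d); apply: cvg_exprn.
      rewrite -[X in _ --> X]addr0; apply: cvgD => //; exact: cvg_cst.
    apply: cvg_trans cvg1; apply: near_eq_cvg; near=> n.
    have n0 : (0 < n)%N by near: n; exact: nbhs_infty_gt.
    have nR : (0 < (2 * n)%:R :> R)%R by rewrite ltr0n muln_gt0.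
    rewrite /c invf_div !natrX -expr_div_n natrD mulrDl divff// gt_eqF//.
  have up n : (0 < n)%N -> a n <= ((c n)^-1 * L)%:E.
    move=> n0; have := lub n n0; rewrite El => h.
    by rewrite EFinM muleC lee_pdivlMr ?c0// muleC.
  apply/fine_cvgP; split.
    near=> n; have n0 : (0 < n)%N by near: n; exact: nbhs_infty_gt.
    by rewrite ge0_fin_numE ?a0// (le_lt_trans (up n n0)) ?ltry.
  apply/cvgrPdist_le => e e0; near=> n.
  have n0 : (0 < n)%N by near: n; exact: nbhs_infty_gt.
  have an : a n = (fine (a n))%:E.
    by rewrite fineK// ge0_fin_numE ?a0// (le_lt_trans (up n n0)) ?ltry.
  have h1 : ((L - e)%:E <= a n).
    by near: n; apply: llow; rewrite El lte_fin; lra.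
  have h2 : ((c n)^-1 * L <= L + e)%R.
    by near: n; apply: (cvgr_le _ cinv); lra.
  have h3 := up n n0; rewrite an lee_fin in h3; rewrite an lee_fin in h1.
  by rewrite /= ler_norml; lra.
- apply/cvgeyPge => x; apply: llow; rewrite El; exact: ltry.
Unshelve. all: by end_near. Qed.

End superadditive.

(** * Packing separated blocks into a cube *)

Section packing.
Context {R : realType} {d : nat}.
Variables (n k s m : nat).

(** The grid has pitch [s] and its first cube touches the corner with all coordinates -n, hence the
    offset k - n. *)
Definition block_center (j : {ffun 'I_d -> 'I_m}) : 'rV[R]_d :=
  \row_i (k%:R + (s * j i)%:R - n%:R)%R.

Definition block (j : {ffun 'I_d -> 'I_m}) : window R d :=
  shift_window (- block_center j) (cube k).

Lemma block_sub_cube j : (m * s <= 2 * n)%N -> (2 * k <= s)%N -> block j `<=` cube n.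
Proof.
move=> msn ks x xj i; have := xj i; rewrite !mxE.
have h1 : (s * j i + 2 * k <= 2 * n)%N.
  by have := ltn_ord (j i); nia.
have h2 : ((s * j i)%:R + 2 * k%:R <= 2 * n%:R :> R)%R.
  by rewrite -!natrM -natrD ler_nat.
have h3 : (0 <= (s * j i)%:R :> R)%R by [].
lra.
Qed.

(** In some coordinate the two centres are at least [s] apart, more than the sum (k + q) + k of the
    half-sides. The case q = 0 gives disjoint blocks, q = [r0] gives blocks that do not interact. *)
Lemma block_disjoint q i j : i != j -> (2 * k + q < s)%N ->
  shift_window (- block_center i) (cube (k + q)) `&` block j = set0.
Proof.
move=> ij qs; apply/seteqP; split=> // x [xi xj].
have [l ijl] : exists l, i l != j l.
  by apply/existsP; apply: contraNT ij => /existsPn h; apply/eqP/ffunP => l; apply/eqP/negPn/h.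
have := xi l; have := xj l; rewrite !mxE natrD.
have h : (s + s * i l <= s * j l \/ s + s * j l <= s * i l)%N.
  have : (i l < j l \/ j l < i l)%N.
    by case: (ltngtP (i l) (j l)) => [||/val_inj/eqP]; [left|right|rewrite (negbTE ijl)].
  by case; [left|right]; nia.
have h' : (s%:R + (s * i l)%:R <= (s * j l)%:R :> R \/
    s%:R + (s * j l)%:R <= (s * i l)%:R :> R)%R.
  by case: h => h; [left|right]; rewrite -natrD ler_nat.
have h2 : (2 * k%:R + q%:R < s%:R :> R)%R by rewrite -natrM -natrD ltr_nat.
move=> xj' xi'; exfalso; case: h' => h'; lra.
Qed.

End packing.

(** * Entropy in a window *)

Section local_entropy.
Context {R : realType} {d : nat}.
Implicit Types (P pi : probability (Omega R d) R) (L : window R d).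

Lemma ge0_integral_restricted P L (f : Omega R d -> \bar R) :
  measurable_fun setT f -> (forall w, 0 <= f w) ->
  \int[restricted_law P L]_w f w = \int[P]_w f (restrict_config L w).
Proof. by move=> mf f0; rewrite /restricted_law ge0_integral_distribution. Qed.

Lemma measurable_comp_restrict L (f : Omega R d -> \bar R) :
  measurable_fun setT f ->
  measurable_fun setT (fun w : Omega R d => f (restrict_config L w)).
Proof. by move=> mf; exact: (measurableT_comp mf (measurable_window_restrict L)). Qed.

Lemma integrable_restricted P L (f : Omega R d -> \bar R) :
  measurable_fun setT f ->
  P.-integrable setT (fun w => f (restrict_config L w)) ->
  (restricted_law P L).-integrable setT f.
Proof.
move=> mf /integrableP[_ fi]; apply/integrableP; split=> //.
rewrite ge0_integral_restricted//.
exact: measurableT_comp.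
Qed.

Lemma integral_restricted P L (f : Omega R d -> \bar R) :
  measurable_fun setT f ->
  P.-integrable setT (fun w => f (restrict_config L w)) ->
  \int[restricted_law P L]_w f w = \int[P]_w f (restrict_config L w).
Proof. by move=> mf fi; rewrite /restricted_law integral_distribution. Qed.

Lemma bounded_integrable P (f : Omega R d -> R) (M : R) :
  measurable_fun setT f -> (forall w, `|f w| <= M)%R ->
  P.-integrable setT (fun w => (f w)%:E).
Proof.
move=> mf fM; apply: (@le_integrable _ _ _ P _ measurableT _ (EFin \o cst M)).
- exact/measurable_EFinP.
- move=> w _ /=; rewrite lee_fin (le_trans (fM w))//; exact: ler_norm.
- exact: finite_measure_integrable_cst.
Qed.

Lemma local_donsker_varadhan P pi L (f : Omega R d -> \bar R) (e : R) :
  measurable_fun setT f ->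
  P.-integrable setT (fun w => f (restrict_config L w)) -> (0 < e)%R ->
  \int[pi]_w expeR (f (restrict_config L w)) <= e%:E ->
  \int[P]_w f (restrict_config L w) <=
    relative_entropy (restricted_law P L) (restricted_law pi L) + (ln e)%:E.
Proof.
move=> mf fi e0 fe; rewrite -integral_restricted//.
apply: donsker_varadhan => //; first exact: integrable_restricted.
rewrite ge0_integral_restricted//; last by move=> w; exact: expeR_ge0.
exact: (measurableT_comp measurable_expeR).
Qed.

Lemma local_relative_entropy_le P pi L (c : R) :
  (forall (h : Omega R d -> R) (e M : R), measurable_fun setT h ->
     (forall w, `|h w| <= M)%R -> (0 < e)%R ->
     \int[pi]_w (expR (h (restrict_config L w)))%:E <= e%:E ->
     \int[P]_w (h (restrict_config L w))%:E <= (c + ln e)%:E) ->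
  relative_entropy (restricted_law P L) (restricted_law pi L) <= c%:E.
Proof.
move=> hc; apply: relative_entropy_le => h e M mh hM e0 he.
have mhE : measurable_fun setT (fun w => (h w)%:E) by exact/measurable_EFinP.
have hi : P.-integrable setT (fun w => (h (restrict_config L w))%:E).
  apply: (@bounded_integrable _ (fun w => h (restrict_config L w)) M) => //.
  exact: (measurableT_comp mh (measurable_window_restrict L)).
rewrite (integral_restricted (f := fun w => (h w)%:E))//.
apply: (hc _ _ M) => //; rewrite -(ge0_integral_restricted _ _ (f := fun w => (expR (h w))%:E))//.
by apply/measurable_EFinP; exact: measurableT_comp.
Qed.

(** Donsker-Varadhan with the zero test function. *)
Lemma local_entropy_ge0 P pi L :
  0 <= relative_entropy (restricted_law P L) (restricted_law pi L).
Proof.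
have := @local_donsker_varadhan P pi L (cst 0) 1%R (measurable_cst _).
rewrite ln1 adde0 integral0; apply=> //; first exact: integrable0.
by rewrite /= expR0 integral_prob_cst.
Qed.

End local_entropy.

Section void.
Context {R : realType} {d : nat}.
Implicit Type L : window R d.

Lemma voidE L : (fun w : Omega R d => (npoints L w == 0%N)%:R%:E : \bar R) =
  (fun w => (\1_[set w : Omega R d | npoints L w = 0%N] w)%:E).
Proof.
apply/funext => w; rewrite indicE; congr (nat_of_bool _)%:R%:E.
by apply/eqP/idP => [|/set_mem//]; rewrite inE.
Qed.

Lemma measurable_void L :
  measurable_fun setT (fun w : Omega R d => (npoints L w == 0%N)%:R%:E : \bar R).
Proof.
rewrite voidE; apply/measurable_EFinP; apply: measurable_indic.
exact: measurable_npoints_eq.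
Qed.

Lemma integral_void (P : probability (Omega R d) R) L :
  \int[P]_w (npoints L w == 0%N)%:R%:E = P [set w | npoints L w = 0%N].
Proof.
by rewrite (voidE L) integral_indic ?setIT//; exact: measurable_npoints_eq.
Qed.

End void.

Section blocks.
Context {R : realType} {d : nat}.
Variable pi : probability (Omega R d) R.
Hypothesis pi_poisson : poisson_process pi.
Variables (n k s m : nat).
Hypotheses (ms : (m * s <= 2 * n)%N) (ks : (2 * k < s)%N).
Local Notation J := {ffun 'I_d -> 'I_m}.

(** Moving each block to the origin turns the observables of all blocks into one function of the
    central cube, so stationarity gives them equal laws. *)
Definition recenter (j : J) (w : Omega R d) : Omega R d :=
  restrict_config (cube k) (translate (- block_center n k s j) w).

Lemma recenterE (j : J) w : recenter j w =
  translate (- block_center n k s j) (restrict_config (block n k s j) w).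
Proof. exact: restrict_translate. Qed.

Lemma recenter_block (j : J) w :
  recenter j (restrict_config (block n k s j) w) = recenter j w.
Proof. by rewrite !recenterE restrict_config_sub. Qed.

Lemma recenter_cube (j : J) w : recenter j (restrict_config (cube n) w) = recenter j w.
Proof.
rewrite !recenterE restrict_config_sub//.
by apply: block_sub_cube => //; exact: ltnW.
Qed.

Lemma measurable_recenter (j : J) : measurable_fun setT (recenter j).
Proof.
exact: (measurableT_comp (measurable_window_restrict (cube k)) (measurable_translate _)).
Qed.

Lemma stationary_recenter (P : probability (Omega R d) R) (j : J) (f : Omega R d -> \bar R) :
  stationary P -> measurable_fun setT f -> (forall w, 0 <= f w) ->
  \int[P]_w f (recenter j w) = \int[P]_w f (restrict_config (cube k) w).
Proof.
move=> sP mf f0.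
rewrite (stationary_integral (- block_center n k s j)
  (f := fun w => f (restrict_config (cube k) w)))//.
exact: measurable_comp_restrict.
Qed.

(** The blocks are pairwise disjoint because 2k < s. Taking for [C] the corridors imposes that they
    are empty; the empty window imposes nothing. *)
Lemma poisson_blocks (C : window R d) (psi : Omega R d -> \bar R) :
  (forall j : J, block n k s j `&` C = set0) ->
  measurable_fun setT psi -> (forall w, 0 <= psi w) ->
  \int[pi]_w ((\prod_(j : J) psi (recenter j w)) *
              (npoints C w == 0%N)%:R%:E) =
  (\prod_(j : J) \int[pi]_w psi (restrict_config (cube k) w)) *
  pi [set w | npoints C w = 0%N].
Proof.
move=> JC mpsi psi0.
have mN := measurable_void C.
have NC (w : Omega R d) : npoints C (restrict_config C w) = npoints C w.
  by rewrite npoints_restrict setIid.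
transitivity (\int[pi]_w ((\prod_(j : J) psi (recenter j (restrict_config (block n k s j) w))) *
  (npoints C (restrict_config C w) == 0%N)%:R%:E)).
  apply: eq_integral => w _; rewrite NC; congr (_ * _).
  by apply: eq_bigr => j _; rewrite recenter_block.
rewrite (poisson_indep_prod pi_poisson (psi := fun j w => psi (recenter j w))
  (phi := fun w => (npoints C w == 0%N)%:R%:E))//.
- congr (_ * _); last first.
    under eq_integral do rewrite NC.
    exact: integral_void.
  apply: eq_bigr => j _; under eq_integral do rewrite recenter_block.
  by apply: stationary_recenter => //; exact: poisson_stationary.
- exact: index_enum_uniq.
- move=> i j ij; have := @block_disjoint R d n k s m 0 i j ij.
  by rewrite !addn0; apply.
- by move=> j; exact: (measurableT_comp mpsi (measurable_recenter j)).
Qed.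

Definition blocks_union : window R d := \big[@windowU R d/@window0 R d]_(j : J) block n k s j.

Lemma blocks_unionP x : window_set blocks_union x <-> exists j : J, window_set (block n k s j) x.
Proof.
rewrite /blocks_union; split.
  by elim/big_ind: _ => //= [U V IU IV [/IU|/IV]//|j _]; exists j.
move=> [j jx]; have : j \in index_enum {ffun 'I_d -> 'I_m} by rewrite mem_index_enum.
elim: (index_enum _) => // i t IH; rewrite big_cons inE => /predU1P[<-|/IH]; first by left.
by right.
Qed.

Definition corridors : window R d := windowD (cube n) blocks_union.

Lemma block_corridors (j : J) : block n k s j `&` corridors = set0.
Proof.
apply/seteqP; split=> // x [jx [_ nx]]; apply: nx.
by apply/blocks_unionP; exists j.
Qed.

Lemma restrict_no_corridors w : npoints corridors w = 0%N ->
  restrict_config (cube n) w = restrict_config blocks_union w.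
Proof.
move=> /npoints_eq0 => /(_ (window_bounded _)) wC; apply: config_ext.
apply/seteqP; split=> x /= [wx].
  move=> nx; split=> //; apply: contrapT => Ux.
  by have : (w `&` corridors) x by []; rewrite wC.
move=> /blocks_unionP[j jx]; split=> //.
by apply: block_sub_cube jx => //; exact: ltnW.
Qed.

End blocks.

Section intensity.
Context {R : realType} {d : nat}.

Lemma npoints_bigU_le (I : Type) (t : seq I) (F : I -> set 'rV[R]_d) w :
  (forall i, bounded_set (F i)) ->
  (npoints (\big[setU/set0]_(i <- t) F i) w <= \sum_(i <- t) npoints (F i) w)%N.
Proof.
move=> bF; elim: t => [|i t IH]; first by rewrite !big_nil npoints0.
rewrite !big_cons; apply: leq_trans (leq_add (leqnn _) IH).
have bt : bounded_set (\big[setU/set0]_(j <- t) F j).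
  by elim/big_ind: _ => //; [exact: bounded_set0|exact: bounded_setU].
rewrite /npoints setIUr fset_setU; [|exact: locally_finite..].
by rewrite -cardfsUI leq_addr.
Qed.

Lemma expected_npoints_le (P : probability (Omega R d) R) n : (0 < n)%N ->
  stationary P -> finite_intensity P ->
  \int[P]_w ((npoints (cube n) w)%:R)%:E <=
  ((2 * n) ^ d)%:R%:E * \int[P]_w ((npoints (box 0 1 : set 'rV[R]_d) w)%:R)%:E.
Proof.
move=> n0 sP fP.
pose u (j : {ffun 'I_d -> 'I_(2 * n)}) : 'rV[R]_d := \row_i ((j i)%:R - n%:R)%R.
pose U j : window R d := shift_window (- u j) (box_window 0 1).
have cover : (cube n : set 'rV[R]_d) `<=` \big[setU/set0]_(j : {ffun 'I_d -> 'I_(2 * n)}) (U j : set _).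
  move=> x xn; rewrite -bigcup_seq.
  (* The unit box is found by rounding down x + n. The cap at 2n - 1 serves the face x = n, which
     lies in the last closed box; overlaps are harmless for an upper bound. *)
  have lt i : (minn (Num.truncn (x ord0 i + n%:R)) (2 * n).-1 < 2 * n)%N.
    by rewrite gtn_min prednK ?leqnn ?orbT// muln_gt0.
  exists [ffun i => Ordinal (lt i)]; first by rewrite /= mem_index_enum.
  move=> i; rewrite !mxE ffunE /=.
  have /andP[x1 x2] := xn i.
  have y0 : (0 <= x ord0 i + n%:R)%R by lra.
  have /andP[t1 t2] := truncn_itv y0.
  have [tn|tn] := leqP (Num.truncn (x ord0 i + n%:R)) (2 * n).-1.
    by move: t1 t2; rewrite -natr1; lra.
  have : ((2 * n).-1.+1%:R <= (Num.truncn (x ord0 i + n%:R))%:R :> R)%R by rewrite ler_nat.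
  rewrite -natr1; have : ((2 * n).-1.+1%:R = 2 * n%:R :> R)%R.
    by rewrite prednK ?muln_gt0// natrM.
  rewrite -natr1; lra.
apply: (@le_trans _ _ (\int[P]_w \sum_(j : {ffun 'I_d -> 'I_(2 * n)}) ((npoints (U j) w)%:R)%:E)).
  apply: ge0_le_integral => //.
  - by apply/measurable_EFinP; exact: measurable_npointsR.
  - by apply: emeasurable_sum => j; apply/measurable_EFinP; exact: measurable_npointsR.
  - move=> w _; rewrite sumEFin lee_fin -natr_sum ler_nat.
    apply: leq_trans (npoints_bigU_le _ _ _); last by move=> j; exact: window_bounded.
    apply: le_npoints cover.
    by elim/big_ind: _ => [|A B|j _]; [exact: bounded_set0|exact: bounded_setU|exact: window_bounded].
rewrite ge0_integral_sum//; last first.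
  by move=> j; apply/measurable_EFinP; exact: measurable_npointsR.
rewrite (eq_bigr (fun=> \int[P]_w ((npoints (box 0 1 : set 'rV[R]_d) w)%:R)%:E)); last first.
  move=> j _; rewrite -(stationary_integral (- u j) sP (f := fun w => ((npoints (box 0 1 : set 'rV[R]_d) w)%:R)%:E))//.
    apply: eq_integral => w _; rewrite npoints_translate//; exact: (window_bounded (box_window 0 1)).
  by apply/measurable_EFinP; exact: (measurable_npointsR (box_window 0 1)).
have : \int[P]_w ((npoints (box 0 1 : set 'rV[R]_d) w)%:R)%:E \is a fin_num.
  by rewrite ge0_fin_numE ?integral_ge0// => w _; rewrite lee_fin.
case: (\int[P]_w _) => // x _.
by rewrite sumEFin sumr_const card_ffun !card_ord -EFinM mulr_natl.
Qed.

End intensity.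

Section image_density.
Context d1 d2 (T1 : measurableType d1) (T2 : measurableType d2) (R : realType).
Variables (mu : {measure set T1 -> \bar R}) (g : T1 -> T2) (D : T1 -> \bar R).
Hypotheses (mg : measurable_fun setT g) (mD : measurable_fun setT D).
Hypotheses (D_ge0 : forall x, 0 <= D x) (D_lty : forall x, D x < +oo).

(** The image under [g] of the measure with density [D] relative to [mu]. The hypotheses are
    arguments so that a measure structure can be attached to the function. It will represent the
    right-hand side of the Gibbs equation as a measure on configurations. *)
Definition image_density of measurable_fun setT g & measurable_fun setT D
    & (forall x, 0 <= D x) : set T2 -> \bar R :=
  fun E => \int[mu]_(x in g @^-1` E) D x.

Local Notation nu := (image_density mg mD D_ge0).

Let mpre E : measurable E -> measurable (g @^-1` E).
Proof. by move=> mE; rewrite -[X in measurable X]setTI; exact: mg. Qed.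

Let nu0 : nu set0 = 0.
Proof. by rewrite /image_density preimage_set0 integral_set0. Qed.

Let nu_ge0 E : 0 <= nu E.
Proof. exact: integral_ge0. Qed.

Let nu_sigma_additive : semi_sigma_additive nu.
Proof.
move=> F mF tF mUF; rewrite /image_density preimage_bigcup.
rewrite ge0_integral_bigcup//.
- apply: is_cvg_ereal_nneg_natsum_cond => n _ _; exact: integral_ge0.
- by move=> n; exact: mpre.
- exact: measurable_funTS.
- by move=> i j _ _ [x [Fi Fj]]; apply: tF => //; exists (g x).
Qed.

HB.instance Definition _ := isMeasure.Build _ _ _ nu nu0 nu_ge0 nu_sigma_additive.

Import HBNNSimple.

Lemma ge0_integral_image_density (f : T2 -> \bar R) :
  measurable_fun setT f -> (forall x, 0 <= f x) ->
  \int[nu]_x f x = \int[mu]_x (f (g x) * D x).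
Proof.
move=> mf f0; pose f_ := nnsfun_approx measurableT mf.
have mf_ n : measurable_fun setT (fun x => (f_ n x)%:E) by exact/measurable_EFinP.
have mfg n : measurable_fun setT (fun x => (f_ n (g x))%:E * D x).
  by apply: emeasurable_funM => //; exact: (measurableT_comp (mf_ n) mg).
have nd x : {homo (fun n => (f_ n x)%:E) : n m / (n <= m)%N >-> n <= m}.
  by move=> a b ab; rewrite lee_fin; exact/lefP/nd_nnsfun_approx.
have step n : \int[nu]_x (f_ n x)%:E = \int[mu]_x ((f_ n (g x))%:E * D x).
  rewrite integralT_nnsfun sintegralE.
  have E y : y%:E * nu (f_ n @^-1` [set y]) =
      \int[mu]_x (y%:E * (\1_(f_ n @^-1` [set y]) (g x))%:E * D x).
    have [y0|y0] := leP 0%R y; last first.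
      rewrite preimage_nnfun0// measure0 mule0 integral0_eq// => x _.
      by rewrite indic0 mule0 mul0e.
    under eq_integral do rewrite -muleA.
    have m1 : measurable (f_ n @^-1` [set y]) by [].
    have mi : measurable_fun setT (fun x : T1 => (\1_(f_ n @^-1` [set y]) (g x))%:E : \bar R).
      apply/measurable_EFinP; apply: (measurableT_comp _ mg).
      exact: measurable_indic.
    rewrite ge0_integralZl//; last 2 first.
    - exact: emeasurable_funM.
    - by move=> x _; rewrite mule_ge0// lee_fin.
    congr (_ * _); rewrite /image_density integral_mkcond.
    apply: eq_integral => x _; rewrite patchE indicE.
    rewrite [X in if X then _ else _](_ : _ = (g x \in f_ n @^-1` [set y])).
      by case: (g x \in _); rewrite ?mul1e ?mul0e.
    by apply/idP/idP; rewrite !inE.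
  under eq_fsbigr do rewrite E.
  rewrite -ge0_integral_fsum//; last 2 first.
  - move=> y; apply: emeasurable_funM => //; apply: emeasurable_funM => //.
    apply/measurable_EFinP; apply: (measurableT_comp _ mg).
    exact: measurable_indic.
  - move=> y x _; rewrite mule_ge0//.
    exact: nnfun_muleindic_ge0.
  apply: eq_integral => x _.
  rewrite -ge0_mule_fsuml; last by move=> y; exact: nnfun_muleindic_ge0.
  congr (_ * _).
  by rewrite [in RHS](fimfunE (f_ n)) -fsumEFin.
transitivity (limn (fun n => \int[nu]_x (f_ n x)%:E)).
  rewrite -monotone_convergence//; last by move=> n x _; rewrite lee_fin.
  by apply: eq_integral => x _; apply/esym/cvg_lim => //; exact: cvg_nnsfun_approx.
rewrite (_ : (fun n => _) = (fun n => \int[mu]_x ((f_ n (g x))%:E * D x))); last exact/funext.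
rewrite -monotone_convergence//; last 2 first.
- by move=> n x _; rewrite mule_ge0// lee_fin.
- by move=> x _ a b ab; rewrite lee_wpmul2r//; exact: nd.
apply: eq_integral => x _; apply/cvg_lim => //.
have Df : D x \is a fin_num by rewrite ge0_fin_numE.
apply: cvgeZr => //; exact: cvg_nnsfun_approx.
Qed.

End image_density.

(** * Partition functions and the pressure *)

Section products.
Context {R : realType}.

Lemma prode_EFin (I : Type) (t : seq I) (f : I -> R) :
  \prod_(i <- t) (f i)%:E = (\prod_(i <- t) f i)%R%:E.
Proof. by elim: t => [|i t IH]; rewrite ?big_nil// !big_cons IH. Qed.

Lemma expeR_oppD (x y : \bar R) : -oo < x -> -oo < y ->
  expeR (- (x + y)) = expeR (- x) * expeR (- y).
Proof.
case: x y => [x| |] [y| |]//= _ _; rewrite ?mule0 ?mul0e//.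
by rewrite -EFinM -expRD opprD.
Qed.

Lemma prode_ge0 (I : Type) (t : seq I) (f : I -> \bar R) :
  (forall i, 0 <= f i) -> 0 <= \prod_(i <- t) f i.
Proof.
by move=> f0; elim: t => [|i t IH]; rewrite ?big_nil ?big_cons ?lee_fin// mule_ge0.
Qed.

Lemma expeR_sum (I : Type) (t : seq I) (f : I -> R) :
  (expR (\sum_(i <- t) f i)%R)%:E = \prod_(i <- t) (expR (f i))%:E.
Proof.
elim: t => [|i t IH]; first by rewrite !big_nil expR0.
by rewrite !big_cons expRD EFinM IH.
Qed.

Lemma prode_const (I : finType) (x : R) : \prod_(i : I) x%:E = (x ^+ #|I|)%:E.
Proof. by rewrite prode_EFin prodr_const. Qed.

Lemma measurable_prode d (T : measurableType d) (I : Type) (t : seq I)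
    (f : I -> T -> \bar R) :
  (forall i, measurable_fun setT (f i)) ->
  measurable_fun setT (fun x => \prod_(i <- t) f i x).
Proof.
move=> mf; elim: t => [|i t IH].
  by under eq_fun do rewrite big_nil; exact: measurable_cst.
by under eq_fun do rewrite big_cons; exact: emeasurable_funM.
Qed.

End products.

Section thermodynamics.
Context {R : realType} {d : nat}.
Hypothesis d_gt0 : (0 < d)%N.
Variable pi : probability (Omega R d) R.
Hypothesis pi_poisson : poisson_process pi.
Variable H : Omega R d -> \bar R.
Hypothesis H_meas : measurable_fun (finite_config : set (Omega R d)) H.
Hypothesis H_gtNy : forall w, finite_config w -> H w != -oo.
Hypothesis H_stationary : stationary_energy H.
Hypothesis H_hereditary : hereditary H.
Hypothesis H_non_degenerate : non_degenerate H.
Variable A : R.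
Hypothesis A_gt0 : (0 < A)%R.
Hypothesis H_stable : forall w, finite_config w ->
  - (A * (npoints setT w)%:R)%:E <= H w.
Variables (r : R) (r0 : nat).
Hypothesis r_ge0 : (0 <= r)%R.
Hypothesis H_range : has_range H r.
Hypothesis rr0 : (r <= r0%:R)%R.
Implicit Types (L : window R d) (w : Omega R d).

Local Notation vol n := (((2 * n) ^ d)%:R : R).

Lemma vol_gt0 n : (0 < n)%N -> (0 < vol n)%R.
Proof. by move=> n0; rewrite ltr0n expn_gt0 muln_gt0 n0. Qed.

Lemma divide_vol (x : R) n : (0 < n)%N ->
  x%:E / lebesgue_rV (@cube R d n) = (x / vol n)%:E.
Proof. by move=> n0; rewrite lebesgue_rV_cube inver gt_eqF// vol_gt0. Qed.

Lemma energy_stable L w : - (A * (npoints L w)%:R)%:E <= H (restrict_config L w).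
Proof.
have := H_stable (finite_restrict w (window_bounded L)).
by rewrite npoints_restrict setIT.
Qed.

Lemma expe_energy_le L w :
  expeR (- H (restrict_config L w)) <= (expR (A * (npoints L w)%:R))%:E.
Proof.
rewrite -[leRHS]/(expeR (A * (npoints L w)%:R)%:E) lee_expeR.
by rewrite leeNl; exact: energy_stable.
Qed.

Lemma poisson_exp_moment_window (a : R) L : (0 <= a)%R ->
  \int[pi]_w (expR (a * (npoints L w)%:R))%:E < +oo.
Proof.
move=> a0; have [n Ln] := bounded_set_cube (window_bounded L).
apply: le_lt_trans (poisson_exp_moment pi_poisson a (ltn0Sn n) d_gt0).
have mN L' : measurable_fun setT (fun w => (expR (a * (npoints L' w)%:R))%:E).
  apply/measurable_EFinP; apply: measurableT_comp => //.
  by apply: measurable_funM => //; exact: measurable_npointsR.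
apply: ge0_le_integral => //.
- move=> w _; rewrite lee_fin ler_expR ler_wpM2l// ler_nat.
  apply: le_npoints; first exact: window_bounded.
  by apply: subset_trans Ln _; exact: subset_cube.
Qed.

Definition free_partition L : \bar R :=
  \int[pi]_w expeR (- H (restrict_config L w)).

Lemma measurable_expe_energy L :
  measurable_fun setT (fun w => expeR (- H (restrict_config L w))).
Proof.
apply: (measurableT_comp measurable_expeR); apply: measurableT_comp => //.
exact: measurable_energy.
Qed.

Lemma free_partition_lty L : free_partition L < +oo.
Proof.
apply: le_lt_trans (poisson_exp_moment_window L (ltW A_gt0)).
apply: ge0_le_integral => //.
- by move=> w _; exact: expeR_ge0.
- exact: measurable_expe_energy.
- apply/measurable_EFinP; apply: measurableT_comp => //.
  by apply: measurable_funM => //; exact: measurable_npointsR.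
- by move=> w _; exact: expe_energy_le.
Qed.

Lemma le_void_integral (L : window R d) (f : Omega R d -> \bar R) (c : R) :
  measurable_fun setT f -> (forall w, 0 <= f w) -> (0 <= c)%R ->
  (forall w, npoints L w = 0%N -> c%:E <= f w) ->
  (c * expR (- fine (lebesgue_rV L)))%:E <= \int[pi]_w f w.
Proof.
move=> mf f0 c0 fc; rewrite EFinM -(poisson_void pi_poisson).
have mE : measurable [set w : Omega R d | npoints L w = 0%N].
  exact: measurable_npoints_eq.
apply: (@le_trans _ _ (\int[pi]_(w in [set w : Omega R d | npoints L w = 0%N]) c%:E)).
  by rewrite integral_cst.
apply: (@le_trans _ _ (\int[pi]_(w in [set w : Omega R d | npoints L w = 0%N]) f w)).
  by apply: ge0_le_integral => //; exact: measurable_funTS.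
by apply: ge0_subset_integral.
Qed.

Lemma restrict_void (B : set 'rV[R]_d) L w : B `<=` L -> npoints L w = 0%N ->
  restrict_config B w = empty_config.
Proof.
move=> BL /npoints_eq0 => /(_ (window_bounded L)) wL; apply: config_ext.
apply/seteqP; split=> // x [wx Bx]; have : (w `&` L) x by split=> //; exact: BL.
by rewrite wL.
Qed.

(** The contribution of the empty configuration, which has zero energy. *)
Lemma free_partition_ge L : (expR (- fine (lebesgue_rV L)))%:E <= free_partition L.
Proof.
rewrite -[X in X%:E]mul1r; apply: le_void_integral => //.
- exact: measurable_expe_energy.
- by move=> w; exact: expeR_ge0.
- move=> w wL; rewrite (restrict_void (L := L))// H_non_degenerate.2.
  by rewrite oppe0 expeR0.
Qed.

Definition zfree n : R := fine (free_partition (cube n)).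

Lemma zfreeE n : (zfree n)%:E = free_partition (cube n).
Proof.
rewrite fineK// ge0_fin_numE ?free_partition_lty// integral_ge0//.
by move=> w _; exact: expeR_ge0.
Qed.

Lemma zfree_ge n : (expR (- vol n) <= zfree n)%R.
Proof.
rewrite -lee_fin zfreeE; apply: le_trans (free_partition_ge _).
by rewrite lebesgue_rV_cube.
Qed.

Lemma zfree_gt0 n : (0 < zfree n)%R.
Proof. by apply: lt_le_trans (zfree_ge n); exact: expR_gt0. Qed.

Section blocks.
Variables (n k m : nat).
(** The gap r0 + 1 exceeds the range, so distinct blocks do not interact. *)
Let s := (2 * k + r0.+1)%N.
Hypothesis ms : (m * s <= 2 * n)%N.
Local Notation J := {ffun 'I_d -> 'I_m}.

Let ks : (2 * k < s)%N. Proof. by rewrite /s addnS ltnS leq_addr. Qed.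

Lemma expe_energy_blocks w :
  expeR (- H (restrict_config (blocks_union n k s m) w)) =
  \prod_(j : J) expeR (- H (recenter n k s j w)).
Proof.
rewrite /blocks_union; have := index_enum_uniq J.
elim: (index_enum _) => [|i t IH].
  by rewrite !big_nil /= restrict_config_set0 H_non_degenerate.2 oppe0 expeR0.
move=> /= /andP[it ut]; rewrite !big_cons -{}IH//.
set B := \big[windowU/window0]_(j <- t) _.
have HE : H (recenter n k s i w) = H (restrict_config (block n k s i) w).
  rewrite recenterE; apply: H_stationary.
  exact/finite_restrict/window_bounded.
rewrite HE /=.
rewrite (@energy_separated _ _ _ H_gtNy H_hereditary H_non_degenerate r r_ge0 H_range
  (block n k s i) (shift_window (- block_center n k s i) (cube (k + r0))) B).
- by rewrite expeR_oppD ?energy_gtNy.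
- rewrite /block /= minkowski_shift => x /=.
  exact: minkowski_sum_cube.
- rewrite /B; elim: t it {ut B} => [|j t IH]; first by rewrite big_nil /= setI0.
  rewrite inE negb_or => /andP[ij it]; rewrite big_cons /= setIUr IH// setU0.
  by apply: block_disjoint => //; rewrite /s addnS.
Qed.

(** If the cube is empty, then so are all blocks and the corridors, which are independent. This
    bounds the void probability of the corridors from below without computing their volume. *)
Lemma void_blocks :
  (expR (- vol n) <= expR (- vol k) ^+ #|J| * fine (pi [set w | npoints (corridors n k s m) w = 0%N]))%R.
Proof.
have pf : pi [set w | npoints (corridors n k s m) w = 0%N] \is a fin_num.
  by apply: fin_num_measure; exact: measurable_npoints_eq.
pose psi (w : Omega R d) : \bar R := (npoints (cube k) w == 0%N)%:R%:E.
have mpsi : measurable_fun setT psi by exact: measurable_void.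
have psi0 w : 0 <= psi w by rewrite lee_fin.
have := poisson_blocks pi_poisson (C := corridors n k s m) ks
  (@block_corridors R d n k s m) mpsi psi0.
have -> : \int[pi]_w psi (restrict_config (cube k) w) = (expR (- vol k))%:E.
  rewrite (_ : vol k = fine (lebesgue_rV (@cube R d k))); last by rewrite lebesgue_rV_cube.
  rewrite -(poisson_void pi_poisson).
  rewrite -integral_void; apply: eq_integral => w _.
  by rewrite /psi npoints_restrict setIid.
rewrite prode_const -[X in _ = _ * X](fineK pf) -EFinM => hE.
rewrite -lee_fin -hE -[X in X%:E]mul1r.
rewrite (_ : vol n = fine (lebesgue_rV (@cube R d n))); last by rewrite lebesgue_rV_cube.
have mN := measurable_void (corridors n k s m).
apply: le_void_integral => //.
- apply: emeasurable_funM => //; apply: measurable_prode => j.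
  exact: (measurableT_comp mpsi (measurable_recenter n k s j)).
- by move=> w; rewrite mule_ge0// prode_ge0.
- move=> w wn.
  have sub L : L `<=` cube n -> npoints L w = 0%N.
    by move=> Ln; apply/eqP; rewrite -leqn0 -wn le_npoints//; exact: window_bounded.
  rewrite (sub (corridors n k s m)); last by move=> x [].
  rewrite eqxx mule1 big1// => j _; rewrite /psi /recenter npoints_restrict setIid.
  rewrite npoints_translate; last exact: window_bounded.
  rewrite (sub (block n k s j)) ?eqxx//.
  by apply: block_sub_cube => //; exact: ltnW.
Qed.

(** Only configurations with empty corridors are kept; for these the energy is the sum of the block
    energies, and the blocks are independent. *)
Lemma zfree_blocks : (zfree k ^+ #|J| *
  fine (pi [set w | npoints (corridors n k s m) w = 0%N]) <= zfree n)%R.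
Proof.
have pf : pi [set w | npoints (corridors n k s m) w = 0%N] \is a fin_num.
  by apply: fin_num_measure; exact: measurable_npoints_eq.
rewrite -lee_fin zfreeE EFinM fineK//.
have E : (zfree k)%:E =
    \int[pi]_w (fun v => expeR (- H (restrict_config (cube k) v))) (restrict_config (cube k) w).
  by rewrite zfreeE; apply: eq_integral => w _; rewrite restrict_config_sub.
rewrite -prode_const E -(@poisson_blocks R d pi pi_poisson n k s m ks
  (corridors n k s m) (fun w => expeR (- H (restrict_config (cube k) w)))); last 3 first.
- exact: block_corridors.
- exact: measurable_expe_energy.
- by move=> w; exact: expeR_ge0.
have rr (j : J) w : restrict_config (cube k) (recenter n k s j w) = recenter n k s j w.
  by rewrite restrict_config_sub.
apply: ge0_le_integral => //.
- by move=> w _; rewrite mule_ge0// prode_ge0// => j; exact: expeR_ge0.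
- apply: emeasurable_funM; last exact: measurable_void.
  apply: measurable_prode => j.
  exact: (measurableT_comp (measurable_expe_energy (cube k)) (measurable_recenter n k s j)).
- exact: measurable_expe_energy.
- move=> w _; have [wC|_] := eqVneq (npoints (corridors n k s m) w) 0%N.
    rewrite mule1 (restrict_no_corridors ms ks wC) expe_energy_blocks.
    by under eq_bigr do rewrite rr.
  by rewrite mule0; exact: expeR_ge0.
Qed.

(** The void probability of the corridors is eliminated between [void_blocks] and [zfree_blocks];
    each block then contributes its volume besides its logarithm. *)
Lemma log_zfree_super : ((m ^ d)%:R * (ln (zfree k) + vol k) <= ln (zfree n) + vol n)%R.
Proof.
have h1 := void_blocks; have h2 := zfree_blocks.
set q := fine _ in h1 h2.
have q0 : (0 < q)%R.
  have := lt_le_trans (expR_gt0 _) h1.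
  by rewrite pmulr_rgt0// exprn_gt0// expR_gt0.
have cJ : #|J| = (m ^ d)%N by rewrite card_ffun !card_ord.
rewrite cJ in h1 h2.
rewrite -ler_ln ?posrE ?expR_gt0 ?mulr_gt0 ?exprn_gt0 ?expR_gt0// in h1.
rewrite -ler_ln ?posrE ?zfree_gt0 ?mulr_gt0 ?exprn_gt0 ?zfree_gt0// in h2.
rewrite lnM ?posrE ?exprn_gt0 ?zfree_gt0// lnXn ?zfree_gt0// in h2.
rewrite lnM ?posrE ?exprn_gt0 ?expR_gt0// lnXn ?expR_gt0// !expRK in h1.
rewrite -mulr_natl in h2; rewrite -mulr_natl in h1.
lra.
Qed.

End blocks.

Lemma cvg_log_zfree : exists p : \bar R, (ln (zfree n) / vol n)%:E @[n --> \oo] --> p.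
Proof.
(* Adding the volume also makes the sequence non-negative; after division it shifts the limit by 1,
   hence the witness l - 1. *)
pose b n : \bar R := (ln (zfree n) + vol n)%:E.
have b0 n : 0 <= b n.
  rewrite lee_fin -lerBlDr sub0r -(expRK (- vol n)%R) ler_ln ?posrE ?expR_gt0 ?zfree_gt0//.
  exact: zfree_ge.
have bs k m n : (0 < k)%N -> (m * (2 * k + r0.+1) <= 2 * n)%N ->
    (m ^ d)%:R%:E * b k <= b n.
  by move=> k0 mn; rewrite /b -EFinM lee_fin; exact: log_zfree_super.
have /cvg_ex[l bl] := cvg_superadditive b0 bs.
exists (l - 1).
have : (b n / (vol n)%:E - 1) @[n --> \oo] --> l - 1.
  by apply: cvgeB => //; [rewrite fin_num_adde_defl|exact: cvg_cst].
apply: cvg_trans; apply: near_eq_cvg; near=> n.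
have n0 : (0 < n)%N by near: n; exact: nbhs_infty_gt.
rewrite /b inver gt_eqF ?vol_gt0// -EFinM -EFinB; congr EFin.
by rewrite mulrDl divff ?gt_eqF ?vol_gt0// addrK.
Unshelve. all: by end_near. Qed.

Lemma pressure_cvg : (ln (zfree n) / vol n)%:E @[n --> \oo] --> pressure pi H.
Proof.
have [p hp] := cvg_log_zfree.
suff -> : pressure pi H = p by [].
apply/cvg_lim => //; apply: cvg_trans hp; apply: near_eq_cvg; near=> n.
have n0 : (0 < n)%N by near: n; exact: nbhs_infty_gt.
rewrite -divide_vol//; congr (_ / _).
rewrite -lne_EFin ?zfree_gt0// zfreeE; congr lne.
rewrite /restricted_law /distribution ge0_integral_pushforward//.
- rewrite (_ : _ @^-1` _ = setT)//.
  by apply/seteqP; split=> // w _; exact/finite_restrict/window_bounded.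
- exact: measurable_finite_config.
- apply: (measurableT_comp measurable_expeR); exact: measurableT_comp.
- by move=> w _; exact: expeR_ge0.
Unshelve. all: by end_near. Qed.

(** * The variational inequality *)

Lemma stationary_integrable (P : probability (Omega R d) R) u (f : Omega R d -> \bar R) :
  stationary P -> measurable_fun setT f ->
  P.-integrable setT (fun w => f (translate u w)) ->
  \int[P]_w f (translate u w) = \int[P]_w f w.
Proof.
move=> sP mf fi; have mt := @measurable_translate R d u.
pose tr : Omega R d -> Omega R d := translate u.
pose Q : {measure set (Omega R d) -> \bar R} := pushforward P tr.
transitivity (\int[Q mt]_w f w); first by rewrite /Q integral_pushforward.
by apply: eq_measure_integral => B mB _; exact: sP.
Qed.

Lemma stationary_recenter_bounded (P : probability (Omega R d) R) n k s m
    (j : {ffun 'I_d -> 'I_m}) (h : Omega R d -> R) (M : R) :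
  stationary P -> measurable_fun setT h -> (forall w, `|h w| <= M)%R ->
  \int[P]_w (h (recenter n k s j w))%:E = \int[P]_w (h (restrict_config (cube k) w))%:E.
Proof.
move=> sP mh hM.
rewrite (stationary_integrable (u := (- block_center n k s j)%R)
  (f := fun w => (h (restrict_config (cube k) w))%:E) sP)//.
- apply/measurable_EFinP.
  exact: (measurableT_comp mh (measurable_window_restrict (cube k))).
- apply: (@bounded_integrable _ _ _ (fun w => h (recenter n k s j w)) M) => //.
  exact: (measurableT_comp mh (measurable_recenter n k s j)).
Qed.

Local Notation entropy P n := (relative_entropy (restricted_law P (cube n))
  (restricted_law pi (cube n))).
Local Notation energy P n := (\int[P]_w H (restrict_config (cube n) w)).

Lemma integral_blocks (P : probability (Omega R d) R) n k s m
    (h : Omega R d -> R) (M : R) :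
  stationary P -> measurable_fun setT h -> (forall w, `|h w| <= M)%R ->
  \int[P]_w (\sum_(j : {ffun 'I_d -> 'I_m}) h (recenter n k s j w))%R%:E =
  (m ^ d)%:R%:E * \int[P]_w (h (restrict_config (cube k) w))%:E.
Proof.
move=> sP mh hM.
under eq_integral do rewrite -sumEFin.
have hi (j : {ffun 'I_d -> 'I_m}) :
    P.-integrable setT (fun w => (h (recenter n k s j w))%:E).
  apply: (@bounded_integrable _ _ _ (fun w => h (recenter n k s j w)) M) => //.
  exact: (measurableT_comp mh (measurable_recenter n k s j)).
rewrite integral_sum//.
under eq_bigr do rewrite (stationary_recenter_bounded _ _ _ _ sP mh hM).
have : \int[P]_w (h (restrict_config (cube k) w))%:E \is a fin_num.
  apply: integrable_fin_num => //.
  apply: (@bounded_integrable _ _ _ (fun w => h (restrict_config (cube k) w)) M) => //.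
  exact: (measurableT_comp mh (measurable_window_restrict (cube k))).
case: (\int[P]_w _) => // x _.
by rewrite sumEFin sumr_const card_ffun !card_ord -EFinM mulr_natl.
Qed.

Lemma measurable_sum_blocks n k s m (h : Omega R d -> R) :
  measurable_fun setT h -> measurable_fun setT
    (fun w => \sum_(j : {ffun 'I_d -> 'I_m}) h (recenter n k s j w))%R.
Proof.
move=> mh; apply: measurable_sum => j.
exact: (measurableT_comp mh (measurable_recenter n k s j)).
Qed.

Lemma le_sum_blocks n k s m (h : Omega R d -> R) (M : R) w :
  (forall w, `|h w| <= M)%R ->
  (`|\sum_(j : {ffun 'I_d -> 'I_m}) h (recenter n k s j w)| <= (m ^ d)%:R * M)%R.
Proof.
move=> hM; rewrite (le_trans (ler_norm_sum _ _ _))//.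
rewrite (le_trans (ler_sum _ (fun j _ => hM (recenter n k s j w))))//.
by rewrite sumr_const card_ffun !card_ord mulr_natl.
Qed.

(** A test function [h] on the small cube yields the sum of its copies over the blocks, whose
    exponential moment factors by independence. Donsker-Varadhan in the large cube bounds the mean
    of [h], and the converse bound turns this into one on the small entropy. The gap 1 keeps the
    closed blocks disjoint. *)
Lemma entropy_super (P : probability (Omega R d) R) k m n :
  stationary P -> (m * (2 * k + 1) <= 2 * n)%N ->
  (m ^ d)%:R%:E * entropy P k <= entropy P n.
Proof.
move=> sP mn; have [->|m0] := posnP m.
  by rewrite exp0n// mul0e local_entropy_ge0.
have m0R : (0 < (m ^ d)%:R :> R)%R by rewrite ltr0n expn_gt0 m0.
set s := (2 * k + 1)%N in mn.
have ks : (2 * k < s)%N by rewrite /s addn1.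
case Ec : (entropy P n) => [c| |]; last 2 first.
- by rewrite leey.
- by have := local_entropy_ge0 P pi (cube n); rewrite Ec.
rewrite muleC -lee_pdivlMr// -EFinM.
apply: local_relative_entropy_le => h e M mh hM e0 he.
pose F w := (\sum_(j : {ffun 'I_d -> 'I_m}) h (recenter n k s j w))%R.
have FE w : F (restrict_config (cube n) w) = F w.
  by apply: eq_bigr => j _; rewrite recenter_cube.
have mF : measurable_fun setT F by exact: measurable_sum_blocks.
have Fi : P.-integrable setT (fun w => (F (restrict_config (cube n) w))%:E).
  apply: (@bounded_integrable _ _ _ (fun w => F (restrict_config (cube n) w)) ((m ^ d)%:R * M)%R).
    exact: (measurableT_comp mF (measurable_window_restrict (cube n))).
  by move=> w; exact: le_sum_blocks.
have mFE : measurable_fun setT (fun w => (F w)%:E) by exact/measurable_EFinP.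
have h2 : \int[pi]_w expeR (F (restrict_config (cube n) w))%:E <= (e ^+ (m ^ d))%:E.
  have me : measurable_fun setT (fun w => (expR (h w))%:E).
    by apply/measurable_EFinP; exact: measurableT_comp.
  have d0 (j : {ffun 'I_d -> 'I_m}) :
      (block n k s j : set 'rV[R]_d) `&` (window0 : window R d) = set0.
    by rewrite /= setI0.
  have h0 w : 0 <= (expR (h w))%:E by rewrite lee_fin expR_ge0.
  have hE := @poisson_blocks R d pi pi_poisson n k s m ks window0 _ d0 me h0.
  rewrite (_ : \int[pi]_w _ = \int[pi]_w ((\prod_(j : {ffun 'I_d -> 'I_m}) (expR (h (recenter n k s j w)))%:E) *
     (npoints (window0 : window R d) w == 0%N)%:R%:E)); last first.
    apply: eq_integral => w _; rewrite npoints0 eqxx mule1 /= FE /F.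
    by rewrite expeR_sum.
  rewrite hE (_ : [set w | _] = setT); last first.
    by apply/seteqP; split=> // w _; rewrite /= npoints0.
  rewrite [X in _ * X]probability_setT mule1.
  have z0 : 0 <= \int[pi]_w (expR (h (restrict_config (cube k) w)))%:E.
    by apply: integral_ge0 => w _; rewrite lee_fin expR_ge0.
  have : \int[pi]_w (expR (h (restrict_config (cube k) w)))%:E \is a fin_num.
    by rewrite ge0_fin_numE// (le_lt_trans he)// ltry.
  move: he z0; case: (\int[pi]_w _) => // z; rewrite !lee_fin => ze z0 _.
  by rewrite prode_const lee_fin card_ffun !card_ord lerXn2r// nnegrE// ltW.
have {h2} := @local_donsker_varadhan R d P pi (cube n) _ _ mFE Fi (exprn_gt0 _ e0) h2.
rewrite Ec.
under eq_integral do rewrite FE.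
rewrite (integral_blocks n k s m sP mh hM).
have : \int[P]_w (h (restrict_config (cube k) w))%:E \is a fin_num.
  apply: integrable_fin_num => //.
  apply: (@bounded_integrable _ _ _ (fun w => h (restrict_config (cube k) w)) M) => //.
  exact: (measurableT_comp mh (measurable_window_restrict (cube k))).
case: (\int[P]_w _) => // x _; rewrite -EFinM -EFinD !lee_fin => hx.
rewrite lnXn// -[(ln e *+ _)%R]mulr_natl in hx.
rewrite -(ler_pM2l m0R) mulrDr mulrCA divff ?mulr1 ?gt_eqF//.
Qed.

Lemma cvg_specific_entropy (P : probability (Omega R d) R) : stationary P ->
  (entropy P n / lebesgue_rV (@cube R d n)) @[n --> \oo] --> specific_entropy pi P.
Proof.
move=> sP; suff : cvgn (fun n => entropy P n / lebesgue_rV (@cube R d n)) by [].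
under eq_fun do rewrite lebesgue_rV_cube.
apply: (@cvg_superadditive _ _ _ 1%N).
- by move=> n; exact: local_entropy_ge0.
- by move=> k m n _; exact: entropy_super.
Qed.

Section energy_of_process.
Variable P : probability (Omega R d) R.
Hypothesis P_proc : stationary_process P.

Let c0 := fine (\int[P]_w ((npoints (box 0 1 : set 'rV[R]_d) w)%:R)%:E).

Let c0E : c0%:E = \int[P]_w ((npoints (box 0 1 : set 'rV[R]_d) w)%:R)%:E.
Proof.
rewrite fineK// ge0_fin_numE; first exact: P_proc.2.
by apply: integral_ge0 => w _; rewrite lee_fin.
Qed.

Let mAN n : measurable_fun setT (fun w => (A * (npoints (cube n) w)%:R)%:E).
Proof. by apply/measurable_EFinP; apply: measurable_funM => //; exact: measurable_npointsR. Qed.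

Lemma expected_AN_le n : (0 < n)%N ->
  \int[P]_w (A * (npoints (cube n) w)%:R)%:E <= (A * (vol n * c0))%:E.
Proof.
move=> n0; under eq_integral do rewrite EFinM.
rewrite ge0_integralZl_EFin ?(ltW A_gt0)//; last first.
  by apply/measurable_EFinP; exact: measurable_npointsR.
rewrite !EFinM lee_wpmul2l ?lee_fin ?(ltW A_gt0)// c0E.
by apply: expected_npoints_le => //; case: P_proc.
Qed.

Lemma AN_integrable n : (0 < n)%N ->
  P.-integrable setT (fun w => (A * (npoints (cube n) w)%:R)%:E).
Proof.
move=> n0; apply/integrableP; split=> //.
under eq_integral do rewrite gee0_abs ?lee_fin ?mulr_ge0 ?(ltW A_gt0)//.
exact: le_lt_trans (expected_AN_le n0) (ltry _).
Qed.

Lemma energy_negative_part n : (0 < n)%N ->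
  \int[P]_w (fun w => H (restrict_config (cube n) w))^\- w \is a fin_num.
Proof.
move=> n0; pose f w := H (restrict_config (cube n) w).
have mf : measurable_fun setT f by exact: measurable_energy.
have [_ ANoo] := integrableP _ _ _ (AN_integrable n0).
rewrite ge0_fin_numE; last by apply: integral_ge0 => w _; exact: funeneg_ge0.
apply: le_lt_trans ANoo; apply: ge0_le_integral => //.
- exact: measurable_funeneg.
- exact: measurableT_comp.
- move=> w _; rewrite funenegE gee0_abs ?lee_fin ?mulr_ge0 ?(ltW A_gt0)//.
  rewrite ge_max leeNl energy_stable/= lee_fin.
  by rewrite mulr_ge0 ?(ltW A_gt0).
Qed.

Lemma energy_integrable n : (0 < n)%N -> energy P n < +oo ->
  P.-integrable setT (fun w => H (restrict_config (cube n) w)).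
Proof.
move=> n0 Eoo; have negf := energy_negative_part n0.
pose f w := H (restrict_config (cube n) w).
have mf : measurable_fun setT f by exact: measurable_energy.
rewrite -/f in negf.
have neg : \int[P]_w f^\- w < +oo by move: negf; case: (\int[P]_w _) => // a _; exact: ltry.
apply/integrableP; split=> //.
rewrite [X in X < _](_ : _ = \int[P]_w (f^\+ w + f^\- w)); last first.
  by apply: eq_integral => w _; rewrite -[LHS]/((abse \o f) w) fune_abse.
rewrite ge0_integralD//; [|exact: measurable_funepos|exact: measurable_funeneg].
rewrite lte_add_pinfty//.
move: Eoo; rewrite -/f [X in (X < _ -> _)](integralE P setT f).
by rewrite lteBlDr// => /lt_le_trans; apply; rewrite leey.
Qed.

Lemma energy_ge n : (0 < n)%N -> (- (A * (vol n * c0)))%:E <= energy P n.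
Proof.
move=> n0; have ANi := AN_integrable n0.
apply: (@le_trans _ _ (\int[P]_w - (A * (npoints (cube n) w)%:R)%:E)).
  rewrite integral_ge0N; last first.
    by move=> w _; rewrite lee_fin mulr_ge0 ?(ltW A_gt0).
  by rewrite EFinN leeN2; exact: expected_AN_le.
apply: ae_le_integral; first exact: integrableN.
- exact: measurable_energy.
- by apply: aeW => w; exact: energy_stable.
Qed.

(** Donsker-Varadhan for [h] minus the energy. The choice h = 0 gives the variational inequality,
    sums of Gibbs defects give the equality case. *)
Lemma variational_lower n (h : Omega R d -> R) (M e : R) : (0 < n)%N ->
  measurable_fun setT h -> (forall w, `|h w| <= M)%R ->
  (forall w, h (restrict_config (cube n) w) = h w) -> (0 < e)%R ->
  \int[pi]_w ((expR (h w))%:E * expeR (- H (restrict_config (cube n) w))) <= e%:E ->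
  \int[P]_w (h w)%:E <= entropy P n + energy P n + (ln e)%:E.
Proof.
move=> n0 mh hM hn e0 he.
have I0 := local_entropy_ge0 P pi (cube n).
have [Ey|Eoo] := eqVneq (energy P n) +oo.
  rewrite Ey addey ?addye ?leey//.
  by rewrite -ltNye (lt_le_trans _ I0)// ltNy0.
have Hi := energy_integrable n0; rewrite ltey in Hi; move: Hi => /(_ Eoo) Hi.
have hi : P.-integrable setT (fun w => (h w)%:E) by exact: bounded_integrable hM.
pose f w := (h w)%:E - H (restrict_config (cube n) w).
have mf : measurable_fun setT (f : Omega R d -> _).
  apply: emeasurable_funB; first exact/measurable_EFinP.
  exact: measurable_energy.
have fE w : f (restrict_config (cube n) w) = f w by rewrite /f hn restrict_config_sub.
have := @local_donsker_varadhan R d P pi (cube n) f e mf.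
under eq_integral do rewrite fE.
under [X in _ -> _ -> _ -> X <= _]eq_integral do rewrite fE.
rewrite (_ : (fun w => f (restrict_config (cube n) w)) = f); last by apply/funext.
have fi : P.-integrable setT f by exact: integrableB.
move=> /(_ fi e0); rewrite /f integralB//.
have Ef := integrable_fin_num measurableT Hi.
move=> h2; rewrite addeAC -leeBlDr// ?Ef//; apply: h2.
apply: le_trans he; apply: ge0_le_integral => //.
- by move=> w _; exact: expeR_ge0.
- exact: (measurableT_comp measurable_expeR).
- apply: emeasurable_funM; last exact: measurable_expe_energy.
  by apply/measurable_EFinP; exact: measurableT_comp.
- by move=> w _; rewrite expeRD.
Qed.

End energy_of_process.

Lemma lteNy_add (T : realDomainType) (a b : \bar T) : -oo < a -> -oo < b -> -oo < a + b.
Proof. by case: a => [a| |]//; case: b => [b| |]// _ _; rewrite -?EFinD ltNyr. Qed.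

Section variational_inequality.
Variable P : probability (Omega R d) R.
Hypothesis P_proc : stationary_process P.
Hypothesis P_energy : cvgn (energy_density H P).

Lemma mean_energy_gtNy : -oo < mean_energy H P.
Proof.
pose c0 := fine (\int[P]_w ((npoints (box 0 1 : set 'rV[R]_d) w)%:R)%:E).
apply: (@lt_le_trans _ _ (- (A * c0))%:E); first exact: ltNyr.
apply: lime_ge => //; near=> n.
have n0 : (0 < n)%N by near: n; exact: nbhs_infty_gt.
rewrite /energy_density lebesgue_rV_cube inver gt_eqF ?vol_gt0//.
rewrite lee_pdivlMr ?vol_gt0//; apply: le_trans (energy_ge P_proc n0).
by rewrite -EFinM lee_fin le_eqVlt; apply/orP; left; apply/eqP; rewrite /c0; ring.
Unshelve. all: by end_near. Qed.

Lemma specific_entropy_ge0 : 0 <= specific_entropy pi P.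
Proof.
apply: lime_ge; first by apply/cvg_ex; eexists; exact: cvg_specific_entropy (proj1 P_proc).
near=> n; have n0 : (0 < n)%N by near: n; exact: nbhs_infty_gt.
by rewrite lebesgue_rV_cube inver gt_eqF ?vol_gt0// mule_ge0 ?local_entropy_ge0.
Unshelve. all: by end_near. Qed.

Lemma pressure_gtNy : -oo < pressure pi H.
Proof.
have pc := pressure_cvg; rewrite -(cvg_lim _ pc)//.
apply: (@lt_le_trans _ _ (- 1)); first exact: ltNyr.
apply: lime_ge; first by apply/cvg_ex; eexists; exact: pc.
near=> n; have n0 : (0 < n)%N by near: n; exact: nbhs_infty_gt.
rewrite lee_fin ler_pdivlMr ?vol_gt0// mulN1r.
rewrite -(expRK (- vol n)%R) ler_ln ?posrE ?expR_gt0 ?zfree_gt0//.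
exact: zfree_ge.
Unshelve. all: by end_near. Qed.

(** Non-negative entropy, stability and the void bound on [zfree] keep all three limits away from
    -oo, so their sum is well defined and is the limit of the sum. *)
Lemma cvg_free_energy :
  ((entropy P n + energy P n + (ln (zfree n))%:E) / lebesgue_rV (@cube R d n)) @[n --> \oo]
  --> specific_entropy pi P + mean_energy H P + pressure pi H.
Proof.
have S0 := specific_entropy_ge0; have Hy := mean_energy_gtNy.
have py := pressure_gtNy.
have SNy : -oo < specific_entropy pi P by rewrite (lt_le_trans _ S0)// ltNy0.
have h1 := cvg_specific_entropy (proj1 P_proc).
have h2 : (energy P n / lebesgue_rV (@cube R d n)) @[n --> \oo] --> mean_energy H P.
  exact: P_energy.
have h3 := pressure_cvg.
have d1 : specific_entropy pi P +? mean_energy H P by apply: ltninfty_adde_def; rewrite inE.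
have d2 : specific_entropy pi P + mean_energy H P +? pressure pi H.
  by apply: ltninfty_adde_def; rewrite inE// lteNy_add.
apply: cvg_trans (cvgeD d2 (cvgeD d1 h1 h2) h3); apply: near_eq_cvg; near=> n.
have n0 : (0 < n)%N by near: n; exact: nbhs_infty_gt.
rewrite lebesgue_rV_cube inver gt_eqF ?vol_gt0//.
have I0 := local_entropy_ge0 P pi (cube n).
have EN : -oo < energy P n by rewrite (lt_le_trans _ (energy_ge P_proc n0))// ltNyr.
move: I0 EN; move: (entropy P n) (energy P n) => a b a0 bNy.
have aNy : -oo < a by rewrite (lt_le_trans _ a0).
rewrite EFinM !muleDl//; apply: ltninfty_adde_def; rewrite inE//.
- exact: lteNy_add.
- exact: ltNyr.
Unshelve. all: by end_near. Qed.

Lemma variational_inequality :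
  - pressure pi H <= specific_entropy pi P + mean_energy H P.
Proof.
have h := cvg_free_energy.
have : 0 <= specific_entropy pi P + mean_energy H P + pressure pi H.
  rewrite -(cvg_lim _ h)//; apply: lime_ge; first by apply/cvg_ex; eexists; exact: h.
  near=> n; have n0 : (0 < n)%N by near: n; exact: nbhs_infty_gt.
  rewrite lebesgue_rV_cube inver gt_eqF ?vol_gt0// mule_ge0//.
  have := @variational_lower P P_proc n (cst 0%R) 0%R (zfree n) n0.
  rewrite integral0; apply => //.
  - by move=> w; rewrite normr0.
  - exact: zfree_gt0.
  - by rewrite zfreeE /free_partition; under eq_integral do rewrite expR0 mul1e.
have py := pressure_gtNy.
have : -oo < specific_entropy pi P + mean_energy H P.
  by rewrite lteNy_add ?mean_energy_gtNy// (lt_le_trans _ specific_entropy_ge0).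
case: (pressure pi H) py => [p| |]// _; case: (_ + mean_energy H P) => [x| |]//= _.
- by rewrite -EFinD !lee_fin => ?; lra.
- by move=> _; exact: leey.
Unshelve. all: by end_near. Qed.

End variational_inequality.

(** * Gibbs kernels *)

Section glueing.
Implicit Types (B W : set 'rV[R]_d).

(** The outer configuration comes first; as a function of [w'] alone, this resamples the inside of
    [L] under a fixed boundary condition. *)
Definition glue L w w' : Omega R d :=
  union_config (restrict_config L w') (restrict_config (~` L) w).

Lemma restrict_glue_out L B w w' : B `&` L = set0 ->
  restrict_config B (glue L w w') = restrict_config B w.
Proof.
move=> BL; apply: config_ext; apply/seteqP; split=> x /=.
  by move=> [[[_ Lx]|[wx _]] Bx]//; have : (B `&` L) x by []; rewrite BL.
move=> [wx Bx]; split=> //; right; split=> // Lx.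
by have : (B `&` L) x by []; rewrite BL.
Qed.

Lemma restrict_glue L W w w' : L `<=` W ->
  restrict_config W (glue L w w') = glue L (restrict_config W w) w'.
Proof.
move=> LW; apply: config_ext; apply/seteqP; split=> x /=.
  by move=> [[[wx Lx]|[wx Lx]] Wx]; [left|right].
by move=> [[wx Lx]|[[wx Wx] Lx]]; split=> //; [left|exact: LW|right].
Qed.

Lemma glue_out L w w1 w' : restrict_config (~` L) w = restrict_config (~` L) w1 ->
  glue L w w' = glue L w1 w'.
Proof. by move=> ww; rewrite /glue ww. Qed.

Lemma glue_restrict_in L B w w' : L `<=` B ->
  glue L w (restrict_config B w') = glue L w w'.
Proof. by move=> LB; rewrite /glue restrict_config_sub. Qed.

Lemma npoints_glue_le L L' w w' :
  (npoints L' (glue L w w') <= npoints L w' + npoints L' w)%N.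
Proof.
rewrite npoints_union_config; last 2 first.
- exact: window_bounded.
- by apply/seteqP; split=> // x /= [[[_ ?] [_ ?]] _].
rewrite !npoints_restrict leq_add//; apply: le_npoints.
- exact: window_bounded.
- by move=> x [].
- exact: window_bounded.
- by move=> x [].
Qed.

Lemma measurable_glue_pair L :
  measurable_fun setT (fun z : Omega R d * Omega R d => glue L z.2 z.1).
Proof.
apply: measurable_glue; [exact: window_borel|apply: borelC; exact: window_borel|].
exact: setICr.
Qed.

Lemma measurable_glue_in L w : measurable_fun setT (glue L w).
Proof.
have h : measurable_fun setT (fun w' : Omega R d => (w', w)).
  by apply: measurable_fun_pair => //; exact: measurable_id.
exact: (measurableT_comp (measurable_glue_pair L) h).
Qed.

End glueing.

Section specification.
Local Notation psi L := (fun w => expeR (- local_energy H L w)).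
Implicit Type W : window R d.

Lemma measurable_boltzmann L : measurable_fun setT (psi L : Omega R d -> _).
Proof.
apply: (measurableT_comp measurable_expeR); apply: measurableT_comp => //.
exact: (measurable_local_energy H_meas r_ge0 H_range rr0).
Qed.

Let psi_ge0 L w : 0 <= psi L w. Proof. exact: expeR_ge0. Qed.

Let mpsi_in L w : measurable_fun setT (fun w' => psi L (glue L w w')).
Proof. exact: (measurableT_comp (measurable_boltzmann L) (measurable_glue_in L w)). Qed.

Definition local_partition L w : \bar R := \int[pi]_w' psi L (glue L w w').

Lemma measurable_local_partition L : measurable_fun setT (local_partition L).
Proof.
apply: (@measurable_fun_fubini_tonelli_G _ _ _ _ _ pi
  (fun z => psi L (glue L z.2 z.1))) => //.
exact: (measurableT_comp (measurable_boltzmann L) (measurable_glue_pair L)).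
Qed.

Lemma expe_energy_glue L W w w' : minkowski_sum L (euclidean_ball r) `<=` W ->
  expeR (- H (restrict_config W (glue L w w'))) =
  psi L (glue L w w') * expeR (- H (restrict_config (W `\` L) w)).
Proof.
move=> LW; rewrite (expe_energy_in H_gtNy H_hereditary L).
rewrite -(local_energyE r_ge0 H_range _ LW) restrict_glue_out//.
by apply/seteqP; split=> // x [[]].
Qed.

Lemma local_energy_restrict L W w : minkowski_sum L (euclidean_ball r) `<=` W ->
  local_energy H L (restrict_config W w) = local_energy H L w.
Proof.
move=> LW; rewrite !(local_energyE r_ge0 H_range _ LW) /energy_in.
by rewrite !restrict_config_sub// => x [].
Qed.

Let void_glue L w w' : npoints L w' = 0%N -> glue L w w' `&` L = set0.
Proof.
move=> /(npoints_eq0 (window_bounded L)) w0.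
apply/seteqP; split=> // x /= [[[wx Lx]|[]]//].
by have : (w' `&` L) x by []; rewrite w0.
Qed.

(** An empty interior has zero local energy under every boundary condition, including those of
    infinite energy. *)
Lemma local_partition_ge L w :
  (expR (- fine (lebesgue_rV L)))%:E <= local_partition L w.
Proof.
rewrite -[X in X%:E](mul1r).
apply: le_void_integral => // w' w0.
by rewrite (local_energy_notin H_gtNy r_ge0 H_range rr0) ?void_glue//= oppr0 expR0.
Qed.

Lemma local_partition_gt0 L w : 0 < local_partition L w.
Proof. by apply: lt_le_trans (local_partition_ge L w); rewrite lte_fin expR_gt0. Qed.

Lemma local_partition_lty L w : local_partition L w < +oo.
Proof.
have [n _ LW] := exists_range_window rr0 L.
set W := cube _ in LW.
(* When the outside already has infinite energy, +oo - +oo = 0 makes every local energy 0 and the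
   integrand constantly 1. *)
have [hy|hy] := eqVneq (H (restrict_config (W `\` L) w)) +oo.
  rewrite /local_partition (_ : (fun w' => _) = cst 1).
    by rewrite integral_prob_cst ltry.
  apply/funext => w'; rewrite (local_energyE r_ge0 H_range _ LW) /energy_in.
  have out : restrict_config (W `\` L) (glue L w w') = restrict_config (W `\` L) w.
    by rewrite restrict_glue_out//; apply/seteqP; split=> // x [[]].
  rewrite out hy /energy_diff (energy_restrict_eqy H_hereditary (A := W `\` L)) ?out//.
  by rewrite eqxx oppe0 expeR0.
have hNy := energy_gtNy H_gtNy (windowD W L) w.
have [h hE] : exists h : R, H (restrict_config (W `\` L) w) = h%:E.
  rewrite /= in hNy; move: hy hNy; case: (H _) => // h; by exists h.
(* Stability bounds the total energy by the points of [w'] in [L] and of [w] in [W]; [h] is the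
   finite energy outside [L], subtracted in the local energy. *)
apply: (@le_lt_trans _ _ (\int[pi]_w' ((expR (h + A * (npoints W w)%:R))%:E *
    (expR (A * (npoints L w')%:R))%:E))).
  apply: ge0_le_integral => //.
  - apply/measurable_EFinP; apply: measurable_funM => //.
    apply: measurableT_comp => //; apply: measurable_funM => //.
    exact: measurable_npointsR.
  move=> w' _; have := expe_energy_glue w w' LW.
  rewrite hE => /(congr1 (fun x => x * (expR h)%:E)).
  rewrite -muleA -EFinM -expRD addNr expR0 mule1 => <-.
  apply: (@le_trans _ _ ((expR (A * (npoints W (glue L w w'))%:R))%:E * (expR h)%:E)).
    by rewrite lee_wpmul2r ?lee_fin ?expR_ge0//; exact: expe_energy_le.
  rewrite -!EFinM -!expRD lee_fin ler_expR.
  have := npoints_glue_le L W w w'; rewrite -(ler_nat R) natrD => /(ler_wpM2l (ltW A_gt0)).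
  lra.
rewrite ge0_integralZl_EFin ?expR_ge0//.
  by rewrite lte_mul_pinfty// ?lee_fin ?expR_ge0// poisson_exp_moment_window// ltW.
apply/measurable_EFinP; apply: measurableT_comp => //; apply: measurable_funM => //.
exact: measurable_npointsR.
Qed.

Definition lpart L w : R := fine (local_partition L w).

Lemma lpartE L w : (lpart L w)%:E = local_partition L w.
Proof. by rewrite fineK// ge0_fin_numE ?local_partition_lty// ltW// local_partition_gt0. Qed.

Lemma lpart_gt0 L w : (0 < lpart L w)%R.
Proof. by rewrite -lte_fin lpartE local_partition_gt0. Qed.

Lemma measurable_lpart L : measurable_fun setT (lpart L).
Proof. exact: measurableT_comp (measurable_local_partition L). Qed.

Lemma partition_functionE L w :
  partition_function pi H L (restrict_config (~` L) w) = (lpart L w)%:E.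
Proof.
rewrite lpartE /partition_function ge0_integral_restricted//.
- by apply: eq_integral => w' _; rewrite -/(glue _ _ _) glue_restrict_in// .
- exact: mpsi_in.
Qed.

Lemma gibbs_densityE L w : gibbs_density pi H L w = (lpart L w)^-1%:E * psi L w.
Proof. by rewrite /gibbs_density partition_functionE inver gt_eqF// lpart_gt0. Qed.

Lemma lpart_out L w w1 : restrict_config (~` L) w = restrict_config (~` L) w1 ->
  lpart L w = lpart L w1.
Proof.
move=> ww; rewrite /lpart /local_partition; congr fine.
by apply: eq_integral => w' _; rewrite (glue_out _ ww).
Qed.

Lemma lpart_glue L w w' : lpart L (glue L w w') = lpart L w.
Proof. by apply: lpart_out; rewrite restrict_glue_out// setICl. Qed.

Lemma measurable_gibbs_density L : measurable_fun setT (gibbs_density pi H L : Omega R d -> _).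
Proof.
rewrite (_ : gibbs_density pi H L = fun w => (lpart L w)^-1%:E * psi L w); last first.
  by apply/funext => w; exact: gibbs_densityE.
apply: emeasurable_funM; last exact: measurable_boltzmann.
apply/measurable_EFinP; apply: measurable_invr_ge0; first exact: measurable_lpart.
by move=> w; exact/ltW/lpart_gt0.
Qed.

Lemma gibbs_density_ge0 L w : 0 <= gibbs_density pi H L w.
Proof. by rewrite gibbs_densityE mule_ge0// lee_fin invr_ge0 ltW// lpart_gt0. Qed.

(** Integration is against [pi] itself: [glue] only reads the part of [w'] in [L]. *)
Definition gibbs_kernel L (G : Omega R d -> \bar R) w : \bar R :=
  \int[pi]_w' (G (glue L w w') * gibbs_density pi H L (glue L w w')).

Section kernel.
Variable L : window R d.
Implicit Type G : Omega R d -> \bar R.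

Let mdens w : measurable_fun setT (fun w' => gibbs_density pi H L (glue L w w')).
Proof. exact: (measurableT_comp (measurable_gibbs_density L) (measurable_glue_in L w)). Qed.

Let mG_in G w : measurable_fun setT G -> measurable_fun setT (fun w' => G (glue L w w')).
Proof. by move=> mG; exact: (measurableT_comp mG (measurable_glue_in L w)). Qed.

Let mGdens G w : measurable_fun setT G ->
  measurable_fun setT (fun w' => G (glue L w w') * gibbs_density pi H L (glue L w w')).
Proof. by move=> mG; apply: emeasurable_funM => //; exact: mG_in. Qed.

Lemma gibbs_kernel_ge0 G w : (forall w, 0 <= G w) -> 0 <= gibbs_kernel L G w.
Proof.
by move=> G0; apply: integral_ge0 => w' _; rewrite mule_ge0// gibbs_density_ge0.
Qed.

Lemma measurable_gibbs_kernel G : measurable_fun setT G -> (forall w, 0 <= G w) ->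
  measurable_fun setT (gibbs_kernel L G).
Proof.
move=> mG G0; apply: (@measurable_fun_fubini_tonelli_G _ _ _ _ _ pi
  (fun z => G (glue L z.2 z.1) * gibbs_density pi H L (glue L z.2 z.1))).
  apply: emeasurable_funM.
    exact: (measurableT_comp mG (measurable_glue_pair L)).
  exact: (measurableT_comp (measurable_gibbs_density L) (measurable_glue_pair L)).
by move=> z; rewrite mule_ge0// gibbs_density_ge0.
Qed.

Lemma lpart_gibbs_kernel G w : measurable_fun setT G -> (forall w, 0 <= G w) ->
  (lpart L w)%:E * gibbs_kernel L G w = \int[pi]_w' (G (glue L w w') * psi L (glue L w w')).
Proof.
move=> mG G0; rewrite /gibbs_kernel -ge0_integralZl_EFin//; last 3 first.
- by move=> w' _; rewrite mule_ge0// gibbs_density_ge0.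
- exact: mGdens.
- exact/ltW/lpart_gt0.
apply: eq_integral => w' _; rewrite gibbs_densityE lpart_glue.
rewrite muleCA; congr (_ * _).
by rewrite muleA -EFinM divff ?mul1e// gt_eqF// lpart_gt0.
Qed.

Lemma gibbs_kernel_cst (c : \bar R) w : 0 <= c -> gibbs_kernel L (cst c) w = c.
Proof.
move=> c0; rewrite /gibbs_kernel ge0_integralZl//; last first.
  by move=> w' _; exact: gibbs_density_ge0.
rewrite [X in _ * X](_ : _ = 1) ?mule1//.
have l0 := lpart_gt0 L w.
have := @lpart_gibbs_kernel (cst 1) w (measurable_cst _) (fun=> lee01).
rewrite [X in _ = X -> _](_ : _ = local_partition L w); last first.
  by apply: eq_integral => w' _; rewrite mul1e.
rewrite /gibbs_kernel [X in _ * X = _ -> _](_ : _ =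
  \int[pi]_w' gibbs_density pi H L (glue L w w')); last first.
  by apply: eq_integral => w' _; rewrite mul1e.
rewrite -lpartE.
move: (\int[pi]_w' _) => [x| |]; rewrite -?EFinM.
- by move=> [] /(congr1 (fun y => ((lpart L w)^-1 * y)%R)); rewrite mulKf ?mulVf ?gt_eqF// => ->.
- by rewrite gt0_muley// lte_fin.
- by rewrite gt0_muleNy// lte_fin.
Qed.

Lemma le_gibbs_kernel G G' w : measurable_fun setT G -> measurable_fun setT G' ->
  (forall w, 0 <= G w) -> (forall w, G w <= G' w) ->
  gibbs_kernel L G w <= gibbs_kernel L G' w.
Proof.
move=> mG mG' G0 GG'; apply: ge0_le_integral => //.
- by move=> w' _; rewrite mule_ge0// gibbs_density_ge0.
- exact: mGdens.
- exact: mGdens.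
- by move=> w' _; rewrite lee_wpmul2r// gibbs_density_ge0.
Qed.

Lemma gibbs_kernelD G G' w : measurable_fun setT G -> measurable_fun setT G' ->
  (forall w, 0 <= G w) -> (forall w, 0 <= G' w) ->
  gibbs_kernel L (fun w => G w + G' w) w = gibbs_kernel L G w + gibbs_kernel L G' w.
Proof.
move=> mG mG' G0 G'0; rewrite /gibbs_kernel -ge0_integralD//.
- by apply: eq_integral => w' _; rewrite ge0_muleDl.
- by move=> w' _; rewrite mule_ge0// gibbs_density_ge0.
- exact: mGdens.
- by move=> w' _; rewrite mule_ge0// gibbs_density_ge0.
- exact: mGdens.
Qed.

Lemma gibbs_kernel_out G w w1 : restrict_config (~` L) w = restrict_config (~` L) w1 ->
  gibbs_kernel L G w = gibbs_kernel L G w1.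
Proof. by move=> ww; apply: eq_integral => w' _; rewrite (glue_out _ ww). Qed.

Lemma gibbs_kernel_glue G w w' : gibbs_kernel L G (glue L w w') = gibbs_kernel L G w.
Proof. by apply: gibbs_kernel_out; rewrite restrict_glue_out// setICl. Qed.

Lemma lpart_restrict W w : minkowski_sum L (euclidean_ball r) `<=` W ->
  lpart L (restrict_config W w) = lpart L w.
Proof.
move=> LW; have LW' := subset_trans (subset_minkowski r_ge0) LW.
rewrite /lpart /local_partition; congr fine.
apply: eq_integral => w' _; rewrite -restrict_glue//.
by rewrite local_energy_restrict.
Qed.

(** Finite range enters here: the kernel sends a function of the points in [W] to a function of the
    points in [W], so Gibbs averages of local functions stay local. *)
Lemma gibbs_kernel_restrict G W w : minkowski_sum L (euclidean_ball r) `<=` W ->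
  (forall w, G (restrict_config W w) = G w) ->
  gibbs_kernel L G (restrict_config W w) = gibbs_kernel L G w.
Proof.
move=> LW GW; have LW' := subset_trans (subset_minkowski r_ge0) LW.
apply: eq_integral => w' _; rewrite -restrict_glue// GW.
by rewrite !gibbs_densityE lpart_restrict// local_energy_restrict.
Qed.

Lemma gibbs_kernel_restricted_law G w : measurable_fun setT G -> (forall w, 0 <= G w) ->
  \int[restricted_law pi L]_w' (G (glue L w w') * gibbs_density pi H L (glue L w w')) =
  gibbs_kernel L G w.
Proof.
move=> mG G0; rewrite ge0_integral_restricted; last 2 first.
- exact: mGdens.
- by move=> w'; rewrite mule_ge0// gibbs_density_ge0.
by apply: eq_integral => w' _; rewrite glue_restrict_in.
Qed.

(* [W] splits into [L] and [W \ L], on which the Poisson process is independent. *)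
Lemma integral_energy_split (W : window R d) (F1 F0 : Omega R d -> \bar R) :
  minkowski_sum L (euclidean_ball r) `<=` W ->
  measurable_fun setT F1 -> (forall w, 0 <= F1 w) ->
  (forall w, F1 (restrict_config W w) = F1 w) ->
  measurable_fun setT F0 -> (forall w, 0 <= F0 w) ->
  (forall w, F0 (restrict_config (W `\` L) w) = F0 w) ->
  \int[pi]_w (F1 w * (F0 w * expeR (- H (restrict_config W w)))) =
  \int[pi]_w ((F0 w * expeR (- H (restrict_config (W `\` L) w))) *
     \int[pi]_w' (F1 (glue L w w') * psi L (glue L w w'))).
Proof.
move=> LW mF1 F10 F1W mF0 F00 F0W.
have LW' := subset_trans (subset_minkowski r_ge0) LW.
pose F w := F1 w * (F0 w * expeR (- H (restrict_config W w))).
have F0W' w : F0 (restrict_config W w) = F0 w.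
  by rewrite -F0W restrict_config_sub ?F0W// => x [].
have FE w : F (restrict_config (L `|` (W `\` L)) w) = F w.
  by rewrite setDUK// /F F1W F0W' restrict_config_sub.
transitivity (\int[pi]_w F (restrict_config (L `|` (W `\` L)) w)).
  by apply: eq_integral => w _; rewrite FE.
rewrite (poisson_split pi_poisson); last 6 first.
- exact: window_borel.
- exact: (window_borel (windowD W L)).
- by apply: bounded_setU; [exact: window_bounded|exact: (window_bounded (windowD W L))].
- by apply/seteqP; split=> // x [? []].
- apply: emeasurable_funM => //; apply: emeasurable_funM => //.
  exact: measurable_expe_energy.
- by move=> w; rewrite !mule_ge0// expeR_ge0.
apply: eq_integral => w _.
rewrite -ge0_integralZl//; last 3 first.
- apply: emeasurable_funM; first exact: mG_in.
  exact: (measurableT_comp (measurable_boltzmann L) (measurable_glue_in L w)).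
- by move=> w' _; rewrite mule_ge0// expeR_ge0.
- by rewrite mule_ge0// expeR_ge0.
apply: eq_integral => w' _.
rewrite (_ : union_config _ _ = restrict_config (L `|` (W `\` L)) (glue L w w')); last first.
  rewrite setDUK// restrict_glue// /glue; congr union_config.
  by rewrite restrict_config_restrict setDE.
rewrite FE /F (expe_energy_glue _ _ LW).
rewrite -[F0 (glue _ _ _)]F0W restrict_glue_out; last first.
  by apply/seteqP; split=> // x [[]].
by rewrite F0W [RHS]muleC -[RHS]muleA; congr (_ * _); rewrite muleCA.
Qed.

End kernel.

(** * Equality implies the Gibbs property *)

(** From (1 - x) exp(x) <= 1 <= (1 - x)(1 + x + 2x^2) = 1 + x^2 (1 - 2x); the last step is where x
    <= 1/2 is required. *)
Lemma expR_le_quadratic (x : R) : (x <= 2^-1)%R -> (expR x <= 1 + x + 2 * x ^+ 2)%R.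
Proof.
move=> x2; have x1 : (0 < 1 - x)%R by lra.
have h := expR_ge1Dx (- x).
have e0 := expR_gt0 x.
have e1 : (expR x * expR (- x) = 1)%R by rewrite -expRD subrr expR0.
rewrite -(ler_pM2r x1); apply: (@le_trans _ _ 1%R).
  by rewrite -[leRHS]e1 ler_pM2l.
have : (0 <= x ^+ 2 * (1 - 2 * x))%R by apply: mulr_ge0; [exact: sqr_ge0|lra].
by rewrite (_ : (1 + x + 2 * x ^+ 2) * (1 - x) = 1 + x ^+ 2 * (1 - 2 * x))%R; [lra|ring].
Qed.

(** * Exponential tilting by the Gibbs defect of a local function *)

Section tilting.
Variables (L : window R d) (N : nat) (G : Omega R d -> R) (t : R).
Hypothesis LN : minkowski_sum L (euclidean_ball r) `<=` @cube R d N.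
Hypothesis mG : measurable_fun setT G.
Hypothesis G01 : forall w, (0 <= G w <= 1)%R.
Hypothesis GN : forall w, G (restrict_config (cube N) w) = G w.
Hypothesis t01 : (0 < t <= 2^-1)%R.

Let g w := gibbs_kernel L (fun w => (G w)%:E) w.

Let G0 w : 0 <= (G w)%:E. Proof. by have /andP[] := G01 w; rewrite lee_fin. Qed.

Let mGE : measurable_fun setT (fun w => (G w)%:E).
Proof. exact/measurable_EFinP. Qed.

Definition gibbs_average w : R := fine (g w).
Local Notation phi := gibbs_average.

Lemma gibbs_averageE w : (phi w)%:E = gibbs_kernel L (fun w => (G w)%:E) w.
Proof.
rewrite fineK// ge0_fin_numE ?gibbs_kernel_ge0//.
apply: (@le_lt_trans _ _ (gibbs_kernel L (cst 1) w)); last first.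
  by rewrite gibbs_kernel_cst// ltry.
by apply: le_gibbs_kernel => // w'; have /andP[_] := G01 w'; rewrite lee_fin.
Qed.

Lemma gibbs_average_itv w : (0 <= phi w <= 1)%R.
Proof.
rewrite -!lee_fin gibbs_averageE gibbs_kernel_ge0//=.
rewrite -[leRHS](gibbs_kernel_cst L w (lee01)).
by apply: le_gibbs_kernel => // w'; have /andP[_] := G01 w'; rewrite lee_fin.
Qed.

Definition gibbs_defect w : R := (G w - phi w)%R.
Local Notation K := gibbs_defect.

Lemma measurable_gibbs_average : measurable_fun setT phi.
Proof. by apply: measurableT_comp => //; exact: measurable_gibbs_kernel. Qed.

Lemma measurable_gibbs_defect : measurable_fun setT K.
Proof. exact: measurable_funB measurable_gibbs_average. Qed.

Lemma gibbs_defect_le1 w : (`|K w| <= 1)%R.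
Proof.
have := G01 w; have := gibbs_average_itv w.
by rewrite ler_norml /gibbs_defect => /andP[? ?] /andP[? ?]; apply/andP; split; lra.
Qed.

(** Locality of the defect lets its copies be placed in disjoint blocks. *)
Lemma gibbs_defect_restrict (W : window R d) w : cube N `<=` W ->
  K (restrict_config W w) = K w.
Proof.
move=> NW; have GW w' : G (restrict_config W w') = G w'.
  by rewrite -[RHS]GN -[LHS]GN restrict_config_sub.
have LW : minkowski_sum L (euclidean_ball r) `<=` W by move=> x /LN /NW.
rewrite /gibbs_defect (GW w) /gibbs_average /g.
by rewrite (gibbs_kernel_restrict w LW) => // w'; rewrite (GW w').
Qed.

Let e w := (expR (t * K w))%:E.

Let me : measurable_fun setT e.
Proof.
apply/measurable_EFinP; apply: measurableT_comp => //.
by apply: measurable_funM => //; exact: measurable_gibbs_defect.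
Qed.

Let e0 w : 0 <= e w. Proof. by rewrite lee_fin expR_ge0. Qed.

Lemma local_tilt w :
  \int[pi]_w' (e (glue L w w') * psi L (glue L w w')) <=
  (1 + 2 * t ^+ 2)%:E * (lpart L w)%:E.
Proof.
have /andP[tgt0 t2] := t01; have t0 := ltW tgt0.
have m1 (F : Omega R d -> \bar R) : measurable_fun setT F ->
    measurable_fun setT (fun w' => F (glue L w w') * psi L (glue L w w')).
  move=> mF; apply: emeasurable_funM; last exact: mpsi_in.
  exact: (measurableT_comp mF (measurable_glue_in L w)).
(* The term t [phi] is added to both sides, so that the quadratic bound on exp(tK) becomes an
   inequality between non-negative integrands; it cancels at the end, because G and [phi] have the
   same integral against the Boltzmann weight. *)
have h1 : \int[pi]_w' ((e (glue L w w') + (t * phi w)%:E) * psi L (glue L w w')) <=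
    \int[pi]_w' (((1 + 2 * t ^+ 2)%:E + (t * G (glue L w w'))%:E) * psi L (glue L w w')).
  apply: ge0_le_integral => //.
  - move=> w' _; rewrite mule_ge0// adde_ge0// lee_fin mulr_ge0//.
    by have /andP[] := gibbs_average_itv w.
  - by apply: (m1 (fun w' => e w' + (t * phi w)%:E)); exact: emeasurable_funD.
  - apply: (m1 (fun w' => (1 + 2 * t ^+ 2)%:E + (t * G w')%:E)).
    by apply: emeasurable_funD => //; apply/measurable_EFinP; exact: measurable_funM.
  move=> w' _; rewrite lee_wpmul2r//.
  (* The average ignores the points in [L], so it is constant under resampling. *)
  have -> : phi w = phi (glue L w w') by rewrite /gibbs_average /g gibbs_kernel_glue.
  rewrite -!EFinD lee_fin.
  have K1 := gibbs_defect_le1 (glue L w w').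
  set x := (t * K (glue L w w'))%R.
  have xt : (`|x| <= t)%R by rewrite normrM (ger0_norm t0) ler_piMr.
  have x2 : (x <= 2^-1)%R by rewrite (le_trans (ler_norm _))// (le_trans xt)//; lra.
  have := expR_le_quadratic x2.
  have : (x ^+ 2 <= t ^+ 2)%R by rewrite -(real_normK (num_real x)) lerXn2r// nnegrE.
  have : x = (t * G (glue L w w') - t * phi (glue L w w'))%R by rewrite -mulrBr.
  by rewrite -/x; lra.
have intZ (c : R) (F : Omega R d -> \bar R) : (0 <= c)%R -> measurable_fun setT F ->
    (forall w', 0 <= F w') -> \int[pi]_w' (c%:E * F (glue L w w') * psi L (glue L w w')) =
    c%:E * \int[pi]_w' (F (glue L w w') * psi L (glue L w w')).
  move=> c0 mF F0; rewrite -ge0_integralZl_EFin//.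
  - by apply: eq_integral => w' _; rewrite muleA.
  - by move=> w' _; rewrite mule_ge0.
  - exact: m1.
have intc (c : R) : (0 <= c)%R ->
    \int[pi]_w' (c%:E * psi L (glue L w w')) = c%:E * (lpart L w)%:E.
  by move=> c0; rewrite lpartE ge0_integralZl_EFin.
have tp0 : (0 <= t * phi w)%R by rewrite mulr_ge0//; case/andP: (gibbs_average_itv w).
have lhsE : \int[pi]_w' ((e (glue L w w') + (t * phi w)%:E) * psi L (glue L w w')) =
    \int[pi]_w' (e (glue L w w') * psi L (glue L w w')) + (t * phi w)%:E * (lpart L w)%:E.
  rewrite -intc// -ge0_integralD//; last 4 first.
  - by move=> w' _; rewrite mule_ge0.
  - exact: m1.
  - by move=> w' _; rewrite mule_ge0.
  - by apply: emeasurable_funM => //; exact: mpsi_in.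
  by apply: eq_integral => w' _; rewrite ge0_muleDl// lee_fin.
have rhsE : \int[pi]_w' (((1 + 2 * t ^+ 2)%:E + (t * G (glue L w w'))%:E) *
      psi L (glue L w w')) =
    (1 + 2 * t ^+ 2)%:E * (lpart L w)%:E + (t * phi w)%:E * (lpart L w)%:E.
  have c0 : (0 <= 1 + 2 * t ^+ 2)%R by rewrite addr_ge0// mulr_ge0// sqr_ge0.
  rewrite EFinM -muleA [_%:E * (lpart L w)%:E in X in _ + X]muleC gibbs_averageE.
  rewrite lpart_gibbs_kernel// -(intZ t (fun w' => (G w')%:E))// -intc// -ge0_integralD//; last 4 first.
  - by move=> w' _; rewrite mule_ge0.
  - by apply: emeasurable_funM => //; exact: mpsi_in.
  - by move=> w' _; rewrite !mule_ge0.
  - by apply: (m1 (fun w' => t%:E * (G w')%:E)); exact: emeasurable_funM.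
  apply: eq_integral => w' _; rewrite EFinM ge0_muleDl// ?lee_fin//.
  by rewrite mulr_ge0//; case/andP: (G01 (glue L w w')).
rewrite lhsE rhsE in h1.
by rewrite leeD2rE in h1.
Qed.

(** As [F0] does not see [L], the integral over the inside of [L] can be done first, where
    [local_tilt] applies to the single factor [e]. *)
Lemma tilt_step (W : window R d) (F0 : Omega R d -> \bar R) : cube N `<=` W ->
  measurable_fun setT F0 -> (forall w, 0 <= F0 w) ->
  (forall w, F0 (restrict_config (W `\` L) w) = F0 w) ->
  \int[pi]_w (e w * (F0 w * expeR (- H (restrict_config W w)))) <=
  (1 + 2 * t ^+ 2)%:E * \int[pi]_w (F0 w * expeR (- H (restrict_config W w))).
Proof.
move=> NW mF0 F00 F0W; have LW := subset_trans LN NW.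
have c0 : (0 <= 1 + 2 * t ^+ 2)%R by rewrite addr_ge0// mulr_ge0// sqr_ge0.
rewrite (integral_energy_split LW me e0 _ mF0 F00 F0W); last first.
  by move=> w; rewrite /e gibbs_defect_restrict.
have -> : \int[pi]_w (F0 w * expeR (- H (restrict_config W w))) =
    \int[pi]_w (F0 w * expeR (- H (restrict_config (W `\` L) w)) * (lpart L w)%:E).
  transitivity (\int[pi]_w (cst 1 w * (F0 w * expeR (- H (restrict_config W w))))).
    by apply: eq_integral => w _; rewrite mul1e.
  rewrite (integral_energy_split LW _ _ _ mF0 F00 F0W)//.
  apply: eq_integral => w _; congr (_ * _); rewrite lpartE.
  by apply: eq_integral => w' _; rewrite mul1e.
have mE : measurable_fun setT (fun w => F0 w * expeR (- H (restrict_config (W `\` L) w))).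
  by apply: emeasurable_funM => //; exact: (measurable_expe_energy (windowD W L)).
have E0 w : 0 <= F0 w * expeR (- H (restrict_config (W `\` L) w)).
  by rewrite mule_ge0// expeR_ge0.
have ml : measurable_fun setT (fun w => (lpart L w)%:E).
  by apply/measurable_EFinP; exact: measurable_lpart.
have l0 w : 0 <= (lpart L w)%:E by rewrite lee_fin ltW// lpart_gt0.
rewrite -ge0_integralZl_EFin//; last 2 first.
- by move=> w _; rewrite mule_ge0.
- exact: emeasurable_funM.
apply: ge0_le_integral => //.
- move=> w _; rewrite mule_ge0//; apply: integral_ge0 => w' _.
  by rewrite mule_ge0.
- apply: emeasurable_funM => //.
  apply: (@measurable_fun_fubini_tonelli_G _ _ _ _ _ pi
    (fun z => e (glue L z.2 z.1) * psi L (glue L z.2 z.1))).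
    apply: emeasurable_funM.
      exact: (measurableT_comp me (measurable_glue_pair L)).
    exact: (measurableT_comp (measurable_boltzmann L) (measurable_glue_pair L)).
  by move=> z; rewrite mule_ge0.
- by apply: emeasurable_funM => //; exact: emeasurable_funM.
- by move=> w _; rewrite muleCA lee_wpmul2l//; exact: local_tilt.
Qed.

Section block_tilt.
Variables (n m : nat).
Let s := (2 * N + 1)%N.
Hypothesis ms : (m * s <= 2 * n)%N.
Local Notation J := {ffun 'I_d -> 'I_m}.

Let Ns : (2 * N < s)%N. Proof. by rewrite /s addn1. Qed.

Let me_recenter (j : J) : measurable_fun setT (fun w => e (recenter n N s j w)).
Proof. exact: (measurableT_comp me (measurable_recenter n N s j)). Qed.

(** Induction on the blocks, one [tilt_step] for each. Translating by the centre of the current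
    block brings its defect back to the origin and moves the large cube to [W]. *)
Lemma block_tilt (q : seq J) : uniq q ->
  \int[pi]_w ((\prod_(j <- q) e (recenter n N s j w)) *
    expeR (- H (restrict_config (cube n) w))) <=
  ((1 + 2 * t ^+ 2) ^+ size q * zfree n)%:E.
Proof.
have c0 : (0 <= 1 + 2 * t ^+ 2)%R by rewrite addr_ge0// mulr_ge0// sqr_ge0.
elim: q => [_|j q IHq /= /andP[jq uq]].
  rewrite expr0 mul1r zfreeE /free_partition le_eqVlt; apply/orP; left; apply/eqP.
  by apply: eq_integral => w _; rewrite big_nil mul1e.
pose u : 'rV[R]_d := block_center n N s j.
pose F0 w := \prod_(i <- q) e (recenter n N s i w).
have mF0 : measurable_fun setT F0 by apply: measurable_prode => i; exact: me_recenter.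
have F00 w : 0 <= F0 w by apply: prode_ge0 => i; exact: e0.
have mH := measurable_expe_energy (cube n).
pose W := shift_window u (cube n : window R d).
have sub := @block_sub_cube R d n N s m.
have NW : @cube R d N `<=` W.
  move=> x Nx; apply: (sub j ms (ltnW Ns)); rewrite /= /block_center.
  by rewrite -/(block_center n N s j) -/u addKr.
have HT w : H (restrict_config (cube n) (translate u w)) = H (restrict_config W w).
  rewrite restrict_translate H_stationary//.
  by apply: finite_restrict; exact: (window_bounded W).
(* The translate of [L] lies in block [j], which is disjoint from the blocks on which the remaining
   factors depend. *)
have F0T w : F0 (translate u (restrict_config (W `\` L) w)) = F0 (translate u w).
  apply: eq_big_seq => i iq; congr e.
  rewrite -[LHS]recenter_block -[RHS]recenter_block; congr (recenter _ _ _ _ _).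
  rewrite !restrict_translate restrict_config_sub// => x /= bx; split.
    exact: (sub i ms (ltnW Ns)).
  move=> Lx.
  have ij : j != i by apply: contraNneq jq => ->.
  have := @block_disjoint R d n N s m 0 j i ij; rewrite addn0 addn0 => /(_ Ns).
  move=> /(congr1 (fun S : set _ => S (u + x)%R)) /= E0.
  suff : False by []; rewrite -E0; split=> //.
  by rewrite addKr; apply: LN; exact: (subset_minkowski r_ge0).
have eT w : e (recenter n N s j (translate u w)) = e w.
  rewrite /recenter -/u translateD addNr translate0.
  by rewrite /e gibbs_defect_restrict.
have mT u' : measurable_fun setT (translate u' : Omega R d -> Omega R d).
  exact: measurable_translate.
have st := poisson_stationary pi_poisson.
rewrite (_ : \int[pi]_w _ = \int[pi]_w (e w * (F0 (translate u w) *
    expeR (- H (restrict_config W w))))); last first.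
  rewrite -(stationary_integral u st)//; last 2 first.
  - by apply: emeasurable_funM => //; apply: measurable_prode => i; exact: me_recenter.
  - by move=> w; rewrite mule_ge0 ?expeR_ge0//; apply: prode_ge0 => i; exact: e0.
  by apply: eq_integral => w _; rewrite big_cons eT HT -/(F0 _) muleA.
apply: le_trans (tilt_step NW _ _ _) _.
- exact: (measurableT_comp mF0 (mT u)).
- by move=> w; exact: F00.
- exact: F0T.
rewrite [((1 + _) ^+ _.+1)%R]exprS -mulrA EFinM lee_wpmul2l ?lee_fin//.
apply: le_trans (IHq uq); rewrite -[leRHS](stationary_integral u st)//; last 2 first.
- exact: emeasurable_funM.
- by move=> w; apply: mule_ge0; [exact: F00|exact: expeR_ge0].
by under [leRHS]eq_integral do rewrite HT.
Qed.

(** [variational_lower] with the sum of tK over all blocks; each block costs at most ln(1 + 2t^2) by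
    [block_tilt]. *)
Lemma block_average_le (P : probability (Omega R d) R) : (0 < n)%N ->
  stationary_process P ->
  ((m ^ d)%:R)%:E * \int[P]_w (t * K w - ln (1 + 2 * t ^+ 2))%:E <=
  entropy P n + energy P n + (ln (zfree n))%:E.
Proof.
move=> n0 P_proc; have c0 : (0 < 1 + 2 * t ^+ 2)%R by rewrite ltr_wpDr// mulr_ge0// sqr_ge0.
have /andP[tgt0 t2] := t01; have t0 := ltW tgt0.
have mtK : measurable_fun setT (fun w => t * K w)%R.
  by apply: measurable_funM => //; exact: measurable_gibbs_defect.
have tK1 w : (`|t * K w| <= 1)%R.
  rewrite normrM (ger0_norm t0) mulr_ile1//; first lra.
  exact: gibbs_defect_le1.
pose h w := (\sum_(j : J) t * K (recenter n N s j w))%R.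
have mh : measurable_fun setT h := measurable_sum_blocks n N s m mtK.
have hn w : h (restrict_config (cube n) w) = h w.
  by apply: eq_bigr => j _; rewrite recenter_cube// ltnW.
have hM w := @le_sum_blocks n N s m _ _ w tK1.
have z0 := zfree_gt0 n.
have cz0 : (0 < (1 + 2 * t ^+ 2) ^+ (m ^ d) * zfree n)%R by rewrite mulr_gt0// exprn_gt0.
have := @variational_lower P P_proc n h _ _ n0 mh hM hn cz0.
rewrite (integral_blocks _ _ _ _ (proj1 P_proc) mtK tK1).
have -> : \int[P]_w (t * K (restrict_config (cube N) w))%:E = \int[P]_w (t * K w)%:E.
  by apply: eq_integral => w _; rewrite gibbs_defect_restrict.
have Ki : P.-integrable setT (fun w => (t * K w)%:E) by exact: bounded_integrable tK1.
under [X in _ -> _ * X <= _]eq_integral do rewrite EFinB.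
rewrite integralB//; last exact: finite_measure_integrable_cst.
rewrite integral_prob_cst.
have := integrable_fin_num measurableT Ki.
case: (\int[P]_w _) => // x _; rewrite -EFinB -!EFinM.
rewrite lnM ?posrE// ?exprn_gt0// lnXn// => h1.
have {h1} : (((m ^ d)%:R * x)%:E) <= entropy P n + energy P n +
    (ln (1 + 2 * t ^+ 2) *+ m ^ d + ln (zfree n))%:E.
  apply: h1; have := block_tilt (enum_uniq {: J}); rewrite -cardE card_ffun !card_ord.
  apply: le_trans; rewrite le_eqVlt; apply/orP; left; apply/eqP.
  by apply: eq_integral => w _; rewrite expeR_sum big_enum.
rewrite [(_ + ln (zfree n))%R]addrC EFinD addeA -leeBlDr//.
apply: le_trans; rewrite -EFinB lee_fin.
by rewrite mulrBr [(_ * ln _)%R]mulr_natl.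
Qed.

End block_tilt.

(** Per unit volume, [block_average_le] tends to y / s^d <= 0, where y = t E_P(K) - ln(1 + 2t^2).
    The number of blocks per unit volume does not vanish, so y itself is at most 0. *)
Lemma integral_gibbs_defect_le (P : probability (Omega R d) R) :
  stationary_process P -> cvgn (energy_density H P) ->
  specific_entropy pi P + mean_energy H P + pressure pi H = 0 ->
  \int[P]_w (t * K w)%:E <= (ln (1 + 2 * t ^+ 2))%:E.
Proof.
move=> P_proc Pc E0.
have h := cvg_free_energy P_proc Pc; rewrite E0 in h.
set s := (2 * N + 1)%N.
have s0 : (0 < s)%N by rewrite /s addn1.
have /andP[tgt0 t2] := t01.
have Ki : P.-integrable setT (fun w => (t * K w)%:E).
  apply: (@bounded_integrable _ _ _ _ t).
    by apply: measurable_funM => //; exact: measurable_gibbs_defect.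
  by move=> w; rewrite normrM (ger0_norm (ltW tgt0)) ler_piMr ?(ltW tgt0)// gibbs_defect_le1.
pose x := fine (\int[P]_w (t * K w)%:E).
have xE : \int[P]_w (t * K w)%:E = x%:E by rewrite fineK// integrable_fin_num.
rewrite xE lee_fin -subr_le0.
set y := (x - _)%R.
have yE : \int[P]_w (t * K w - ln (1 + 2 * t ^+ 2))%:E = y%:E.
  under eq_integral do rewrite EFinB.
  rewrite integralB//; last exact: finite_measure_integrable_cst.
  by rewrite integral_prob_cst xE.
have c1 : ((((2 * n %/ s) ^ d)%:R / ((2 * n) ^ d)%:R * y : R)%R)%:E @[n --> \oo] -->
    ((s ^ d)%:R^-1 * y)%:E.
  by apply: cvg_EFin; [exact: nearW|]; apply: cvgMl; exact: cvg_packing_ratio.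
have : ((s ^ d)%:R^-1 * y)%:E <= 0.
  rewrite -(cvg_lim _ c1)// -(cvg_lim _ h)//.
  apply: lee_lim.
  - by apply/cvg_ex; eexists; exact: c1.
  - by apply/cvg_ex; eexists; exact: h.
  near=> n; have n0 : (0 < n)%N by near: n; exact: nbhs_infty_gt.
  rewrite lebesgue_rV_cube inver gt_eqF ?vol_gt0// lee_pdivlMr ?vol_gt0//.
  rewrite -EFinM mulrAC divfK ?gt_eqF ?vol_gt0// EFinM -yE.
  apply: block_average_le => //; exact: leq_trunc_div.
rewrite lee_fin pmulr_rle0// invr_gt0 ltr0n expn_gt0 s0//.
Unshelve. all: by end_near. Qed.

End tilting.

Lemma lee_complement (a b c e : \bar R) : a + b = 1 -> c + e = 1 ->
  0 <= a -> 0 <= b -> 0 <= c -> 0 <= e -> b <= e -> c <= a.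
Proof.
case: a => [a| |]//; case: b => [b| |]//; case: c => [c| |]//; case: e => [e| |]//.
by rewrite -!EFinD => -[ab] [ce] _ _ _ _; rewrite !lee_fin; lra.
Qed.

Lemma gibbs_density_lty L w : gibbs_density pi H L w < +oo.
Proof.
rewrite gibbs_densityE lte_mul_pinfty ?lee_fin ?invr_ge0 ?(ltW (lpart_gt0 L w))//.
have := local_energy_gtNy H_gtNy H_hereditary r_ge0 H_range rr0 L w.
by case: (local_energy _ _ _) => [x| |]//= _; rewrite ltry.
Qed.

(** By heredity it suffices to test countably many cubes, which makes the set measurable. *)
Lemma locally_finite_energyE : locally_finite_energy H =
  \bigcap_n [set w : Omega R d | H (restrict_config (@cube R d n) w) < +oo].
Proof.
apply/seteqP; split=> w /= wf; first by move=> n _; exact: (wf (cube n)).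
move=> L; have [n Ln] := bounded_set_cube (window_bounded L).
rewrite ltey; apply/eqP => Hy; have := wf n I.
by rewrite /= (energy_restrict_eqy H_hereditary Ln Hy) ltxx.
Qed.

Lemma measurable_locally_finite_energy :
  measurable (locally_finite_energy H : set (Omega R d)).
Proof.
rewrite locally_finite_energyE; apply: bigcapT_measurable => n.
rewrite (_ : [set w | _] = setT `&`
   (fun w : Omega R d => H (restrict_config (@cube R d n) w)) @^-1` [set x | x < +oo]).
  apply: measurable_energy => //.
  rewrite (_ : [set x | x < +oo] = ~` [set +oo]); first exact: measurableC.
  by apply/seteqP; split=> x /=; rewrite ltey => /eqP.
by rewrite setTI.
Qed.

Section equality_case.
Variable P : probability (Omega R d) R.
Hypothesis P_proc : stationary_process P.
Hypothesis P_energy : cvgn (energy_density H P).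
Hypothesis P_eq : specific_entropy pi P + mean_energy H P + pressure pi H = 0.

(** Equality excludes infinite mean energy, so the energies of large cubes are integrable, hence
    almost surely finite; heredity passes this to smaller cubes. *)
Lemma gibbs_locally_finite_energy : P (locally_finite_energy H) = 1.
Proof.
have Hoo : mean_energy H P < +oo.
  rewrite ltey; apply/eqP => Hy; move: P_eq.
  rewrite Hy addey ?addye//.
  - by rewrite gt_eqF// pressure_gtNy.
  - by rewrite gt_eqF// (lt_le_trans _ (specific_entropy_ge0 P_proc)).
have near_lty : \forall n \near \oo, energy_density H P n < +oo.
  have : nbhs (mean_energy H P) [set x | x < +oo].
    by apply: open_nbhs_nbhs; split=> //; exact: open_ereal_lt_ereal.
  by move=> /P_energy.
have ae n : {ae P, forall w, H (restrict_config (@cube R d n) w) < +oo}.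
  have [k [nk k0 Ek]] : exists k, [/\ (n <= k)%N, (0 < k)%N & energy P k < +oo].
    have [k0 _ hk] := near_lty.
    exists (maxn k0 n.+1); split; [by rewrite (leq_trans (leqnSn n))// leq_maxr| |].
      by rewrite (leq_trans _ (leq_maxr _ _)).
    have v0 : (0 < maxn k0 n.+1)%N by rewrite (leq_trans _ (leq_maxr _ _)).
    have := hk _ (leq_maxl k0 n.+1).
    rewrite /energy_density lebesgue_rV_cube inver gt_eqF ?vol_gt0//.
    case: (\int[P]_w _) => [x| |]//; first by move=> _; exact: ltry.
    by rewrite gt0_mulye// lte_fin invr_gt0 vol_gt0.
  have := integrable_ae measurableT (energy_integrable P_proc k0 Ek).
  apply: filterS => w /(_ I) fin.
  rewrite ltey; apply/eqP => Hy; move: fin.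
  by rewrite (energy_restrict_eqy H_hereditary (subset_cube nk) Hy).
have N0 : P (~` locally_finite_energy H) = 0.
  have m := measurableC measurable_locally_finite_energy.
  apply: measure_negligible => //.
  move: (ae_foralln ae) => [B [mB B0 hB]]; exists B; split=> // w Hw.
  apply: hB => /= all; apply: Hw; rewrite locally_finite_energyE => n _.
  exact: all.
have := probability_setC P (measurableC measurable_locally_finite_energy).
by rewrite setCK => ->; rewrite N0 sube0.
Qed.

Lemma integral_gibbs_average_le L N (G : Omega R d -> R) :
  minkowski_sum L (euclidean_ball r) `<=` @cube R d N -> measurable_fun setT G ->
  (forall w, (0 <= G w <= 1)%R) -> (forall w, G (restrict_config (cube N) w) = G w) ->
  \int[P]_w (G w)%:E <= \int[P]_w gibbs_kernel L (fun w => (G w)%:E) w.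
Proof.
move=> LN mG G01 GN.
under [leRHS]eq_integral do rewrite -gibbs_averageE//.
have Gi : P.-integrable setT (fun w => (G w)%:E).
  apply: (@bounded_integrable _ _ _ _ 1%R) => // w.
  by have /andP[G0 G1] := G01 w; rewrite ger0_norm.
have phii : P.-integrable setT (fun w => (gibbs_average L G w)%:E).
  apply: (@bounded_integrable _ _ _ _ 1%R); first exact: measurable_gibbs_average.
  by move=> w; have /andP[G0 G1] := gibbs_average_itv L mG G01 w; rewrite ger0_norm.
have Ki : P.-integrable setT (fun w => (gibbs_defect L G w)%:E).
  by apply: (eq_integrable measurableT (fun w => (G w)%:E - (gibbs_average L G w)%:E)) => //;
    exact: integrableB.
pose x := fine (\int[P]_w (gibbs_defect L G w)%:E).
have xE : \int[P]_w (gibbs_defect L G w)%:E = x%:E.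
  by rewrite fineK// integrable_fin_num.
(* Here ln(1 + 2t^2) <= 2t^2, and one factor t is divided out. *)
have small (t : R) : (0 < t <= 2^-1)%R -> (x <= 2 * t)%R.
  move=> t01; have /andP[t0 _] := t01.
  have := integral_gibbs_defect_le LN mG G01 GN t01 P_proc P_energy P_eq.
  under eq_integral do rewrite EFinM.
  rewrite integralZl// xE -EFinM lee_fin => h.
  have : (t * x <= t * (2 * t))%R.
    apply: (le_trans h); rewrite -[leRHS]expRK ler_ln ?posrE ?expR_gt0//.
      by rewrite (le_trans (expR_ge1Dx _))// ler_expR; rewrite le_eqVlt; apply/orP; left; apply/eqP; ring.
    by rewrite ltr_wpDr// mulr_ge0// sqr_ge0.
  by rewrite ler_pM2l.
have : (x <= 0)%R.
  rewrite leNgt; apply/negP => x0.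
  (* For x > 0 this choice of t gives x <= x/2, a contradiction. *)
  have := small (Num.min (x / 4) 2^-1)%R.
  rewrite lt_min divr_gt0//= invr_gt0 ltr0n/= ge_min lexx orbT => /(_ isT).
  have : (Num.min (x / 4) 2^-1 <= x / 4)%R by rewrite ge_min lexx.
  lra.
rewrite -lee_fin -xE.
have -> : \int[P]_w (gibbs_defect L G w)%:E =
    \int[P]_w (G w)%:E - \int[P]_w (gibbs_average L G w)%:E.
  by rewrite -integralB//; apply: eq_integral => w _; rewrite -EFinB.
have := integrable_fin_num measurableT phii.
by case: (\int[P]_w (gibbs_average L G w)%:E) => // y _; rewrite leeBlDr// add0e.
Qed.

Lemma integral_local_gibbs_kernel L N (G : Omega R d -> R) :
  minkowski_sum L (euclidean_ball r) `<=` @cube R d N -> measurable_fun setT G ->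
  (forall w, (0 <= G w <= 1)%R) -> (forall w, G (restrict_config (cube N) w) = G w) ->
  \int[P]_w (G w)%:E = \int[P]_w gibbs_kernel L (fun w => (G w)%:E) w.
Proof.
move=> LN mG G01 GN; apply/eqP; rewrite eq_le; apply/andP; split.
  exact: (integral_gibbs_average_le LN).
pose G' w := (1 - G w)%R.
have mG' : measurable_fun setT G' by exact: measurable_funB.
have G'01 w : (0 <= G' w <= 1)%R.
  by have /andP[? ?] := G01 w; rewrite /G'; apply/andP; split; lra.
have mGE : measurable_fun setT (fun w => (G w)%:E) by exact/measurable_EFinP.
have mG'E : measurable_fun setT (fun w => (G' w)%:E) by exact/measurable_EFinP.
have G0 w : 0 <= (G w)%:E by have /andP[] := G01 w; rewrite lee_fin.
have G'0 w : 0 <= (G' w)%:E by have /andP[] := G'01 w; rewrite lee_fin.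
have := integral_gibbs_average_le LN mG' G'01.
have -> : (forall w, G' (restrict_config (cube N) w) = G' w) = True.
  by rewrite propeqE; split=> // _ w; rewrite /G' GN.
move=> /(_ I).
have mk := measurable_gibbs_kernel L mGE G0.
have mk' := measurable_gibbs_kernel L mG'E G'0.
have k0 w := gibbs_kernel_ge0 L w G0.
have k'0 w := gibbs_kernel_ge0 L w G'0.
have s1 : \int[P]_w (G w)%:E + \int[P]_w (G' w)%:E = 1.
  rewrite -ge0_integralD//; rewrite -[RHS](integral_prob_cst P 1).
  by apply: eq_integral => w _; rewrite -EFinD /G' addrC subrK.
have s2 : \int[P]_w gibbs_kernel L (fun w => (G w)%:E) w +
    \int[P]_w gibbs_kernel L (fun w => (G' w)%:E) w = 1.
  rewrite -ge0_integralD//; rewrite -[RHS](integral_prob_cst P 1).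
  apply: eq_integral => w _; rewrite -gibbs_kernelD//.
  rewrite -[RHS](gibbs_kernel_cst L w (lee01)).
  apply: eq_integral => w' _; congr (_ * _).
  by rewrite -EFinD /G' addrC subrK.
have a0 : 0 <= \int[P]_w (G w)%:E by exact: integral_ge0.
have b0 : 0 <= \int[P]_w (G' w)%:E by exact: integral_ge0.
have c0 : 0 <= \int[P]_w gibbs_kernel L (fun w => (G w)%:E) w by exact: integral_ge0.
have d0 : 0 <= \int[P]_w gibbs_kernel L (fun w => (G' w)%:E) w by exact: integral_ge0.
exact: lee_complement s1 s2 a0 b0 c0 d0.
Qed.

Section specification_measure.
Variable L : window R d.

Let D (z : Omega R d * Omega R d) := gibbs_density pi H L (glue L z.2 z.1).

Let mD : measurable_fun setT D.
Proof. exact: (measurableT_comp (measurable_gibbs_density L) (measurable_glue_pair L)). Qed.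

Let D0 z : 0 <= D z. Proof. exact: gibbs_density_ge0. Qed.

(** The law obtained by resampling [L] under [P]. As a measure it can be compared with [P] on a
    generating class, which extends the Gibbs equation from local functions to all. *)
Let Q : {measure set (Omega R d) -> \bar R} :=
  @image_density _ _ _ _ _ (pi \x P) _ _ (measurable_glue_pair L) mD D0.

Let QE (f : Omega R d -> \bar R) : measurable_fun setT f -> (forall w, 0 <= f w) ->
  \int[Q]_w f w = \int[P]_w gibbs_kernel L f w.
Proof.
move=> mf f0; rewrite ge0_integral_image_density//; last first.
  by move=> z; exact: gibbs_density_lty.
rewrite fubini_tonelli2//.
- apply: emeasurable_funM => //.
  exact: (measurableT_comp mf (measurable_glue_pair L)).
- by move=> z; rewrite mule_ge0.
Qed.

(** Counting events generate the configurations and depend on finitely many bounded windows, so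
    their indicators fit in one cube together with [L] and its range. *)
Lemma integral_gibbs_kernel (f : Omega R d -> \bar R) :
  measurable_fun setT f -> (forall w, 0 <= f w) ->
  \int[P]_w f w = \int[P]_w gibbs_kernel L f w.
Proof.
move=> mf f0; rewrite -QE//; apply: eq_measure_integral => B mB _.
move: B mB {mf f0}; apply: (@measure_eq_count_events R d P Q).
  by rewrite [X in X < _](probability_setT P) ltry.
move=> I L' k.
have mE := measurable_count_event L' k.
pose G : Omega R d -> R := \1_(count_event L' k).
have mG : measurable_fun setT G by exact: measurable_indic.
have [N LN] : exists N, (minkowski_sum L (euclidean_ball r) `<=` @cube R d N) /\
    forall i, L' i `<=` @cube R d N.
  have [n0 _ Ln0] := exists_range_window rr0 L.
  have /choice[nu hnu] i := bounded_set_cube (window_bounded (L' i)).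
  exists (maxn (n0 + r0) (\max_i nu i)); split.
    by apply: subset_trans Ln0 _; apply: subset_cube; exact: leq_maxl.
  move=> i; apply: subset_trans (hnu i) _; apply: subset_cube.
  by rewrite (leq_trans _ (leq_maxr _ _))// leq_bigmax.
case: LN => LN L'N.
have G01 w : (0 <= G w <= 1)%R.
  by rewrite /G indicE; case: (_ \in _); rewrite ?ler01 ?lexx.
have GN w : G (restrict_config (cube N) w) = G w.
  rewrite /G !indicE; congr (_%:R); congr (nat_of_bool _).
  apply/idP/idP; rewrite !inE /count_event /= => h i; have := h i;
    by rewrite npoints_restrict setIidr.
have := integral_local_gibbs_kernel LN mG G01 GN.
rewrite -QE; last 2 first.
- exact/measurable_EFinP.
- by move=> w; rewrite lee_fin; case/andP: (G01 w).
by rewrite !integral_indic// !setIT.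
Qed.

End specification_measure.

Lemma equality_gibbs : gibbs pi H P.
Proof.
split; first exact: gibbs_locally_finite_energy.
move=> L g mg [M gM].
have M0 : (0 <= M)%R by rewrite (le_trans _ (gM point)).
(* A bounded [g] is raised to a non-negative function; the kernel preserves the constant [M], which
   is then subtracted. *)
pose f w := (g w + M)%:E.
have mf : measurable_fun setT f by apply/measurable_EFinP; exact: measurable_funD.
have f0 w : 0 <= f w.
  by rewrite lee_fin; have := gM w; rewrite ler_norml => /andP[? _]; lra.
have fM w : f w <= (M + M)%:E.
  by rewrite lee_fin lerD2r; have := gM w; rewrite ler_norml => /andP[_ ?].
have inner w : \int[restricted_law pi L]_w' ((g (glue L w w'))%:E *
    gibbs_density pi H L (glue L w w')) = gibbs_kernel L f w - M%:E.
  have dens_int (F : Omega R d -> \bar R) (c : R) : (0 <= c)%R ->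
      measurable_fun setT F -> (forall w, 0 <= F w) -> (forall w, F w <= c%:E) ->
      (restricted_law pi L).-integrable setT
        (fun w' => F (glue L w w') * gibbs_density pi H L (glue L w w')).
    move=> c0 mF F0 Fc; apply/integrableP; split.
      apply: emeasurable_funM.
        exact: (measurableT_comp mF (measurable_glue_in L w)).
      exact: (measurableT_comp (measurable_gibbs_density L) (measurable_glue_in L w)).
    rewrite [X in X < _](_ : _ = gibbs_kernel L F w); last first.
      rewrite -gibbs_kernel_restricted_law//; apply: eq_integral => w' _.
      by rewrite gee0_abs// mule_ge0// gibbs_density_ge0.
    apply: (@le_lt_trans _ _ (gibbs_kernel L (cst c%:E) w)).
      exact: le_gibbs_kernel.
    by rewrite gibbs_kernel_cst ?lee_fin// ltry.
  have MM : (0 <= M + M)%R by rewrite addr_ge0.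
  have i1 := dens_int f (M + M)%R MM mf f0 fM.
  have i2 := dens_int (cst M%:E) M M0 (measurable_cst _) (fun=> M0) (fun=> lexx _).
  rewrite -(gibbs_kernel_cst L w (c := M%:E))// -!gibbs_kernel_restricted_law//.
  rewrite -integralB//; apply: eq_integral => w' _.
  have : gibbs_density pi H L (glue L w w') \is a fin_num.
    by rewrite ge0_fin_numE ?gibbs_density_ge0// gibbs_density_lty.
  case: (gibbs_density _ _ _ _) => // x _ /=.
  by rewrite -!EFinM -EFinB /f; congr (_%:E); ring.
transitivity (\int[P]_w (gibbs_kernel L f w - M%:E)); last first.
  by apply: eq_integral => w _; rewrite -inner.
have k0 w := gibbs_kernel_ge0 L w f0.
have kM w : gibbs_kernel L f w <= (M + M)%:E.
  rewrite -[leRHS](gibbs_kernel_cst L w (c := (M + M)%:E)) ?lee_fin ?addr_ge0//.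
  exact: le_gibbs_kernel.
have bint (F : Omega R d -> \bar R) : measurable_fun setT F -> (forall w, 0 <= F w) ->
    (forall w, F w <= (M + M)%:E) -> P.-integrable setT F.
  move=> mF F0 FM; apply/integrableP; split=> //.
  under eq_integral do rewrite gee0_abs//.
  apply: (@le_lt_trans _ _ (\int[P]_w (M + M)%:E)); first exact: ge0_le_integral.
  by rewrite integral_prob_cst ltry.
rewrite integralB//; last 2 first.
- by apply: bint => //; exact: measurable_gibbs_kernel.
- exact: finite_measure_integrable_cst.
rewrite -integral_gibbs_kernel// -integralB//; last 2 first.
- exact: bint.
- exact: finite_measure_integrable_cst.
by apply: eq_integral => w _; rewrite /f -EFinB addrK.
Qed.

End equality_case.

(** * Gibbs measures attain equality *)

(** Quotient of the void probabilities of the two cubes, by independence; the volume of the annulus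
    need not be computed. *)
Lemma annulus_void k n : (k <= n)%N ->
  pi [set w | npoints (windowD (cube n) (@cube R d k)) w = 0%N] =
  (expR (- (vol n - vol k)))%:E.
Proof.
move=> kn; set C := windowD _ _.
pose f B (w : Omega R d) : \bar R := (npoints B w == 0%N)%:R%:E.
have mf (B : window R d) : measurable_fun setT (f B) by exact: measurable_void.
have f0 B w : 0 <= f B w by rewrite lee_fin.
have volE m : fine (lebesgue_rV (@cube R d m)) = vol m by rewrite lebesgue_rV_cube.
have fE (B : window R d) : \int[pi]_w f B (restrict_config B w) =
    pi [set w | npoints B w = 0%N].
  by rewrite -integral_void; apply: eq_integral => w _; rewrite /f npoints_restrict setIid.
have disj : cube k `&` C = set0 by apply/seteqP; split=> // x [? []].
have := poisson_indep2 pi_poisson disj (mf (cube k)) (mf C) (f0 _) (f0 _).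
rewrite !fE (poisson_void pi_poisson) volE.
have -> : \int[pi]_w (f (cube k) (restrict_config (cube k) w) * f C (restrict_config C w)) =
    \int[pi]_w f (cube n) (restrict_config (cube n) w).
  apply: eq_integral => w _; rewrite /f !npoints_restrict !setIid -EFinM -natrM mulnb.
  congr (_%:R%:E); congr (nat_of_bool _).
  rewrite -addn_eq0 -npointsU//; first by rewrite setDUK//; exact: subset_cube.
  - exact: window_bounded.
  - exact: (window_bounded C).
rewrite fE (poisson_void pi_poisson) volE.
have : pi [set w | npoints C w = 0%N] \is a fin_num.
  by apply: fin_num_measure; exact: measurable_npoints_eq.
case: (pi _) => // x _; rewrite -EFinM => -[E]; congr EFin.
by rewrite opprB expRD E mulrA -expRD subrr expR0 mul1r.
Qed.

Lemma restrict_glue_in L (B : set 'rV[R]_d) w w' : B `<=` L ->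
  restrict_config B (glue L w w') = restrict_config B w'.
Proof.
move=> BL; apply: config_ext; apply/seteqP; split=> x /= [].
  by move=> [[wx _]|[_ nLx]] Bx//; case: nLx; exact: BL.
by move=> wx Bx; split=> //; left; split=> //; exact: BL.
Qed.

(** Only interiors with empty annulus of width [r0] are kept. Their points lie in the inner cube,
    out of range of the boundary condition, so the local energy is the free energy function of the
    inner cube. *)
Lemma local_partition_ge_free k w : locally_finite_energy H w ->
  (zfree k * expR (- (vol (k + r0) - vol k)) <= lpart (cube (k + r0)) w)%R.
Proof.
move=> wf; set n := (k + r0)%N; set L := cube n : window R d.
set C := windowD L (cube k).
have kn : (k <= n)%N by rewrite leq_addr.
have kL : cube k `<=` L := subset_cube kn.
have disj : cube k `&` C = set0 by apply/seteqP; split=> // x [? []].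
pose f (v : Omega R d) : \bar R := expeR (- H (restrict_config (cube k) v)).
pose g (v : Omega R d) : \bar R := (npoints C v == 0%N)%:R%:E.
have mf : measurable_fun setT f by exact: measurable_expe_energy.
have mg : measurable_fun setT g by exact: measurable_void.
have f0 v : 0 <= f v by exact: expeR_ge0.
have g0 v : 0 <= g v by rewrite lee_fin.
rewrite -lee_fin EFinM lpartE -annulus_void// -integral_void zfreeE.
rewrite (_ : free_partition _ = \int[pi]_v f (restrict_config (cube k) v)); last first.
  by apply: eq_integral => v _; rewrite /f restrict_config_sub.
rewrite (_ : \int[pi]_v _%:R%:E = \int[pi]_v g (restrict_config C v)); last first.
  by apply: eq_integral => v _; rewrite /g npoints_restrict setIid.
rewrite -(poisson_indep2 pi_poisson disj mf mg f0 g0).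
apply: ge0_le_integral => //.
- by move=> v _; rewrite mule_ge0.
- by apply: emeasurable_funM; exact: measurable_comp_restrict.
move=> w' _; rewrite /g npoints_restrict setIid.
have [C0|] := eqVneq (npoints C w') 0%N; last by rewrite mule0 expeR_ge0.
rewrite mule1 /f restrict_config_sub//.
set L' := cube (n + r0) : window R d.
have LL' : minkowski_sum L (euclidean_ball r) `<=` L' by exact: minkowski_sum_cube.
rewrite (local_energyE r_ge0 H_range _ LL') /energy_in.
set D := windowD L' L.
have DE : restrict_config D (glue L w w') = restrict_config D w.
  by rewrite restrict_glue_out//; apply/seteqP; split=> // x [[]].
have kL' : minkowski_sum (@cube R d k) (euclidean_ball r) `<=` L.
  exact: minkowski_sum_cube.
have LD : L `&` D = set0 by apply/seteqP; split=> // x [? []].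
have w'C := npoints_eq0 (window_bounded C) C0.
have -> : restrict_config L' (glue L w w') = restrict_config (cube k `|` D) (glue L w w').
  apply: config_ext; apply/seteqP; split=> x /=.
    move=> [[[wx Lx]|[wx nLx]] L'x]; split=> //; [by left|left|by right|by right].
    apply: contrapT => nkx; have : (w' `&` C) x by [].
    by rewrite w'C.
  move=> [gx [kx|[L'x _]]]; split=> //.
  by apply: (subset_trans kL (subset_cube (leq_addr r0 n))).
rewrite (energy_separated H_gtNy H_hereditary H_non_degenerate r_ge0 H_range _ kL' LD).
rewrite restrict_glue_in//.
rewrite -[restrict_config (L' `\` L) _]/(restrict_config D (glue L w w')) DE.
have := energy_gtNy H_gtNy D w; have := wf D.
(* The outer energy must be finite to cancel in the difference; this is where [wf] is used. *)
case: (H (restrict_config D w)) => [h| |]// _ _.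
by rewrite /energy_diff /= andbF addeK.
Qed.

Section gibbs_equality.
Variable P : probability (Omega R d) R.
Hypothesis P_gibbs : gibbs pi H P.

Lemma gibbs_integral L (g : Omega R d -> R) (M : R) : measurable_fun setT g ->
  (forall w, (0 <= g w <= M)%R) ->
  \int[P]_w (g w)%:E = \int[P]_w gibbs_kernel L (fun w => (g w)%:E) w.
Proof.
move=> mg gM; have [_ P_dlr] := P_gibbs.
rewrite (P_dlr L g mg); last first.
  by exists M => w; have /andP[g0 ?] := gM w; rewrite ger0_norm.
apply: eq_integral => w _.
rewrite -[RHS]gibbs_kernel_restricted_law//; first exact/measurable_EFinP.
by move=> w'; have /andP[] := gM w'; rewrite lee_fin.
Qed.

Lemma ae_locally_finite_energy : {ae P, forall w : Omega R d, locally_finite_energy H w}.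
Proof.
have m := measurable_locally_finite_energy.
exists (~` locally_finite_energy H); split.
- exact: measurableC.
- rewrite -[X in X = 0]/(P _) (probability_setC P m) (proj1 P_gibbs).
  by rewrite subee.
- by move=> w.
Qed.

Lemma fin_num_integrable (f : Omega R d -> \bar R) : measurable_fun setT f ->
  \int[P]_w f w \is a fin_num -> P.-integrable setT f.
Proof.
move=> mf; rewrite integralE => fin; apply/integrableP; split=> //.
have -> : \int[P]_w `|f w| = \int[P]_w (f^\+ w + f^\- w).
  by apply: eq_integral => w _; rewrite -[LHS]/((abse \o f) w) fune_abse.
rewrite ge0_integralD//; [|exact: measurable_funepos|exact: measurable_funeneg].
have p0 : 0 <= \int[P]_w f^\+ w by apply: integral_ge0.
have n0 : 0 <= \int[P]_w f^\- w by apply: integral_ge0.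
move: fin p0 n0; move: (\int[P]_w f^\+ w) (\int[P]_w f^\- w).
by case=> [a| |] [b| |]// _ _ _; rewrite -EFinD ltry.
Qed.

Lemma measurable_boundary_energy L : measurable_fun setT (boundary_energy H L : Omega R d -> _).
Proof.
apply: measurable_energy_diff; first exact: (measurable_local_energy H_meas r_ge0 H_range rr0).
exact: measurable_energy.
Qed.

Lemma measurable_inverse_density L (h : Omega R d -> R) (e : R) : measurable_fun setT h ->
  measurable_fun setT (fun w : Omega R d =>
    (expR (h (restrict_config L w)) * lpart L w / e)%:E * expeR (local_energy H L w)).
Proof.
move=> mh; have mle : measurable_fun setT (local_energy H L : Omega R d -> _).
  exact: (measurable_local_energy H_meas r_ge0 H_range rr0).
apply: emeasurable_funM; last exact: (measurableT_comp measurable_expeR mle).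
apply/measurable_EFinP; apply: measurable_funM => //.
apply: measurable_funM; last exact: measurable_lpart.
apply: measurableT_comp => //.
exact: (measurableT_comp mh (measurable_window_restrict L)).
Qed.

(* [q] is the reciprocal of the local Gibbs density, tilted by the test function [h]. *)
Lemma integral_inverse_density_le1 L (h : Omega R d -> R) (e M : R) :
  measurable_fun setT h -> (forall w, `|h w| <= M)%R -> (0 < e)%R ->
  \int[pi]_w (expR (h (restrict_config L w)))%:E <= e%:E ->
  \int[P]_w ((expR (h (restrict_config L w)) * lpart L w / e)%:E *
     expeR (local_energy H L w)) <= 1.
Proof.
move=> mh hM e0 he; set q := (X in integral _ _ X).
have mhL : measurable_fun setT (fun w => expR (h (restrict_config L w))).
  apply: measurableT_comp => //.
  exact: (measurableT_comp mh (measurable_window_restrict L)).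
have mq : measurable_fun setT q := measurable_inverse_density L e mh.
have c0 w : (0 < expR (h (restrict_config L w)) * lpart L w / e)%R.
  by rewrite divr_gt0// mulr_gt0 ?expR_gt0 ?lpart_gt0.
have q0 w : 0 <= q w by rewrite mule_ge0 ?expeR_ge0// lee_fin ltW.
(* The Gibbs equation only tests bounded functions, whence the truncation of [q]. *)
apply: le_integral_truncation => // k.
pose g w := fine (mine (q w) k%:R%:E).
have gE w : (g w)%:E = mine (q w) k%:R%:E.
  rewrite fineK// ge0_fin_numE; last by rewrite le_min q0 lee_fin/=.
  by rewrite gt_min ltry orbT.
have mg : measurable_fun setT g.
  by apply: measurableT_comp => //; exact: measurable_mine.
have gk w : (0 <= g w <= k%:R)%R.
  apply/andP; split; rewrite -lee_fin gE; first by rewrite le_min q0 lee_fin/=.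
  by rewrite ge_min lexx orbT.
under eq_integral do rewrite -gE.
rewrite (gibbs_integral L mg gk).
have mk : measurable_fun setT (gibbs_kernel L (fun w => (g w)%:E)).
  apply: measurable_gibbs_kernel; first exact/measurable_EFinP.
  by move=> w; have /andP[] := gk w; rewrite lee_fin.
rewrite -[leRHS](integral_prob_cst P 1); apply: ge0_le_integral => //.
  move=> w _; apply: gibbs_kernel_ge0 => w'.
  by have /andP[] := gk w'; rewrite lee_fin.
(* The Gibbs density cancels its reciprocal and leaves exp(h)/e; where the local energy is infinite
   the density is 0, so only an inequality remains. *)
move=> w _; apply: (@le_trans _ _ (\int[pi]_w' (e^-1%:E *
    (expR (h (restrict_config L w')))%:E))); last first.
  rewrite ge0_integralZl_EFin ?invr_ge0 ?(ltW e0)//.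
    apply: (@le_trans _ _ (e^-1%:E * e%:E)).
      by rewrite lee_wpmul2l ?lee_fin ?invr_ge0 ?(ltW e0).
    by rewrite -EFinM mulVf ?gt_eqF.
  exact/measurable_EFinP.
apply: ge0_le_integral => //.
- move=> w' _; rewrite mule_ge0 ?gibbs_density_ge0//.
  by have /andP[] := gk (glue L w w'); rewrite lee_fin.
- apply: emeasurable_funM.
    by apply/measurable_EFinP; exact: (measurableT_comp mg (measurable_glue_in L w)).
  exact: (measurableT_comp (measurable_gibbs_density L) (measurable_glue_in L w)).
- by apply/measurable_EFinP; exact: measurable_funM.
move=> w' _; set v := glue L w w'.
have hv : h (restrict_config L v) = h (restrict_config L w').
  by rewrite /v restrict_glue_in.
have := local_energy_gtNy H_gtNy H_hereditary r_ge0 H_range rr0 L v.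
have l0 := lpart_gt0 L v; have gq : (g v)%:E <= q v by rewrite gE ge_min lexx.
move: gq; rewrite gibbs_densityE /q hv.
case: (local_energy H L v) => [x| |]// gq _; last first.
  by rewrite /= mule0 mule0 -EFinM lee_fin mulr_ge0 ?invr_ge0 ?expR_ge0// ltW.
rewrite /= -!EFinM !lee_fin in gq *.
apply: (@le_trans _ _ (expR (h (restrict_config L w')) * lpart L v / e * expR x *
   ((lpart L v)^-1 * expR (- x)))%R).
  by rewrite ler_wpM2r// mulr_ge0 ?expR_ge0// invr_ge0 ltW.
rewrite le_eqVlt; apply/orP; left; apply/eqP.
have ee : (expR x * expR (- x) = 1)%R by rewrite -expRD subrr expR0.
have -> : (expR (h (restrict_config L w')) * lpart L v / e * expR x *
  ((lpart L v)^-1 * expR (- x)) = (lpart L v / lpart L v) * (expR x * expR (- x)) *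
  (e^-1 * expR (h (restrict_config L w'))))%R by ring.
by rewrite divff ?gt_eqF// ee !mul1r.
Qed.

Hypothesis P_proc : stationary_process P.

(** The reciprocal density replaces that of the law of [P] in the window: Jensen's inequality bounds
    the mean of each test function, and the converse bound returns the entropy. *)
Lemma gibbs_entropy_le k : (0 < k + r0)%N ->
  \int[P]_w boundary_energy H (cube (k + r0)) w \is a fin_num ->
  entropy P (k + r0) + energy P (k + r0) + \int[P]_w boundary_energy H (cube (k + r0)) w
    <= (vol (k + r0) - vol k - ln (zfree k))%:E.
Proof.
set n := (k + r0)%N; set L := cube n : window R d => n0 bfin.
have bi := fin_num_integrable (measurable_boundary_energy L) bfin.
pose C : R := (vol n - vol k - ln (zfree k))%R.
have key (h : Omega R d -> R) (e M : R) : measurable_fun setT h ->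
    (forall w, `|h w| <= M)%R -> (0 < e)%R ->
    \int[pi]_w (expR (h (restrict_config L w)))%:E <= e%:E ->
    \int[P]_w (h (restrict_config L w))%:E + \int[P]_w boundary_energy H L w <=
    \int[P]_w (- H (restrict_config L w)) + (C + ln e)%:E.
  move=> mh hM e0 he.
  have q1 := integral_inverse_density_le1 mh hM e0 he.
  have hi : P.-integrable setT (fun w => (h (restrict_config L w))%:E).
    apply: (@bounded_integrable _ _ _ (fun w => h (restrict_config L w)) M) => //.
    exact: (measurableT_comp mh (measurable_window_restrict L)).
  rewrite -integralD//; apply: le_integral_exponential q1 _ => //.
  - exact: integrableD.
  - by apply: measurableT_comp => //; exact: measurable_energy.
  - exact: measurable_inverse_density.
  - move=> w; rewrite mule_ge0 ?expeR_ge0// lee_fin ltW//.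
    by rewrite divr_gt0// mulr_gt0 ?expR_gt0 ?lpart_gt0.
  case: ae_locally_finite_energy => B [mB B0 hB]; exists B; split=> // w nw.
  apply: hB => wf; apply: nw => /=.
  have lp : (- ln (lpart L w) <= C)%R.
    have := local_partition_ge_free k wf; rewrite -/n -/L => hl.
    rewrite lerNl /C opprB -[(ln _ - _)%R]/(ln (zfree k) + - (vol n - vol k))%R.
    rewrite -[(- (vol n - vol k))%R]expRK -lnM ?posrE ?expR_gt0 ?zfree_gt0//.
    by rewrite ler_ln ?posrE ?lpart_gt0// mulr_gt0 ?expR_gt0 ?zfree_gt0.
  have Hf : H (restrict_config L w) < +oo := wf L.
  have HNy := energy_gtNy H_gtNy L w.
  have lf : local_energy H L w < +oo.
    have [n' _ LW] := exists_range_window rr0 L.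
    rewrite (local_energyE r_ge0 H_range _ LW) /energy_in.
    have := wf (cube (n' + r0)); have := wf (windowD (cube (n' + r0)) L).
    have := energy_gtNy H_gtNy (windowD (cube (n' + r0)) L) w.
    rewrite /energy_diff /=.
    case: (H (restrict_config (_ `\` _) w)) => [a| |]//.
    by case: (H _) => [b| |]//= _ _ _; rewrite ltry.
  have lNy := local_energy_gtNy H_gtNy H_hereditary r_ge0 H_range rr0 L w.
  rewrite /boundary_energy /energy_diff.
  move: Hf HNy lf lNy; case: (H _) => [a| |]// _ _; case: (local_energy _ _ _) => [b| |]// _ _.
  rewrite /= -?EFinM -?EFinN -?EFinD lee_fin.
  set y := (h _); set l := lpart L w in lp *.
  have l0 : (0 < l)%R by exact: lpart_gt0.
  (* This is ln q <= q - 1, with ln q = h + ln Z - ln e + H_L for the conditional partition function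
     Z. *)
  have := expR_ge1Dx (y + ln l - ln e + b).
  rewrite !expRD expRN !lnK ?posrE//; lra.
have NE : \int[P]_w (- H (restrict_config L w)) = - energy P n.
  by rewrite integralN// fin_num_adde_defl// fin_numN; exact: energy_negative_part.
(* The test function 0 already excludes infinite energy, since the boundary term has finite mean. *)
have Efin : energy P n < +oo.
  have := key (cst 0%R) 1%R 0%R (measurable_cst _) _ ltr01 _.
  rewrite integral0 add0e NE; move: bfin; case: (\int[P]_w boundary_energy H L w) => // b _.
  case: (\int[P]_w H _) => [x| |]//= hx; first exact: ltry.
  have : b%:E <= -oo.
    apply: hx => [w|]; first by rewrite normr0.
    by under eq_integral do rewrite expR0; rewrite integral_prob_cst.
  by [].
have Ei := energy_integrable P_proc n0 Efin.
have Ef := integrable_fin_num measurableT Ei.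
rewrite -/L -/n.
have : entropy P n <= (C - fine (energy P n) - fine (\int[P]_w boundary_energy H L w))%:E.
  apply: local_relative_entropy_le => h e M mh hM e0 he.
  have := key h e M mh hM e0 he; rewrite NE.
  move: Ef bfin; case: (energy P n) => // E _; case: (\int[P]_w boundary_energy H L w) => // b _.
  have hi : P.-integrable setT (fun w => (h (restrict_config L w))%:E).
    apply: (@bounded_integrable _ _ _ (fun w => h (restrict_config L w)) M) => //.
    exact: (measurableT_comp mh (measurable_window_restrict L)).
  have := integrable_fin_num measurableT hi.
  case: (\int[P]_w _) => // x _; rewrite -EFinN -!EFinD !lee_fin /=; lra.
have I0 := local_entropy_ge0 P pi L.
move: Ef bfin I0; case: (energy P n) => // E _; case: (\int[P]_w boundary_energy H L w) => // b _.
case: (relative_entropy _ _) => // x _; rewrite -!EFinD !lee_fin /C /=; lra.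
Qed.

End gibbs_equality.

Lemma cvg_cube_ratio : (vol k / vol (k + r0) : R)%R @[k --> \oo] --> (1 : R)%R.
Proof.
rewrite (_ : (fun k => _) = fun k => (k%:R / (k + r0)%:R) ^+ d)%R; last first.
  apply/funext => k; rewrite !natrX -expr_div_n !natrM; congr (_ ^+ d)%R.
  by rewrite invfM mulrACA divff ?mul1r// pnatr_eq0.
rewrite -[X in _ --> X](expr1n R d).
apply: cvg_exprn; apply/cvgrPdist_le => e e0; near=> k.
have k0 : (0 < (k + r0)%:R :> R)%R.
  by rewrite ltr0n addn_gt0; apply/orP; left; near: k; exact: nbhs_infty_gt.
rewrite -{1}(divff (x := (k + r0)%:R)) ?gt_eqF// -mulrBl natrD addrAC subrr add0r.
rewrite ger0_norm ?divr_ge0// -natrD// ler_pdivrMr// -ler_pdivrMl// mulrC.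
rewrite natrD ler_wpDr//; near: k; exact: nbhs_infty_ger.
Unshelve. all: by end_near. Qed.

(** * Passing to the infinite-volume limit for a Gibbs measure *)

Section gibbs_limit.
Variable P : probability (Omega R d) R.
Hypothesis P_proc : stationary_process P.
Hypothesis P_energy : cvgn (energy_density H P).
Hypothesis P_gibbs : gibbs pi H P.
Hypothesis P_boundary : (\int[P]_w boundary_energy H (cube n) w) / lebesgue_rV (@cube R d n)
  @[n --> \oo] --> 0.

Lemma gibbs_free_energy_le0 : specific_entropy pi P + mean_energy H P + pressure pi H <= 0.
Proof.
have S0 := specific_entropy_ge0 P_proc; have Hy := mean_energy_gtNy P_proc P_energy.
have py := pressure_gtNy.
have SNy : -oo < specific_entropy pi P by rewrite (lt_le_trans _ S0).
have h1 := cvg_specific_entropy (proj1 P_proc).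
have h2 : (energy P n / lebesgue_rV (@cube R d n)) @[n --> \oo] --> mean_energy H P.
  exact: P_energy.
have d1 : specific_entropy pi P +? mean_energy H P.
  by apply: ltninfty_adde_def; rewrite inE.
have SHy : -oo < specific_entropy pi P + mean_energy H P by exact: lteNy_add.
have d2 : specific_entropy pi P + mean_energy H P +? 0.
  by apply: ltninfty_adde_def; rewrite inE.
have shift (u : nat -> \bar R) l : u n @[n --> \oo] --> l -> u (n + r0)%N @[n --> \oo] --> l.
  by rewrite -(cvg_shiftn r0).
have h3 : (entropy P (n + r0) / lebesgue_rV (@cube R d (n + r0)) +
    energy P (n + r0) / lebesgue_rV (@cube R d (n + r0)) +
    (\int[P]_w boundary_energy H (cube (n + r0)) w) / lebesgue_rV (@cube R d (n + r0)))
    @[n --> \oo] --> specific_entropy pi P + mean_energy H P.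
  rewrite -[X in _ --> X]adde0; apply: cvgeD => //; last exact: shift P_boundary.
  by apply: cvgeD => //; [exact: shift h1|exact: shift h2].
have rp : (vol k / vol (k + r0))%R%:E @[k --> \oo] --> 1.
  by apply: cvg_EFin; [exact: nearW|exact: cvg_cube_ratio].
(* The logarithm of the inner partition function is divided by the volume of the outer cube; the
   volume ratio tends to 1, so the product with the pressure is well defined. *)
have d3 : (1 : \bar R) *? pressure pi H by case: (pressure pi H) => //=; rewrite oner_neq0.
have h4 : ((vol k / vol (k + r0))%R%:E * (ln (zfree k) / vol k)%:E) @[k --> \oo]
    --> pressure pi H.
  by rewrite -[X in _ --> X]mul1e; apply: cvgeM => //; exact: pressure_cvg.
have d4 : specific_entropy pi P + mean_energy H P +? pressure pi H.
  by apply: ltninfty_adde_def; rewrite inE.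
have h5 : (entropy P (n + r0) / lebesgue_rV (@cube R d (n + r0)) +
    energy P (n + r0) / lebesgue_rV (@cube R d (n + r0)) +
    (\int[P]_w boundary_energy H (cube (n + r0)) w) / lebesgue_rV (@cube R d (n + r0)) +
    (vol n / vol (n + r0))%R%:E * (ln (zfree n) / vol n)%:E)
    @[n --> \oo] --> specific_entropy pi P + mean_energy H P + pressure pi H.
  by apply: cvgeD.
(* What the bound leaves is the relative volume of the annulus, which vanishes in the limit. *)
have rp0 : (1 - vol k / vol (k + r0))%R%:E @[k --> \oo] --> (0 : \bar R).
  apply: cvg_EFin; first exact: nearW.
  rewrite -[X in _ --> X](subrr (1 : R)%R); apply: cvgB; first exact: cvg_cst.
  exact: cvg_cube_ratio.
rewrite -(cvg_lim _ h5)// -(cvg_lim _ rp0)//; apply: lee_lim.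
- by apply/cvg_ex; eexists; exact: h5.
- by apply/cvg_ex; eexists; exact: rp0.
(* The boundary integrals are known to be finite only eventually, from convergence to a finite
   limit. *)
have bfin : \forall n \near \oo,
    \int[P]_w boundary_energy H (cube (n + r0)) w / lebesgue_rV (@cube R d (n + r0)) \is a fin_num.
  have := P_boundary; rewrite -(cvg_shiftn r0) => /fine_cvgP[].
  by [].
near=> k.
have k0 : (0 < k)%N by near: k; exact: nbhs_infty_gt.
have n0 : (0 < k + r0)%N by rewrite addn_gt0 k0.
have bk : \int[P]_w boundary_energy H (cube (k + r0)) w / lebesgue_rV (@cube R d (k + r0)) \is a fin_num.
  by near: k.
have vn := vol_gt0 n0; have vk := vol_gt0 k0.
have EN : -oo < energy P (k + r0) by rewrite (lt_le_trans _ (energy_ge P_proc n0))// ltNyr.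
have I0 := local_entropy_ge0 P pi (cube (k + r0)).
have {bk} bk : \int[P]_w boundary_energy H (cube (k + r0)) w \is a fin_num.
  move: bk; rewrite lebesgue_rV_cube inver gt_eqF//.
  case: (\int[P]_w _) => [b| |]//.
    by rewrite gt0_mulye// lte_fin invr_gt0.
  by rewrite gt0_mulNye// lte_fin invr_gt0.
have := gibbs_entropy_le P_gibbs P_proc n0 bk.
rewrite lebesgue_rV_cube inver gt_eqF//.
move: I0 EN bk; move: (entropy P (k + r0)) (energy P (k + r0)) (\int[P]_w boundary_energy _ _ _).
case=> [a| |] [b| |] [c| |]// a0 _ _.
rewrite -!EFinM -!EFinD !lee_fin => h.
rewrite -(ler_pM2r vn) !mulrDl mul1r mulNr.
have cancel x : (x * (vol (k + r0))^-1 * vol (k + r0) = x)%R by rewrite divfK// gt_eqF.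
rewrite !cancel.
rewrite (_ : vol k / vol (k + r0) * (ln (zfree k) / vol k) * vol (k + r0) = ln (zfree k))%R.
  lra.
by rewrite mulrAC divfK ?gt_eqF// mulrC divfK ?gt_eqF.
Unshelve. all: by end_near. Qed.

End gibbs_limit.

Lemma variational_principle (P : probability (Omega R d) R) :
  stationary_process P -> cvgn (energy_density H P) ->
  (gibbs pi H P -> (\int[P]_w boundary_energy H (cube n) w) / lebesgue_rV (@cube R d n)
    @[n --> \oo] --> 0) ->
  - pressure pi H <= specific_entropy pi P + mean_energy H P /\
  (specific_entropy pi P + mean_energy H P = - pressure pi H <-> gibbs pi H P).
Proof.
move=> P_proc P_energy P_boundary.
have ineq := variational_inequality P_proc P_energy; split=> //.
have py := pressure_gtNy.
have SHy : -oo < specific_entropy pi P + mean_energy H P.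
  apply: lteNy_add; last exact: mean_energy_gtNy.
  by rewrite (lt_le_trans _ (specific_entropy_ge0 P_proc)).
split=> [E|P_gibbs].
  apply: equality_gibbs => //; rewrite E; rewrite E in SHy.
  by case: (pressure pi H) py SHy => // p _ _; rewrite -EFinN -EFinD addNr.
move: ineq SHy py (gibbs_free_energy_le0 P_proc P_energy P_gibbs (P_boundary P_gibbs)).
case: (pressure pi H) => [p| |]//; case: (_ + mean_energy H P) => [x| |]//.
rewrite -EFinN -EFinD !lee_fin => px _ _ xp.
by congr EFin; lra.
Qed.

End specification.

End thermodynamics.

Theorem theorem1 (R : realType) (d : nat) (d_gt0 : (0 < d)%N)
    (pi : probability (Omega R d) R) (pi_poisson : poisson_process pi)
    (H : Omega R d -> \bar R)
    (H_meas : measurable_fun (finite_config : set (Omega R d)) H)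
    (H_gtNy : forall w, finite_config w -> H w != -oo)
    (H_stationary : stationary_energy H)
    (H_hereditary : hereditary H)
    (H_non_degenerate : non_degenerate H)
    (H_stable : stable H)
    (H_finite_range : finite_range H)
    (mean_energy_exists : forall P : probability (Omega R d) R,
       stationary_process P -> cvgn (energy_density H P))
    (boundary_negligible : forall P : probability (Omega R d) R,
       gibbs pi H P ->
       (\int[P]_w boundary_energy H (cube n) w) / lebesgue_rV (@cube R d n)
         @[n --> \oo] --> 0)
    (P : probability (Omega R d) R) (P_stationary : stationary_process P) :
  - pressure pi H <= specific_entropy pi P + mean_energy H P /\
  (specific_entropy pi P + mean_energy H P = - pressure pi H <-> gibbs pi H P).
Proof.
have [A A_gt0 H_st] := H_stable; have [r r_ge0 H_range] := H_finite_range.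
(* An integer bound on the range keeps enlarged cubes within the sequence of cubes. *)
have rr0 : (r <= (Num.truncn r).+1%:R)%R by exact/ltW/truncnS_gt.
apply: (variational_principle d_gt0 pi_poisson H_meas H_gtNy H_stationary
  H_hereditary H_non_degenerate A_gt0 H_st r_ge0 H_range rr0 P_stationary).
- exact: mean_energy_exists.
- exact: boundary_negligible.
Qed.
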